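(* Let $c_1, c_2, \ldots, c_m$ and $d_1, d_2, \ldots, d_n$ be non-negative integers and let $$f=(f_1,f_2,\ldots,f_n) : (\mathbb{D}, ds^2_{c_1}) \times \cdots \times (\mathbb{D}, ds^2_{c_m}) \to (\mathbb{D}, ds^2_{d_1}) \times \cdots \times (\mathbb{D}, ds^2_{d_n})$$ be a holomorphic isometry. Then, after a possible reparametrization, there exist positive integers $n_1, n_2, \ldots, n_m$ with $n_1+n_2+\cdots+n_m = n$ such that $f_1,\ldots,f_{n_1}$ depend on $z_1$ only, $f_{n_1+1},\ldots,f_{n_1+n_2}$ depend on $z_2$ only, and so on, till the final subset of components $f_{n_1+\cdots+n_{m-1}+1},\ldots,f_n$, which depend on $z_m$ only. In particular, with $n_0=0$, for each $1\le i\le m$ the $i$-th of these $m$ groups of component functions constitutes a holomorphic isometry from $(\mathbb{D}, ds^2_{c_i})$ into the product $(\mathbb{D}, ds^2_{d_{n_0+n_1+\cdots+n_{i-1}+1}})\times\cdots\times(\mathbb{D}, ds^2_{d_{n_0+n_1+\cdots+n_i}})$. Finally, for each $1\le i\le m$, $$c_i+1 \le \sum_{k=n_0+n_1+\cdots+n_{i-1}+1}^{n_0+n_1+\cdots+n_i}(d_k+1),$$ and equality holds precisely when (after the reparametrization) $f_k = a_k z_i$ for all $n_0+n_1+\cdots+n_{i-1}+1\le k\le n_0+n_1+\cdots+n_i$, where all the $a_k$ are unimodular constants.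
   Context: $\mathbb{D}\subset\mathbb{C}$ is the open unit disc and $K_{\mathbb{D}}(z)=K_{\mathbb{D}}(z,z)$ its Bergman kernel on the diagonal. For an integer $d\ge 0$, $\mu_d = K_{\mathbb{D}}^{-d}$ is a weight on $\mathbb{D}$, $K_{\mathbb{D},d}(z,w)$ is the reproducing kernel of the Hilbert space of holomorphic functions on $\mathbb{D}$ square integrable with respect to $\mu_d\, dV$ ($dV$ Lebesgue measure), and $K_{\mathbb{D},d}(z)=K_{\mathbb{D},d}(z,z)$. The weighted Bergman metric is $ds^2_d = \frac{\partial^2}{\partial z\partial\overline{z}} \log K_{\mathbb{D},d}(z)\, dz\otimes d\overline{z}$. Products carry the product metric (the sum of the pullbacks of the metrics of the factors), and a holomorphic isometry is a holomorphic map $f:\mathbb{D}^m\to\mathbb{D}^n$ that pulls back the product metric of the target to that of the source; coordinates on $\mathbb{D}^m$ are $(z_1,\ldots,z_m)$. A reparametrization of $f$ means composing $f$ with holomorphic automorphisms of the individual disc factors in the source and in the target, and permuting the components $f_1,\ldots,f_n$ (together with the target factors and their indices $d_1,\ldots,d_n$); in the conclusions $f$ and $d_1,\ldots,d_n$ denote the reparametrized map and the correspondingly reindexed integers. *)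

(* Defs.v *)
From HB Require Import structures.
From mathcomp Require Import all_boot all_order all_algebra all_fingroup.
From mathcomp Require Import complex.
From mathcomp Require Import all_classical all_reals all_analysis.

Set Implicit Arguments.
Unset Strict Implicit.
Unset Printing Implicit Defensive.

Import Order.TTheory GRing.Theory Num.Theory numFieldNormedType.Exports.

Local Open Scope classical_set_scope.
Local Open Scope ring_scope.
Local Open Scope complex_scope.

(* R[i] as a structure: MathComp-Analysis attaches the norm, the topology and
   the normed module structures to numClosedFieldType, not to R[i] itself. The
   norm `|z| of z : Cx R is in Cx R (a real element), as for any numFieldType. *)
Definition Cx (R : realType) : numClosedFieldType := R[i].

Section Defs.
Variable R : realType.
Local Notation C := (Cx R).

Definition disc : set C := [set z | `|z| < 1].

Definition polydisc (m : nat) : set 'rV[C]_m := [set z | forall i, disc (z 0 i)].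

Definition holomorphic_on (V W : normedModType C) (D : set V) (f : V -> W) :=
  forall z, D z -> differentiable f z.

(* dV is the Lebesgue measure of R * R, transported by (x, y) |-> x + iy. *)
Local Notation dV := (@lebesgue_measure R \x @lebesgue_measure R)%E.

Definition disc_plane : set (measurableTypeR R * measurableTypeR R) :=
  [set p | disc (p.1 +i* p.2)].

Definition disc_integral (g : C -> C) : C :=
  (\int[dV]_(p in disc_plane) complex.Re (g (p.1 +i* p.2)))
  +i* (\int[dV]_(p in disc_plane) complex.Im (g (p.1 +i* p.2))).

Definition bergman_space (mu : C -> R) : set (C -> C) :=
  [set f | holomorphic_on disc f /\
    (\int[dV]_(p in disc_plane)
       (complex.Re (`|f (p.1 +i* p.2)| ^+ 2) * mu (p.1 +i* p.2))%:E < +oo)%E].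

Definition bergman_dot (mu : C -> R) (f g : C -> C) : C :=
  disc_integral (fun z => f z * (g z)^* * (mu z)%:C).

Definition is_reproducing_kernel (mu : C -> R) (K : C -> C -> C) :=
  forall w, disc w ->
    bergman_space mu (K ^~ w) /\
    forall f, bergman_space mu f -> f w = bergman_dot mu f (K ^~ w).

(* The reproducing kernel, whose values are determined on disc * disc only. *)
Definition bergman_kernel (mu : C -> R) : C -> C -> C :=
  xget (fun _ _ => 0) [set K | is_reproducing_kernel mu K].

(* K(z, z), which is a nonnegative real number on the disc *)
Definition bergman_diag (mu : C -> R) (z : C) : R := complex.Re (bergman_kernel mu z z).

Definition disc_weight (d : nat) (z : C) : R :=
  bergman_diag (fun=> 1) z ^- d.

Definition dx (u : C -> C) (z : C) : C :=
  (derive1 (fun t : R => complex.Re (u (z + t%:C))) 0)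
  +i* (derive1 (fun t : R => complex.Im (u (z + t%:C))) 0).

Definition dy (u : C -> C) (z : C) : C :=
  (derive1 (fun t : R => complex.Re (u (z + 'i * t%:C))) 0)
  +i* (derive1 (fun t : R => complex.Im (u (z + 'i * t%:C))) 0).

Definition dz (u : C -> C) (z : C) : C := (dx u z - 'i * dy u z) / 2.

Definition dzbar (u : C -> C) (z : C) : C := (dx u z + 'i * dy u z) / 2.

(* the coefficient of dz (x) dzbar in ds^2_d *)
Definition bergman_metric (d : nat) : C -> C :=
  dz (dzbar (fun z => (ln (bergman_diag (disc_weight d) z))%:C)).

(* The product of the ds^2_{c_i} at z, as a Hermitian form on tangent vectors. *)
Definition product_metric (m : nat) (c : 'I_m -> nat) (z u v : 'rV[C]_m) : C :=
  \sum_i bergman_metric (c i) (z 0 i) * u 0 i * (v 0 i)^*.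

(* Maps are total functions; only their restriction to the polydisc matters. *)
Definition holomorphic_isometry (m n : nat) (c : 'I_m -> nat) (d : 'I_n -> nat)
    (f : 'rV[C]_m -> 'rV[C]_n) :=
  [/\ forall z, polydisc z -> polydisc (f z),
      holomorphic_on (@polydisc m) f
    & forall z u v, polydisc z ->
        product_metric d (f z) ('d f z u) ('d f z v) = product_metric c z u v].

Definition disc_automorphism (phi : C -> C) :=
  exists psi : C -> C,
    [/\ holomorphic_on disc phi, holomorphic_on disc psi,
        forall z, disc z -> disc (phi z) /\ psi (phi z) = z
      & forall z, disc z -> disc (psi z) /\ phi (psi z) = z].

(* The k-th target factor after permutation is the (s k)-th original one. *)
Definition reparam (m n : nat) (phi : 'I_m -> C -> C) (psi : 'I_n -> C -> C)
    (s : 'S_n) (f : 'rV[C]_m -> 'rV[C]_n) (z : 'rV[C]_m) : 'rV[C]_n :=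
  \row_k psi k (f (\row_i phi i (z 0 i)) 0 (s k)).

Definition depends_only_on (m : nat) (i : 'I_m) (u : 'rV[C]_m -> C) :=
  forall z w, polydisc z -> polydisc w -> z 0 i = w 0 i -> u z = u w.

(* When n = p_0 + ... + p_(m-1), the j-th index of the i-th block of
   consecutive indices: its value is p_0 + ... + p_(i-1) + j. *)
Definition block_index (m n : nat) (p : 'I_m -> nat)
    (psum : (\sum_i p i)%N = n) (i : 'I_m) (j : 'I_(p i)) : 'I_n :=
  cast_ord psum (tagnat.Rank i j).

(* The i-th group of components as a map of the single variable z_i, the other
   variables (on which it will not depend) being set to 0. *)
Definition block_map (m n : nat) (p : 'I_m -> nat)
    (psum : (\sum_i p i)%N = n) (i : 'I_m) (f : 'rV[C]_m -> 'rV[C]_n)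
    (z : 'rV[C]_1) : 'rV[C]_(p i) :=
  \row_j f (z 0 0 *: delta_mx 0 i) 0 (block_index psum j).

End Defs.

Arguments block_index {m n p} psum {i} j.
Arguments block_map {R m n p} psum i f z.

(* Main.v *)
(* The functions (1 - z * wbar)^-(2d+2) reproduce, up to a constant, the holomorphic
   functions which are square integrable for the weight (1 - |z|^2)^(2d). Hence
   ds^2_d = (2d+2) / (1 - |z|^2)^2 dz dzbar, and evaluating the isometry on the i-th
   coordinate vector gives
     \sum_k (d_k + 1) |d_i f_k|^2 / (1 - |f_k|^2)^2 = (c_i + 1) / (1 - |z_i|^2)^2.
   The right-hand side does not depend on y = z_j for j <> i. After Moebius changes of
   coordinates making every f_k vanish at y = 0, write h_k for d_i f_k; then
     \sum_k (d_k + 1) (|h_k - h_k(0)|^2 + |h_k|^2 ((1 - |f_k|^2)^-2 - 1))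
   is twice the drop from its value at y = 0 of the real part of the holomorphic function
   \sum_k (d_k + 1) h_k(0)^* h_k. So this real part is maximal at 0, hence constant, and
   every term of the sum vanishes: d_i f_k does not depend on z_j, nor does f_k wherever
   d_i f_k is not 0. Therefore each f_k depends on a single variable. At the origin, with
   f(0) = 0 after Moebius changes of coordinates, the identity reads
   \sum_k (d_k + 1) |f_k'(0)|^2 = c_i + 1, the sum being over the i-th group, and the
   Schwarz lemma gives the inequality and its equality case. *)
From HB Require Import structures.
Require Import Defs.
From mathcomp Require Import all_boot all_order all_algebra all_fingroup.
From mathcomp Require Import complex.
From mathcomp Require Import all_classical all_reals all_analysis.
From mathcomp Require Import measurable_realfun ring lra.

Set Implicit Arguments.
Unset Strict Implicit.
Unset Printing Implicit Defensive.

Import Order.TTheory GRing.Theory Num.Theory numFieldNormedType.Exports.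

Local Open Scope classical_set_scope.
Local Open Scope ring_scope.
Local Open Scope complex_scope.

(** * Complex numbers over a real type *)

(** The metric is defined by integrals, while [holomorphic_on] asks for differentiability at each
    point, with no continuity of the derivative. The bridge is one integral formula, the weighted
    Bergman reproducing formula. It comes from Green's formula for fields differentiable at all
    points but one, which rests on Goursat's subdivision rather than on continuous derivatives. With
    weight exponent [2 * d] it yields the kernels and the metrics; with exponent 0 it plays the part
    of Cauchy's formula: mean value property, local Lipschitz bounds, maximum principle, division of
    f z by z, Schwarz lemma. The functions h_k are derivatives in z_i, and their regularity in z_j
    has to be earned: as bounded limits of difference quotients they inherit the reproducing
    formula, which is all that the maximum principle asks of them. That f_k depends on one variable
    needs a last step: d_i f_k is controlled everywhere, but f_k only where d_i f_k is not 0; a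
    single such point fixes the constant of integration along z_i. *)

Section ComplexNumbers.
Variable R : realType.
Local Notation C := (Cx R).
Implicit Types (z w : C) (a b : R).

(* Retyped copies of the operations of R[i]: with argument and result types
   Cx R, every expression is elaborated in the one structure Cx R. *)
Definition re (z : C) : R := complex.Re z.
Definition im (z : C) : R := complex.Im z.
Definition cj (z : C) : C := conjc z.
Definition rc (a : R) : C := a%:C.
Definition ci : C := 'i%C.
Definition nm (z : C) : R := re `|z|.

Lemma reD z w : re (z + w) = re z + re w. Proof. by case: z; case: w. Qed.
Lemma imD z w : im (z + w) = im z + im w. Proof. by case: z; case: w. Qed.
Lemma reN z : re (- z) = - re z. Proof. by case: z. Qed.
Lemma imN z : im (- z) = - im z. Proof. by case: z. Qed.
Lemma reM z w : re (z * w) = re z * re w - im z * im w.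
Proof. by case: z; case: w. Qed.
Lemma imM z w : im (z * w) = re z * im w + im z * re w.
Proof. by case: z; case: w. Qed.
Lemma reJ z : re (cj z) = re z. Proof. by case: z. Qed.
Lemma imJ z : im (cj z) = - im z. Proof. by case: z. Qed.
Lemma re_rc a : re (rc a) = a. Proof. by []. Qed.
Lemma im_rc a : im (rc a) = 0. Proof. by []. Qed.
Lemma re_i : re ci = 0. Proof. by []. Qed.
Lemma im_i : im ci = 1. Proof. by []. Qed.
Lemma re0 : re 0 = 0. Proof. by []. Qed.
Lemma im0 : im 0 = 0. Proof. by []. Qed.
Lemma re1 : re 1 = 1. Proof. by []. Qed.
Lemma im1 : im 1 = 0. Proof. by []. Qed.

Definition reim := (reD, imD, reN, imN, reM, imM, reJ, imJ, re_rc, im_rc,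
  re_i, im_i, re0, im0, re1, im1).

Lemma cx_eq z w : re z = re w -> im z = im w -> z = w.
Proof. by case: z w => a b [c d]; rewrite /re /im /= => -> ->. Qed.

Lemma cjD z w : cj (z + w) = cj z + cj w.
Proof. by apply: cx_eq; rewrite !reim//; ring. Qed.
Lemma cjN z : cj (- z) = - cj z.
Proof. by apply: cx_eq; rewrite !reim. Qed.
Lemma cjB z w : cj (z - w) = cj z - cj w.
Proof. by rewrite cjD cjN. Qed.
Lemma cjM z w : cj (z * w) = cj z * cj w.
Proof. by apply: cx_eq; rewrite !reim; ring. Qed.
Lemma cjK z : cj (cj z) = z.
Proof. by apply: cx_eq; rewrite !reim ?opprK. Qed.
Lemma cj1 : cj 1 = 1. Proof. by apply: cx_eq; rewrite !reim ?oppr0. Qed.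
Lemma cj0 : cj 0 = 0. Proof. by apply: cx_eq; rewrite !reim ?oppr0. Qed.
Lemma cjX z n : cj (z ^+ n) = cj z ^+ n.
Proof. by elim: n => [|n ih]; rewrite ?expr0 ?cj1// !exprS cjM ih. Qed.
Lemma cj_rc a : cj (rc a) = rc a.
Proof. by apply: cx_eq; rewrite !reim ?oppr0. Qed.
Lemma cjV z : cj z^-1 = (cj z)^-1.
Proof.
have [->|z0] := eqVneq z 0; first by rewrite invr0 cj0 invr0.
have cz0 : cj z != 0 by apply: contra_neq z0 => h; rewrite -(cjK z) h cj0.
by apply: (mulfI cz0); rewrite -cjM !divff// cj1.
Qed.

Lemma rcD a b : rc (a + b) = rc a + rc b.
Proof. by apply: cx_eq; rewrite !reim ?addr0. Qed.
Lemma rcN a : rc (- a) = - rc a.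
Proof. by apply: cx_eq; rewrite !reim ?oppr0. Qed.
Lemma rcB a b : rc (a - b) = rc a - rc b.
Proof. by rewrite rcD rcN. Qed.
Lemma rcM a b : rc (a * b) = rc a * rc b.
Proof. by apply: cx_eq; rewrite !reim; ring. Qed.
Lemma rc0 : rc 0 = 0. Proof. by []. Qed.
Lemma rc1 : rc 1 = 1. Proof. by []. Qed.
Lemma rcX a n : rc (a ^+ n) = rc a ^+ n.
Proof. by elim: n => [|n ih]; rewrite ?expr0// !exprS rcM ih. Qed.
Lemma rcn n : rc n%:R = n%:R.
Proof. by elim: n => [//|n ih]; rewrite -!natr1 rcD ih. Qed.
Lemma rcI : injective rc.
Proof. by move=> a b /(congr1 re). Qed.
Lemma rcV a : rc a^-1 = (rc a)^-1.
Proof.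
have [->|a0] := eqVneq a 0; first by rewrite invr0 rc0 invr0.
have ra0 : rc a != 0 by apply: contra_neq a0 => /(congr1 re).
by apply: (mulfI ra0); rewrite -rcM !divff.
Qed.
Lemma sqr_ci : ci * ci = -1.
Proof. by apply: cx_eq; rewrite !reim; ring. Qed.
Lemma rc_le a b : (rc a <= rc b) = (a <= b). Proof. exact: lecR. Qed.
Lemma rc_lt a b : (rc a < rc b) = (a < b). Proof. exact: ltcR. Qed.

Lemma nm_sqrt z : nm z = Num.sqrt (re z ^+ 2 + im z ^+ 2).
Proof. by rewrite /nm /re normc_def. Qed.

Lemma normE z : `|z| = rc (nm z).
Proof. by rewrite nm_sqrt /rc -normc_def. Qed.

Lemma nm_ge0 z : 0 <= nm z. Proof. by rewrite nm_sqrt sqrtr_ge0. Qed.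

Lemma nm_sqr z : nm z ^+ 2 = re z ^+ 2 + im z ^+ 2.
Proof. by rewrite nm_sqrt sqr_sqrtr// addr_ge0 ?sqr_ge0. Qed.

Lemma nmM z w : nm (z * w) = nm z * nm w.
Proof. by apply: rcI; rewrite rcM -!normE normrM. Qed.

Lemma nmV z : nm z^-1 = (nm z)^-1.
Proof. by apply: rcI; rewrite rcV -!normE normfV. Qed.

Lemma nmX z n : nm (z ^+ n) = nm z ^+ n.
Proof. by apply: rcI; rewrite rcX -!normE normrX. Qed.

Lemma nmD z w : nm (z + w) <= nm z + nm w.
Proof. by rewrite -rc_le rcD -!normE ler_normD. Qed.

Lemma nmN z : nm (- z) = nm z.
Proof. by rewrite /nm normrN. Qed.

Lemma nmB z w : nm (z - w) <= nm z + nm w.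
Proof. by rewrite (le_trans (nmD _ _))// nmN. Qed.

Lemma nm_distC z w : nm (z - w) = nm (w - z).
Proof. by rewrite -nmN opprB. Qed.

Lemma nm0 : nm 0 = 0. Proof. by rewrite /nm normr0. Qed.
Lemma nm1 : nm 1 = 1. Proof. by rewrite /nm normr1. Qed.

Lemma nm_eq0 z : (nm z == 0) = (z == 0).
Proof.
apply/idP/idP => [/eqP h|/eqP ->]; last by rewrite nm0.
by rewrite -normr_eq0 normE h.
Qed.

Lemma nm_gt0 z : (0 < nm z) = (z != 0).
Proof. by rewrite lt_def nm_eq0 nm_ge0 andbT. Qed.

Lemma nm_rc a : nm (rc a) = `|a|.
Proof. by rewrite nm_sqrt !reim expr0n addr0 sqrtr_sqr. Qed.

Lemma nm_i : nm ci = 1.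
Proof. by rewrite nm_sqrt !reim expr0n expr1n add0r sqrtr1. Qed.

Lemma nm_cj z : nm (cj z) = nm z.
Proof. by rewrite !nm_sqrt !reim sqrrN. Qed.

Lemma nm_dist z w : `|nm z - nm w| <= nm (z - w).
Proof.
rewrite ler_norml; have h1 := nmD (z - w) w; have h2 := nmD (w - z) z.
rewrite subrK in h1; rewrite subrK nm_distC in h2.
by apply/andP; split; lra.
Qed.

Lemma re_nm z : `|re z| <= nm z.
Proof. by rewrite nm_sqrt -sqrtr_sqr ler_wsqrtr// lerDl sqr_ge0. Qed.

Lemma im_nm z : `|im z| <= nm z.
Proof. by rewrite nm_sqrt -sqrtr_sqr ler_wsqrtr// lerDr sqr_ge0. Qed.

Lemma re_le_nm z : re z <= nm z.
Proof. exact: le_trans (ler_norm _) (re_nm _). Qed.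

Lemma nm_le_reim z : nm z <= `|re z| + `|im z|.
Proof.
rewrite -(@ler_pXn2r _ 2)// ?nnegrE ?nm_ge0 ?addr_ge0// nm_sqr.
rewrite sqrrD !real_normK ?num_real// lerD2r lerDl.
by rewrite mulrn_wge0// mulr_ge0.
Qed.

Lemma mul_cj z : z * cj z = rc (nm z ^+ 2).
Proof. by apply: cx_eq; rewrite !reim ?nm_sqr; ring. Qed.

Lemma discE z : disc z <-> nm z < 1.
Proof. by rewrite /disc /= normE -rc1 rc_lt. Qed.

Lemma nm_nat n : nm n%:R = n%:R.
Proof. by rewrite -rcn nm_rc normr_nat. Qed.

Lemma nm_prod_lt1 z w : nm z < 1 -> nm w < 1 -> nm (z * w) < 1.
Proof.
move=> z1 w1; rewrite nmM; have := nm_ge0 z; have := nm_ge0 w.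
by move=> ? ?; nra.
Qed.

Lemma nm_1B z : 1 - nm z <= nm (1 - z).
Proof. by have := nmD (1 - z) z; rewrite subrK nm1; lra. Qed.

(** A positive element of [Cx R] is real, so the radii of balls, which live in [C], can be traded
    for radii in [R], where real arithmetic applies. *)
Lemma nbhs_nm (z : C) (A : set C) :
  nbhs z A <-> exists2 e : R, 0 < e & forall w, nm (w - z) < e -> A w.
Proof.
split => [/nbhs_ballP[e /= e0 h]|[e e0 h]].
  have ee : e = rc (re e).
    by apply: cx_eq => //; move: e0; rewrite ltcE => /andP[/eqP]; rewrite /im.
  exists (re e); first by rewrite -rc_lt -ee.
  by move=> w hw; apply: h; rewrite -ball_normE /= normE ee rc_lt nm_distC.
apply/nbhs_ballP; exists (rc e); first by rewrite /= -rc0 rc_lt.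
by move=> w; rewrite -ball_normE /= normE rc_lt nm_distC => /h.
Qed.

Lemma continuous_nmP (f : C -> C) z :
  {for z, continuous f} <-> forall e : R, 0 < e -> exists2 d : R, 0 < d &
    forall w, nm (w - z) < d -> nm (f w - f z) < e.
Proof.
split=> [h e e0|h A /nbhs_nm[e e0 hA]].
  have : nbhs (f z) [set y | nm (y - f z) < e] by apply/nbhs_nm; exists e.
  by move/h/nbhs_nm.
have [d d0 hd] := h _ e0.
by apply/nbhs_nm; exists d => // w /hd/hA.
Qed.

Lemma continuous_rnmP (f : C -> R) z :
  {for z, continuous f} <-> forall e : R, 0 < e -> exists2 d : R, 0 < d &
    forall w, nm (w - z) < d -> `|f w - f z| < e.
Proof.
split=> [h e e0|h A /nbhs_ballP[e e0 hA]].
  have : nbhs (f z) (ball (f z) e) by apply/nbhs_ballP; exists e.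
  move/h/nbhs_nm => -[d d0 hd]; exists d => // w /hd.
  by rewrite -ball_normE /= distrC.
have [d d0 hd] := h _ e0.
apply/nbhs_nm; exists d => // w /hd h1; apply: hA.
by rewrite -ball_normE /= distrC.
Qed.

Lemma continuous_re : continuous re.
Proof.
move=> z; apply/continuous_rnmP => e e0; exists e => // w h.
by rewrite -reN -reD (le_lt_trans (re_nm _)).
Qed.

Lemma continuous_im : continuous im.
Proof.
move=> z; apply/continuous_rnmP => e e0; exists e => // w h.
by rewrite -imN -imD (le_lt_trans (im_nm _)).
Qed.

Lemma continuous_nm : continuous nm.
Proof.
move=> z; apply/continuous_rnmP => e e0; exists e => // w h.
exact: le_lt_trans (nm_dist _ _) h.
Qed.

Lemma continuous_cj : continuous cj.
Proof.
move=> z; apply/continuous_nmP => e e0; exists e => // w h.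
by rewrite -cjB nm_cj.
Qed.

Lemma continuous_rc : continuous rc.
Proof.
move=> a A /nbhs_nm[e e0 hA]; apply/nbhs_ballP; exists e => // b.
by rewrite -ball_normE /= distrC => h; apply: hA; rewrite -rcB nm_rc.
Qed.

End ComplexNumbers.

Arguments ci {R}.

Section ContinuityRules.
Variable R : realType.
Local Notation C := (Cx R).
Implicit Types (f g : C -> R) (F G : C -> C) (z : C).

Lemma crN f z : {for z, continuous f} -> {for z, continuous (fun z => - f z)}.
Proof. exact: (@continuousN R R C f z). Qed.
Lemma crD f g z : {for z, continuous f} -> {for z, continuous g} ->
  {for z, continuous (fun z => f z + g z)}.
Proof. exact: (@continuousD R R C f g z). Qed.
Lemma crM f g z : {for z, continuous f} -> {for z, continuous g} ->
  {for z, continuous (fun z => f z * g z)}.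
Proof. exact: (@continuousM R C f g z). Qed.
Lemma cr_cst (c : R) z : {for z, continuous (fun _ : C => c)}.
Proof. exact: cst_continuous. Qed.
Lemma ccN F z : {for z, continuous F} -> {for z, continuous (fun z => - F z)}.
Proof. exact: (@continuousN C C C F z). Qed.
Lemma ccD F G z : {for z, continuous F} -> {for z, continuous G} ->
  {for z, continuous (fun z => F z + G z)}.
Proof. exact: (@continuousD C C C F G z). Qed.
Lemma ccM F G z : {for z, continuous F} -> {for z, continuous G} ->
  {for z, continuous (fun z => F z * G z)}.
Proof. exact: (@continuousM C C F G z). Qed.
Lemma ccX F z n : {for z, continuous F} -> {for z, continuous (fun z => F z ^+ n)}.
Proof.
move=> cF; elim: n => [|n ih]; first exact: cst_continuous.
rewrite (_ : (fun z => F z ^+ n.+1) = fun z => F z * F z ^+ n); first exact: ccM.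
by apply/funext => x; rewrite exprS.
Qed.
Lemma cc_cst (c : C) z : {for z, continuous (fun _ : C => c)}.
Proof. exact: cst_continuous. Qed.
Lemma cc_id z : {for z, continuous (fun z : C => z)}.
Proof. by []. Qed.
Lemma cc_cj F z : {for z, continuous F} -> {for z, continuous (fun z => cj (F z))}.
Proof. by move=> cF; apply: continuous_comp cF _; exact: continuous_cj. Qed.
Lemma cr_re F z : {for z, continuous F} -> {for z, continuous (fun z => re (F z))}.
Proof. by move=> cF; apply: continuous_comp cF _; exact: continuous_re. Qed.
Lemma cr_im F z : {for z, continuous F} -> {for z, continuous (fun z => im (F z))}.
Proof. by move=> cF; apply: continuous_comp cF _; exact: continuous_im. Qed.
Lemma cr_nm F z : {for z, continuous F} -> {for z, continuous (fun z => nm (F z))}.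
Proof. by move=> cF; apply: continuous_comp cF _; exact: continuous_nm. Qed.
Lemma cc_rc f z : {for z, continuous f} -> {for z, continuous (fun z => rc (f z))}.
Proof. by move=> cF; apply: continuous_comp cF _; exact: continuous_rc. Qed.
Lemma cr_comp (phi : R -> R) f z : {for z, continuous f} -> {for f z, continuous phi} ->
  {for z, continuous (fun z => phi (f z))}.
Proof. by move=> cF cphi; apply: continuous_comp cF cphi. Qed.

End ContinuityRules.

(** * Green's formula *)

Section Plane.
Variable R : realType.
Local Notation C := (Cx R).
Local Notation R2 := (measurableTypeR R * measurableTypeR R)%type.
Local Notation mu := (@lebesgue_measure R \x @lebesgue_measure R)%E.

Definition cpt (p : R2) : C := p.1 +i* p.2.

Lemma re_cpt p : re (cpt p) = p.1. Proof. by []. Qed.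
Lemma im_cpt p : im (cpt p) = p.2. Proof. by []. Qed.

(** The product sigma-algebra is generated by rectangles: an open set is the union of the countably
    many boxes with rational centre and radius that it contains. *)
Lemma measurable_cpt_open (U : set C) : open U -> measurable (cpt @^-1` U).
Proof.
move=> oU.
pose box (q : rat * rat * rat) : set R2 :=
  `](ratr q.1.1 - ratr q.2 : R), (ratr q.1.1 + ratr q.2)[%classic `*`
  `](ratr q.1.2 - ratr q.2 : R), (ratr q.1.2 + ratr q.2)[%classic.
pose F q := if `[< box q `<=` cpt @^-1` U >] then box q else set0.
suff -> : cpt @^-1` U = \bigcup_q F q.
  apply: countable_bigcupT_measurable; first exact: countableP.
  move=> q; rewrite /F; case: ifPn => _; last exact: measurable0.
  by apply: measurableX; exact: measurable_itv.
apply/seteqP; split => [p Up|p [q _]]; last first.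
  by rewrite /F; case: ifPn => [/asboolP h /h|].
have /nbhs_nm[e e0 he] : nbhs (cpt p) U by exact: open_nbhs_nbhs.
have e4 : 0 < e / 4 by rewrite divr_gt0.
have [r] := rat_in_itvoo e4; rewrite in_itv/= => /andP[r0 re4].
have hx (x : R) : x - ratr r < x + ratr r by lra.
have [q1] := rat_in_itvoo (hx p.1); rewrite in_itv/= => /andP[q11 q12].
have [q2] := rat_in_itvoo (hx p.2); rewrite in_itv/= => /andP[q21 q22].
exists (q1, q2, r) => //; rewrite /F asboolT.
  by split; rewrite /= in_itv/=; apply/andP; split; lra.
move=> z [] /=; rewrite !in_itv/= => /andP[z11 z12] /andP[z21 z22].
apply: he; rewrite (le_lt_trans (nm_le_reim _))// !reim !re_cpt !im_cpt.
have : `|z.1 - p.1| < 2 * ratr r by rewrite ltr_norml; apply/andP; split; lra.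
have : `|z.2 - p.2| < 2 * ratr r by rewrite ltr_norml; apply/andP; split; lra.
by lra.
Qed.

Lemma measurable_fun_cpt (D : set C) (f : C -> R) :
  open D -> (forall z, D z -> {for z, continuous f}) ->
  measurable_fun (cpt @^-1` D) (f \o cpt).
Proof.
move=> oD cf mD; apply: (measurability _ (measurable_realfun.RGenOpens.measurableE R)) => //.
move=> _ [_ [a [b ->] <-]].
rewrite [X in measurable X](_ : _ =
    cpt @^-1` (D `&` f @^-1` `]a, b[%classic)) //.
apply: measurable_cpt_open.
rewrite openE => z [Dz fz]; apply: filterI; first exact: open_nbhs_nbhs.
by apply: cf => //; apply: open_nbhs_nbhs; split => //; exact: interval_open.
Qed.

Lemma open_disc : open (@disc R).
Proof.
rewrite openE => z /discE z1; apply/nbhs_nm; exists (1 - nm z).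
  by rewrite subr_gt0.
by move=> w h; apply/discE; have := nmD (w - z) z; rewrite subrK; lra.
Qed.

Lemma disc_planeE : @disc_plane R = cpt @^-1` (@disc R).
Proof. by []. Qed.

Lemma measurable_disc_plane : measurable (@disc_plane R).
Proof. by rewrite disc_planeE; apply: measurable_cpt_open open_disc. Qed.

Lemma measurable_fun_disc (f : C -> R) :
  (forall z, disc z -> {for z, continuous f}) ->
  measurable_fun (@disc_plane R) (f \o cpt).
Proof. by move=> h; apply: measurable_fun_cpt => //; exact: open_disc. Qed.

Lemma mu_itvoc (a b : R) : a <= b ->
  lebesgue_measure (`]a, b]%classic : set R) = (b - a)%:E.
Proof.
move=> ab; rewrite lebesgue_measure_itv/= lte_fin; case: ltP => //.
by move=> ba; rewrite (@le_anti _ _ a b) ?ab// subrr.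
Qed.

(** Half-open, so that cutting a box gives a genuine partition. *)
Definition box (a b c d : R) : set R2 :=
  `]a, b]%classic `*` `]c, d]%classic.

Lemma measurable_box a b c d : measurable (box a b c d).
Proof. by apply: measurableX; exact: measurable_itv. Qed.

Lemma mu_box a b c d : a <= b -> c <= d ->
  mu (box a b c d) = ((b - a) * (d - c))%:E.
Proof.
move=> ab cd; rewrite product_measure1E//; try exact: measurable_itv.
by rewrite /= !mu_itvoc.
Qed.

Lemma mu_disc_fin : (mu (@disc_plane R) < +oo)%E.
Proof.
apply: (@le_lt_trans _ _ (mu (box (-1) 1 (-1) 1))); last first.
  by rewrite mu_box ?ltry//; lra.
apply: le_measure; rewrite ?inE.
- exact: measurable_disc_plane.
- exact: measurable_box.
- move=> p /discE; rewrite -/(cpt p) => h.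
  have := re_nm (cpt p); have := im_nm (cpt p).
  rewrite re_cpt im_cpt !ler_norml => /andP[? ?] /andP[? ?].
  by split; rewrite /= in_itv/=; apply/andP; split; lra.
Qed.

End Plane.

(** * Goursat's subdivision argument for additive functions of rectangles *)

Section Bisection.
Variable R : realType.
Variable E : R -> R -> R -> R -> R.
Variables a0 b0 c0 d0 : R.
Hypotheses (ab0 : a0 <= b0) (cd0 : c0 <= d0).
Hypothesis Ex : forall a m b c d, a <= m -> m <= b -> c <= d ->
  E a b c d = E a m c d + E m b c d.
Hypothesis Ey : forall a b c m d, a <= b -> c <= m -> m <= d ->
  E a b c d = E a b c m + E a b m d.
Hypothesis Eloc : forall x y, a0 <= x <= b0 -> c0 <= y <= d0 ->
  forall e : R, 0 < e -> exists2 del : R, 0 < del &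
    forall a b c d, a0 <= a -> a <= x <= b -> b <= b0 ->
      c0 <= c -> c <= y <= d -> d <= d0 -> b - a < del -> d - c < del ->
      `|E a b c d| <= e * ((b - a) + (d - c)) ^+ 2.

Let s n : R := 2^-1 ^+ n.
Let l n : R := (b0 - a0) * s n.
Let k n : R := (d0 - c0) * s n.
Let val n (q : R * R) : R := `|E q.1 (q.1 + l n) q.2 (q.2 + k n)|.
(** [q] is the lower left corner of a box of sides [l n] and [k n]. The new corner is that of a
    quarter carrying at least a quarter of the absolute value of [E]; the last quarter is taken
    untested, since additivity makes it qualify when the other three fail. *)
Let nxt n (q : R * R) : R * R :=
  if val n q <= 4 * val n.+1 q then q else
  if val n q <= 4 * val n.+1 (q.1 + l n.+1, q.2) then (q.1 + l n.+1, q.2) else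
  if val n q <= 4 * val n.+1 (q.1, q.2 + k n.+1) then (q.1, q.2 + k n.+1) else
  (q.1 + l n.+1, q.2 + k n.+1).
Fixpoint corner n : R * R := if n is n'.+1 then nxt n' (corner n') else (a0, c0).
Let u := corner.

Let s_gt0 n : 0 < s n. Proof. by rewrite exprn_gt0 ?invr_gt0. Qed.
Let sS n : s n = 2 * s n.+1.
Proof. by rewrite /s exprS mulrA divff ?mul1r. Qed.
Let lS n : l n = l n.+1 + l n.+1. Proof. by rewrite /l (sS n); ring. Qed.
Let kS n : k n = k n.+1 + k n.+1. Proof. by rewrite /k (sS n); ring. Qed.
Let l_ge0 n : 0 <= l n. Proof. by rewrite mulr_ge0 ?subr_ge0 ?(ltW (s_gt0 _)). Qed.
Let k_ge0 n : 0 <= k n. Proof. by rewrite mulr_ge0 ?subr_ge0 ?(ltW (s_gt0 _)). Qed.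

Let val_nxt n q : val n q <= 4 * val n.+1 (nxt n q).
Proof.
rewrite /nxt; case: ifPn => // h1; case: ifPn => // h2; case: ifPn => // h3.
move: h1 h2 h3; rewrite -!ltNge => h1 h2 h3.
have : val n q <= val n.+1 q + val n.+1 (q.1 + l n.+1, q.2) +
  (val n.+1 (q.1, q.2 + k n.+1) + val n.+1 (q.1 + l n.+1, q.2 + k n.+1)).
  rewrite /val (lS n) (kS n) !addrA /=.
  have l0 := l_ge0 n.+1; have k0 := k_ge0 n.+1.
  rewrite (@Ex _ (q.1 + l n.+1)); [|lra..].
  rewrite (@Ey q.1 _ _ (q.2 + k n.+1)); [|lra..].
  rewrite (@Ey (q.1 + l n.+1) _ _ (q.2 + k n.+1)); [|lra..].
  set x1 := E _ _ _ _; set x2 := E _ _ _ _; set x3 := E _ _ _ _; set x4 := E _ _ _ _.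
  have := ler_normD (x1 + x2) (x3 + x4).
  have := ler_normD x1 x2; have := ler_normD x3 x4; lra.
lra.
Qed.

Let nxt_in n q : [/\ q.1 <= (nxt n q).1, (nxt n q).1 + l n.+1 <= q.1 + l n,
  q.2 <= (nxt n q).2 & (nxt n q).2 + k n.+1 <= q.2 + k n].
Proof.
have l0 := l_ge0 n.+1; have k0 := k_ge0 n.+1; have := lS n; have := kS n.
by move=> ? ?; rewrite /nxt; case: ifPn => _; [|case: ifPn => _; [|case: ifPn => _]];
  split => /=; lra.
Qed.

Let u_incr n m : [/\ (u n).1 <= (u (n + m)).1,
   (u (n + m)).1 + l (n + m) <= (u n).1 + l n,
   (u n).2 <= (u (n + m)).2 & (u (n + m)).2 + k (n + m) <= (u n).2 + k n].
Proof.
elim: m => [|m [h1 h2 h3 h4]]; first by rewrite addn0.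
rewrite addnS; have [g1 g2 g3 g4] := nxt_in (n + m) (u (n + m)).
by split; [apply: le_trans h1 g1|apply: le_trans g2 h2|apply: le_trans h3 g3|
  apply: le_trans g4 h4].
Qed.

Let u_cross n m : (u n).1 <= (u m).1 + l m /\ (u n).2 <= (u m).2 + k m.
Proof.
have [h1 h2 h3 h4] := u_incr n m; have [g1 g2 g3 g4] := u_incr m n.
rewrite addnC in g1 g2 g3 g4; have := l_ge0 (n + m); have := k_ge0 (n + m).
by move=> ? ?; split; lra.
Qed.

Let val_u n : val 0 (u 0) * s n ^+ 2 <= val n (u n).
Proof.
elim: n => [|n ih]; first by rewrite /s expr0 expr1n mulr1.
have := val_nxt n (u n); rewrite -/(u n.+1) => h.
have e : s n ^+ 2 = 4 * s n.+1 ^+ 2 by rewrite (sS n); ring.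
by move: ih; rewrite e; lra.
Qed.

(** Along the nested boxes the absolute value of [E] decreases at most by the factor 4 at each step,
    that is, like the square of the sides, whereas the local estimate at their common point is a
    small multiple of that square. *)
Lemma bisection_eq0 : E a0 b0 c0 d0 = 0.
Proof.
have u0 : val 0 (u 0) = `|E a0 b0 c0 d0|.
  by rewrite /val /= /l /k /s expr0 !mulr1 !(addrC _ (_ - _)) !subrK.
apply/eqP; rewrite -normr_eq0 -u0 eq_le normr_ge0 andbT leNgt; apply/negP => v0.
(* The lower left corners increase and stay below every upper right corner ([u_cross]), so the
   suprema give a point common to all the boxes. *)
pose x := sup [set (u n).1 | n in setT]; pose y := sup [set (u n).2 | n in setT].
have ux n : (u n).1 <= x.
  apply: ub_le_sup; last by exists n.
  by exists ((u 0).1 + l 0) => _ [m _ <-]; case: (u_cross m 0).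
have uy n : (u n).2 <= y.
  apply: ub_le_sup; last by exists n.
  by exists ((u 0).2 + k 0) => _ [m _ <-]; case: (u_cross m 0).
have xu n : x <= (u n).1 + l n.
  apply: ge_sup; first by exists (u 0).1, 0%N.
  by move=> _ [m _ <-]; case: (u_cross m n).
have yu n : y <= (u n).2 + k n.
  apply: ge_sup; first by exists (u 0).2, 0%N.
  by move=> _ [m _ <-]; case: (u_cross m n).
have l0E : l 0 = b0 - a0 by rewrite /l /s expr0 mulr1.
have k0E : k 0 = d0 - c0 by rewrite /k /s expr0 mulr1.
have xin : a0 <= x <= b0.
  have := ux 0%N; have := xu 0%N; rewrite l0E /= => ? ?; apply/andP; split; lra.
have yin : c0 <= y <= d0.
  have := uy 0%N; have := yu 0%N; rewrite k0E /= => ? ?; apply/andP; split; lra.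
(* The added 1 keeps [L] positive for a degenerate box. *)
pose L := (b0 - a0) + (d0 - c0) + 1.
have L0 : 0 < L by rewrite /L; lra.
(* With this constant the local bound at stage [n] is at most half of the lower bound
   [val 0 (u 0) * s n ^+ 2]. *)
have e0 : 0 < val 0 (u 0) / (2 * L ^+ 2).
  by rewrite divr_gt0// mulr_gt0// exprn_gt0.
have [del del0 hdel] := Eloc xin yin e0.
have [n hn] : exists n, L * s n < del.
  have : (fun n => L * s n) @ \oo --> L * 0.
    by apply: cvgMr; apply: cvg_expr; rewrite ger0_norm ?invr_ge0// invf_lt1// ltr1n.
  rewrite mulr0 => /cvgrPdist_lt/(_ _ del0) [n _ /(_ n (leqnn n))] /=.
  rewrite sub0r normrN ger0_norm ?mulr_ge0 ?(ltW L0) ?(ltW (s_gt0 _))// => ?.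
  by exists n.
have [h1 h2 h3 h4] := u_incr 0 n; rewrite !add0n l0E k0E /= in h1 h2 h3 h4.
have sn := s_gt0 n.
have lk : l n + k n <= L * s n by rewrite /l /k /L; nra.
have ln := l_ge0 n; have kn := k_ge0 n.
have := hdel (u n).1 ((u n).1 + l n) (u n).2 ((u n).2 + k n).
rewrite !(addrC _ (l n)) !(addrC _ (k n)) !addrK !(addrC (l n) (u n).1) !(addrC (k n) (u n).2).
have -> : (a0 <= (u n).1) by lra.
have -> : ((u n).1 <= x <= (u n).1 + l n) by rewrite ux xu.
have -> : ((u n).1 + l n <= b0) by lra.
have -> : (c0 <= (u n).2) by lra.
have -> : ((u n).2 <= y <= (u n).2 + k n) by rewrite uy yu.
have -> : ((u n).2 + k n <= d0) by lra.
have -> : (l n < del) by lra.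
have -> : (k n < del) by lra.
move=> /(_ isT isT isT isT isT isT isT isT) h.
have := val_u n; rewrite leNgt => /negP; apply.
apply: le_lt_trans h _.
apply: (@le_lt_trans _ _ (val 0 (u 0) / (2 * L ^+ 2) * (L * s n) ^+ 2)).
  by rewrite ler_pM2l// ler_pXn2r// nnegrE; nra.
have -> : val 0 (u 0) / (2 * L ^+ 2) * (L * s n) ^+ 2 = val 0 (u 0) * s n ^+ 2 / 2.
  by field; rewrite gt_eqF.
have v1 : 0 < val 0 (u 0) * s n ^+ 2 by rewrite mulr_gt0// exprn_gt0.
by lra.
Qed.

End Bisection.

(** * Integrals close to those of a constant, and integrability on boxes *)

Section MeanValue.
Context d (T : measurableType d) (R : realType).
Variable mu : {measure set T -> \bar R}.

Lemma integrable_cst_fin (A : set T) (v : R) : measurable A ->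
  (mu A < +oo)%E -> mu.-integrable A (EFin \o cst v).
Proof.
move=> mA Afin; apply: measurable_bounded_integrable => //.
exact: bounded_cst.
Qed.

Lemma integrable_bounded (A : set T) (f : T -> R) (M : R) : measurable A ->
  (mu A < +oo)%E -> measurable_fun A f -> (forall x, A x -> `|f x| <= M) ->
  mu.-integrable A (EFin \o f).
Proof.
move=> mA Afin mf fM; apply: measurable_bounded_integrable => //.
exists M; split; first exact: num_real.
by move=> x Mx y Ay; exact: le_trans (fM _ Ay) (ltW Mx).
Qed.

Lemma Rintegral_near_cst (A : set T) (f : T -> R) (v e m : R) : measurable A ->
  mu A = m%:E -> mu.-integrable A (EFin \o f) ->
  (forall x, A x -> `|f x - v| <= e) -> `|\int[mu]_(x in A) f x - v * m| <= e * m.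
Proof.
move=> mA Am fi fe.
have Afin : (mu A < +oo)%E by rewrite Am ltry.
have ci w : mu.-integrable A (EFin \o cst w) by exact: integrable_cst_fin.
have cE w : w * m = \int[mu]_(x in A) (cst w x).
  by rewrite Rintegral_cst// Am.
rewrite !cE -RintegralB//.
have fvi : mu.-integrable A (EFin \o (fun x => f x - v)).
  have := integrableB mA fi (ci v).
  by apply: eq_integrable.
apply: le_trans (le_normr_Rintegral mA fvi) _.
apply: le_Rintegral => //.
have := integrable_abse fvi.
by apply: eq_integrable.
Qed.

End MeanValue.

Section Boxes.
Variable R : realType.
Local Notation C := (Cx R).
Local Notation leb := (@lebesgue_measure R).
Local Notation mu2 := (@lebesgue_measure R \x @lebesgue_measure R)%E.

Definition pt (x y : R) : C := x +i* y.

Lemma re_pt x y : re (pt x y) = x. Proof. by []. Qed.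
Lemma im_pt x y : im (pt x y) = y. Proof. by []. Qed.

Lemma nm_ptB x y x' y' : nm (pt x y - pt x' y') <= `|x - x'| + `|y - y'|.
Proof. by rewrite (le_trans (nm_le_reim _))// !reim. Qed.

Lemma continuous_ptl y : continuous (pt ^~ y).
Proof.
move=> x A /nbhs_nm[e e0 h]; apply/nbhs_ballP; exists e => // z.
rewrite -ball_normE /= distrC => xz; apply: h.
by rewrite (le_lt_trans (nm_ptB _ _ _ _))// subrr normr0 addr0.
Qed.

Lemma continuous_ptr x : continuous (pt x).
Proof.
move=> y A /nbhs_nm[e e0 h]; apply/nbhs_ballP; exists e => // z.
rewrite -ball_normE /= distrC => xz; apply: h.
by rewrite (le_lt_trans (nm_ptB _ _ _ _))// subrr normr0 add0r.
Qed.

Lemma continuous_pt : continuous (fun p : R * R => pt p.1 p.2).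
Proof.
move=> p A /nbhs_nm[e e0 h]; apply/nbhs_ballP; exists (e / 2).
  by rewrite /= divr_gt0.
move=> q [/= h1 h2]; apply: h; rewrite (le_lt_trans (nm_ptB _ _ _ _))//.
move: h1 h2; rewrite -!ball_normE /= !(distrC p.1) !(distrC p.2); lra.
Qed.

Lemma compact_box (a b c d : R) :
  compact [set pt p.1 p.2 | p in `[a, b]%classic `*` `[c, d]%classic].
Proof.
apply: continuous_compact.
  by apply: continuous_subspaceT; exact: continuous_pt.
by apply: compact_setX; exact: segment_compact.
Qed.

Lemma bounded_box (h : C -> R) (a b c d : R) : continuous h ->
  exists M : R, forall z, a <= re z <= b -> c <= im z <= d -> `|h z| <= M.
Proof.
move=> ch.
have : compact [set h z | z in [set pt p.1 p.2 | p in `[a, b]%classic `*` `[c, d]%classic]].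
  by apply: continuous_compact; [exact: continuous_subspaceT|exact: compact_box].
move=> /compact_bounded[M [_ hM]]; exists (M + 1) => z hx hy.
apply: (hM (M + 1)); first by rewrite ltrDl.
exists z => //; exists (re z, im z); last by apply: cx_eq.
by split; rewrite /= in_itv.
Qed.

Lemma integrable_box (h : C -> R) (a b c d : R) : a <= b -> c <= d ->
  continuous h -> mu2.-integrable (box a b c d) (EFin \o (h \o @cpt R)).
Proof.
move=> ab cd ch; have [M hM] := bounded_box a b c d ch.
apply: (@integrable_bounded _ _ _ _ _ _ M).
- exact: measurable_box.
- by have E := mu_box ab cd; apply: (eq_ind_r (fun X => (X < +oo)%E) _ E); exact: ltry.
- apply: (@measurable_funS _ _ _ _ setT) => //.
  exact: (@measurable_fun_cpt R setT h openT (fun z _ => ch z)).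
- move=> p [/=]; rewrite !in_itv/= => /andP[p1 p2] /andP[p3 p4].
  by apply: hM; rewrite ?(re_cpt, im_cpt); apply/andP; split => //; exact: ltW.
Qed.

Lemma integrable_itv (h : R -> R) (a b : R) : continuous h ->
  leb.-integrable `]a, b]%classic (EFin \o h).
Proof.
move=> ch.
have H : leb.-integrable `[a, b]%classic (EFin \o h).
  apply: continuous_compact_integrable; first exact: segment_compact.
  exact: continuous_subspaceT.
apply: integrableS H => //.
by apply: subset_itvr; rewrite bnd_simp.
Qed.

End Boxes.

(** * The divergence theorem on a rectangle with one exceptional point *)

Section Divergence.
Variable R : realType.
Local Notation C := (Cx R).
Local Notation leb := (@lebesgue_measure R).
Local Notation mu2 := (@lebesgue_measure R \x @lebesgue_measure R)%E.

(** Differentiability at the single point [z]: the partial derivatives [a] and [b] may vary without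
    continuity. *)
Definition rdiff (P : C -> R) (z : C) (a b : R) :=
  forall e : R, 0 < e -> exists2 del : R, 0 < del & forall z', nm (z' - z) < del ->
    `|P z' - P z - a * (re z' - re z) - b * (im z' - im z)| <= e * nm (z' - z).

Variables P Q h : C -> R.
Hypotheses (cP : continuous P) (cQ : continuous Q) (ch : continuous h).

(** The outward flux of the field (P, Q) through the boundary, minus the integral of its intended
    divergence [h]. *)
Definition flux_defect (a b c d : R) : R :=
  \int[leb]_(y in `]c, d]%classic) (P (pt b y) - P (pt a y)) +
  \int[leb]_(x in `]a, b]%classic) (Q (pt x d) - Q (pt x c)) -
  \int[mu2]_(p in box a b c d) h (cpt p).

Let cPr b : continuous (fun y => P (pt b y)).
Proof. by move=> y; apply: continuous_comp; [exact: continuous_ptr|exact: cP]. Qed.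

Let cQl b : continuous (fun x => Q (pt x b)).
Proof. by move=> y; apply: continuous_comp; [exact: continuous_ptl|exact: cQ]. Qed.

Let cPB a b : continuous (fun y => P (pt b y) - P (pt a y)).
Proof. by move=> y; apply: continuousB; exact: cPr. Qed.

Let cQB a b : continuous (fun x => Q (pt x b) - Q (pt x a)).
Proof. by move=> y; apply: continuousB; exact: cQl. Qed.

Lemma itv_split (f : R -> R) (a m b : R) : a <= m -> m <= b -> continuous f ->
  \int[leb]_(x in `]a, b]%classic) f x =
  \int[leb]_(x in `]a, m]%classic) f x + \int[leb]_(x in `]m, b]%classic) f x.
Proof.
move=> am mb cf.
have ab : `]a, b]%classic = `]a, m]%classic `|` `]m, b]%classic :> set R.
  by rewrite -itv_bndbnd_setU// bnd_simp.
rewrite ab Rintegral_setU//; try exact: measurable_itv.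
- by rewrite -ab; exact: integrable_itv.
- apply/disj_setPS => x [] /=; rewrite !in_itv/= => /andP[_ xm] /andP[mx _].
  by move: (lt_le_trans mx xm); rewrite ltxx.
Qed.

Let Dx a m b c d : a <= m -> m <= b -> c <= d ->
  flux_defect a b c d = flux_defect a m c d + flux_defect m b c d.
Proof.
move=> am mb cd; rewrite /flux_defect (itv_split am mb); last exact: cQB.
have bs : box a b c d = box a m c d `|` box m b c d.
  rewrite /box (@itv_bndbnd_setU _ _ _ (BRight m)) ?bnd_simp//.
  apply/seteqP; split => [p [[p1|p1] p2]|p [] [p1 p2]].
  - by left; split.
  - by right; split.
  - by split => //; left.
  - by split => //; right.
have dj : [disjoint box a m c d & box m b c d].
  apply/disj_setPS => p [] [] /=; rewrite !in_itv/= => /andP[_ xm] _ [] /andP[mx _] _.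
  by move: (lt_le_trans mx xm); rewrite ltxx.
have bi : mu2.-integrable (box a m c d `|` box m b c d) (EFin \o (h \o @cpt R)).
  by rewrite -bs; apply: integrable_box => //; apply: le_trans mb.
have := Rintegral_setU (measurable_box a m c d) (measurable_box m b c d) bi dj.
rewrite -bs /= => ->.
have -> : \int[leb]_(y in `]c, d]%classic) (P (pt b y) - P (pt a y)) =
    \int[leb]_(y in `]c, d]%classic) (P (pt m y) - P (pt a y)) +
    \int[leb]_(y in `]c, d]%classic) (P (pt b y) - P (pt m y)); last by lra.
rewrite -RintegralD//; try exact: integrable_itv.
by apply: eq_Rintegral => y _ /=; ring.
Qed.

Let Dy a b c m d : a <= b -> c <= m -> m <= d ->
  flux_defect a b c d = flux_defect a b c m + flux_defect a b m d.
Proof.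
move=> ab cm md; rewrite /flux_defect (itv_split cm md); last exact: cPB.
have bs : box a b c d = box a b c m `|` box a b m d.
  rewrite /box (@itv_bndbnd_setU _ _ (BRight c) (BRight m) (BRight d)) ?bnd_simp//.
  apply/seteqP; split => [p [p1 [p2|p2]]|p [] [p1 p2]].
  - by left; split.
  - by right; split.
  - by split => //; left.
  - by split => //; right.
have dj : [disjoint box a b c m & box a b m d].
  apply/disj_setPS => p [] [] /=; rewrite !in_itv/= => _ /andP[_ xm] [] _ /andP[mx _].
  by move: (lt_le_trans mx xm); rewrite ltxx.
have bi : mu2.-integrable (box a b c m `|` box a b m d) (EFin \o (h \o @cpt R)).
  by rewrite -bs; apply: integrable_box => //; apply: le_trans md.
have := Rintegral_setU (measurable_box a b c m) (measurable_box a b m d) bi dj.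
rewrite -bs /= => ->.
have -> : \int[leb]_(x in `]a, b]%classic) (Q (pt x d) - Q (pt x c)) =
    \int[leb]_(x in `]a, b]%classic) (Q (pt x m) - Q (pt x c)) +
    \int[leb]_(x in `]a, b]%classic) (Q (pt x d) - Q (pt x m)); last by lra.
rewrite -RintegralD//; try exact: integrable_itv.
by apply: eq_Rintegral => y _ /=; ring.
Qed.

Let flux_bound (a b c d p q r e : R) : a <= b -> c <= d ->
  (forall y, c < y -> y <= d -> `|P (pt b y) - P (pt a y) - p| <= e) ->
  (forall x, a < x -> x <= b -> `|Q (pt x d) - Q (pt x c) - q| <= e) ->
  (forall x y, a < x -> x <= b -> c < y -> y <= d -> `|h (pt x y) - r| <= e) ->
  `|flux_defect a b c d - (p * (d - c) + q * (b - a) - r * ((b - a) * (d - c)))|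
    <= e * ((d - c) + (b - a) + (b - a) * (d - c)).
Proof.
move=> ab cd hP hQ hh; rewrite /flux_defect.
have := @Rintegral_near_cst _ _ _ leb `]c, d]%classic
  (fun y => P (pt b y) - P (pt a y)) p e (d - c) (measurable_itv _) (mu_itvoc cd)
  (integrable_itv _ _ (@cPB _ _)).
have := @Rintegral_near_cst _ _ _ leb `]a, b]%classic
  (fun y => Q (pt y d) - Q (pt y c)) q e (b - a) (measurable_itv _) (mu_itvoc ab)
  (integrable_itv _ _ (@cQB _ _)).
have := @Rintegral_near_cst _ _ _ mu2 (box a b c d)
  (h \o @cpt R) r e ((b - a) * (d - c)) (measurable_box _ _ _ _) (mu_box ab cd)
  (integrable_box ab cd ch).
move=> H1 H2 H3.
have {}H1 : `|\int[mu2]_(p in box a b c d) h (cpt p) - r * ((b - a) * (d - c))| <=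
    e * ((b - a) * (d - c)).
  apply: H1 => -[x y] [] /=; rewrite !in_itv/= => /andP[? ?] /andP[? ?].
  exact: hh.
have {}H2 : `|\int[leb]_(x in `]a, b]%classic) (Q (pt x d) - Q (pt x c)) - q * (b - a)| <=
    e * (b - a).
  by apply: H2 => x; rewrite /= in_itv/= => /andP[]; exact: hQ.
have {}H3 : `|\int[leb]_(y in `]c, d]%classic) (P (pt b y) - P (pt a y)) - p * (d - c)| <=
    e * (d - c).
  by apply: H3 => x; rewrite /= in_itv/= => /andP[]; exact: hP.
move: H1 H2 H3.
set I1 := Rintegral _ _ _; set I2 := Rintegral _ _ _; set I3 := Rintegral _ _ _.
rewrite !ler_norml => /andP[? ?] /andP[? ?] /andP[? ?].
by apply/andP; split; lra.
Qed.

(** On a box of sides l and k around [z], the vertical sides contribute aP l k and the horizontal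
    ones bQ k l, which cancel h(z) l k; each error is a small multiple of the squared size. *)
Let D_loc z aP bP aQ bQ : rdiff P z aP bP -> rdiff Q z aQ bQ -> h z = aP + bQ ->
  forall e : R, 0 < e -> exists2 del : R, 0 < del &
    forall a b c d, a <= re z <= b -> c <= im z <= d -> b - a < del -> d - c < del ->
      `|flux_defect a b c d| <= e * ((b - a) + (d - c)) ^+ 2.
Proof.
move=> dP dQ hz e e0.
have e4 : 0 < e / 4 by rewrite divr_gt0.
have [d1 d10 h1] := dP _ e4; have [d2 d20 h2] := dQ _ e4.
have /continuous_rnmP/(_ _ e4)[d3 d30 h3] := @ch z.
pose dm := Num.min d1 (Num.min d2 d3).
have dm0 : 0 < dm by rewrite !lt_min d10 d20 d30.
exists (dm / 2); first by rewrite divr_gt0.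
move=> a b c d /andP[ax xb] /andP[cy yd] bad dcd.
have near x y : a <= x -> x <= b -> c <= y -> y <= d ->
    [/\ nm (pt x y - z) <= (b - a) + (d - c), nm (pt x y - z) < d1,
     nm (pt x y - z) < d2 & nm (pt x y - z) < d3].
  move=> xa xb' yc yd'.
  have H : nm (pt x y - z) <= (b - a) + (d - c).
    rewrite (le_trans (nm_le_reim _))// !reim re_pt im_pt lerD//.
    - by rewrite ler_norml; apply/andP; split; lra.
    - by rewrite ler_norml; apply/andP; split; lra.
  have H' : nm (pt x y - z) < dm by lra.
  by move: H'; rewrite !lt_min => /andP[? /andP[? ?]].
pose l := b - a; pose k := d - c.
have l0 : 0 <= l by rewrite /l; lra.
have k0 : 0 <= k by rewrite /k; lra.
have sq0 : e / 4 * (2 * (l + k)) * (d - c) + e / 4 * (2 * (l + k)) * (b - a) +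
   e / 4 * ((b - a) * (d - c)) <=
   e * ((b - a) + (d - c)) ^+ 2.
  by rewrite -/l -/k; have : 0 <= l * k by [rewrite mulr_ge0]; nra.
have H1 : `|\int[leb]_(y in `]c, d]%classic) (P (pt b y) - P (pt a y)) - (aP * l) * k|
    <= e / 4 * (2 * (l + k)) * k.
  have cd : c <= d by lra.
  apply: (@Rintegral_near_cst _ _ _ leb `]c, d]%classic
    (fun y => P (pt b y) - P (pt a y)) (aP * l) _ k (measurable_itv _) (mu_itvoc cd)
    (integrable_itv _ _ (@cPB _ _))) => y; rewrite /= in_itv/= => /andP[y1 y2].
  have [||n1 n2 _ _] := @near b y _ _ (ltW y1) y2; [lra..|].
  have [||n3 n4 _ _] := @near a y _ _ (ltW y1) y2; [lra..|].
  move: (h1 _ n2) (h1 _ n4); rewrite !re_pt !im_pt -/l -/k in n1 n3 *.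
  rewrite !ler_norml => /andP[? ?] /andP[? ?].
  have : e / 4 * nm (pt b y - z) <= e / 4 * (l + k) by rewrite ler_pM2l.
  have : e / 4 * nm (pt a y - z) <= e / 4 * (l + k) by rewrite ler_pM2l.
  by rewrite /l; move=> ? ?; apply/andP; split; lra.
have H2 : `|\int[leb]_(x in `]a, b]%classic) (Q (pt x d) - Q (pt x c)) - (bQ * k) * l|
    <= e / 4 * (2 * (l + k)) * l.
  have ab : a <= b by lra.
  apply: (@Rintegral_near_cst _ _ _ leb `]a, b]%classic
    (fun y => Q (pt y d) - Q (pt y c)) (bQ * k) _ l (measurable_itv _) (mu_itvoc ab)
    (integrable_itv _ _ (@cQB _ _))) => x; rewrite /= in_itv/= => /andP[y1 y2].
  have [||n1 _ n2 _] := @near x d (ltW y1) y2; [lra..|].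
  have [||n3 _ n4 _] := @near x c (ltW y1) y2; [lra..|].
  move: (h2 _ n2) (h2 _ n4); rewrite !re_pt !im_pt -/l -/k in n1 n3 *.
  rewrite !ler_norml => /andP[? ?] /andP[? ?].
  have : e / 4 * nm (pt x d - z) <= e / 4 * (l + k) by rewrite ler_pM2l.
  have : e / 4 * nm (pt x c - z) <= e / 4 * (l + k) by rewrite ler_pM2l.
  by rewrite /k; move=> ? ?; apply/andP; split; lra.
have H3 : `|\int[mu2]_(p in box a b c d) h (cpt p) - h z * (l * k)| <= e / 4 * (l * k).
  have ab : a <= b by lra.
  have cd : c <= d by lra.
  apply: (@Rintegral_near_cst _ _ _ mu2 (box a b c d)
    (h \o @cpt R) _ _ (l * k) (measurable_box _ _ _ _) (mu_box ab cd)
    (integrable_box ab cd ch)) => -[x y] [] /=; rewrite !in_itv/= => /andP[? ?] /andP[? ?].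
  have [||||_ _ _ n] := @near x y; [lra..|].
  exact: ltW (h3 _ n).
move: H1 H2 H3; rewrite /flux_defect hz.
set I1 := Rintegral _ _ _; set I2 := Rintegral _ _ _; set I3 := Rintegral _ _ _.
rewrite !ler_norml => /andP[? ?] /andP[? ?] /andP[? ?].
by rewrite -/l -/k in sq0 *; apply/andP; split; lra.
Qed.

Variable w : C.
Hypothesis dPQ : forall z, z != w -> exists aP bP aQ bQ,
  [/\ rdiff P z aP bP, rdiff Q z aQ bQ & h z = aP + bQ].

Let D_off a b c d : a <= b -> c <= d ->
  (forall z, a <= re z <= b -> c <= im z <= d -> z != w) -> flux_defect a b c d = 0.
Proof.
move=> ab cd nw; apply: bisection_eq0 => //.
move=> x y xab ycd e e0.
have [aP [bP [aQ [bQ [dP dQ hz]]]]] := dPQ (nw (pt x y) xab ycd).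
have [del del0 hdel] := D_loc dP dQ hz e0.
by exists del => // a' b' c' d' _ xa' _ _ yc' _; exact: hdel.
Qed.

(** A crude bound that needs only boundedness of the three functions, hence remains valid for boxes
    containing [w]. *)
Let D_small a0 b0 c0 d0 : a0 <= b0 -> c0 <= d0 -> exists2 M : R, 0 < M &
  forall a b c d, a0 <= a -> a <= b -> b <= b0 -> c0 <= c -> c <= d -> d <= d0 ->
  `|flux_defect a b c d| <= M * ((d - c) + (b - a) + (b - a) * (d - c)).
Proof.
move=> ab0 cd0.
have [MP hP] := bounded_box a0 b0 c0 d0 cP.
have [MQ hQ] := bounded_box a0 b0 c0 d0 cQ.
have [Mh hh] := bounded_box a0 b0 c0 d0 ch.
exists (1 + 2 * `|MP| + 2 * `|MQ| + `|Mh|).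
  by have := normr_ge0 MP; have := normr_ge0 MQ; have := normr_ge0 Mh; lra.
move=> a b c d a0a ab bb0 c0c cd dd0.
have nP := normr_ge0 MP; have nQ := normr_ge0 MQ; have nh := normr_ge0 Mh.
have lP := ler_norm MP; have lQ := ler_norm MQ; have lh := ler_norm Mh.
have := @flux_bound a b c d 0 0 0 (1 + 2 * `|MP| + 2 * `|MQ| + `|Mh|) ab cd.
rewrite !mul0r addr0 !subr0; apply.
- move=> y y1 y2; rewrite subr0; apply: le_trans (ler_normB _ _) _.
  have := hP (pt b y); have := hP (pt a y); rewrite !re_pt !im_pt.
  have -> : a0 <= a <= b0 by apply/andP; split; lra.
  have -> : a0 <= b <= b0 by apply/andP; split; lra.
  have -> : c0 <= y <= d0 by apply/andP; split; lra.
  by move=> /(_ isT isT) ? /(_ isT isT) ?; lra.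
- move=> y y1 y2; rewrite subr0; apply: le_trans (ler_normB _ _) _.
  have := hQ (pt y c); have := hQ (pt y d); rewrite !re_pt !im_pt.
  have -> : a0 <= y <= b0 by apply/andP; split; lra.
  have -> : c0 <= c <= d0 by apply/andP; split; lra.
  have -> : c0 <= d <= d0 by apply/andP; split; lra.
  by move=> /(_ isT isT) ? /(_ isT isT) ?; lra.
- move=> x y x1 x2 y1 y2; rewrite subr0.
  have := hh (pt x y); rewrite !re_pt !im_pt.
  have -> : a0 <= x <= b0 by apply/andP; split; lra.
  have -> : c0 <= y <= d0 by apply/andP; split; lra.
  by move=> /(_ isT isT) ?; lra.
Qed.

Let Dx0 a c d : c <= d -> flux_defect a a c d = 0.
Proof. by move=> cd; have := @Dx a a a c d (lexx _) (lexx _) cd; lra. Qed.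

Let Dy0 a b c : a <= b -> flux_defect a b c c = 0.
Proof. by move=> ab; have := @Dy a b c c c ab (lexx _) (lexx _); lra. Qed.

(* At the exceptional point w, cut the rectangle along a small square around w:
   only that square contributes, and its contribution is of the order of its side. *)
Lemma divergence_eq0 a b c d : a <= b -> c <= d -> flux_defect a b c d = 0.
Proof.
move=> ab cd.
have [win|] := boolP ((a <= re w <= b) && (c <= im w <= d)); last first.
  move=> h1; apply: D_off => // z h2 h3.
  by apply: contraNneq h1 => <-; rewrite h2 h3.
have /andP[/andP[aw wb] /andP[cw wd]] := win.
have [M M0 hM] := D_small ab cd.
apply/eqP; rewrite -normr_eq0 eq_le normr_ge0 andbT; apply/ler_addgt0Pr => e e0.
(* The small box has sides at most [2 * del], and [del <= 1] bounds its area by [4 * del]: the three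
   terms of the crude bound add up to [8 * del]. *)
rewrite add0r; pose del := Num.min 1 (e / (8 * M)).
have del0 : 0 < del by rewrite lt_min ltr01 divr_gt0// mulr_gt0.
have del1 : del <= 1 by rewrite ge_min lexx.
have delM : M * (8 * del) <= e.
  have : del <= e / (8 * M) by rewrite ge_min lexx orbT.
  by rewrite ler_pdivlMr ?mulr_gt0//; lra.
pose x1 := Num.max a (re w - del); pose x2 := Num.min b (re w + del).
pose y1 := Num.max c (im w - del); pose y2 := Num.min d (im w + del).
have ax1 : a <= x1 by rewrite le_max lexx.
have x1w : x1 <= re w by rewrite ge_max aw/=; lra.
have wx2 : re w <= x2 by rewrite le_min wb/=; lra.
have x2b : x2 <= b by rewrite ge_min lexx.
have cy1 : c <= y1 by rewrite le_max lexx.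
have y1w : y1 <= im w by rewrite ge_max cw/=; lra.
have wy2 : im w <= y2 by rewrite le_min wd/=; lra.
have y2d : y2 <= d by rewrite ge_min lexx.
have x1d : re w - del <= x1 by rewrite le_max lexx orbT.
have x2d : x2 <= re w + del by rewrite ge_min lexx orbT.
have y1d : im w - del <= y1 by rewrite le_max lexx orbT.
have y2d' : y2 <= im w + del by rewrite ge_min lexx orbT.
(* Either the strip is degenerate, or [x1] is [re w - del] and the strip misses [w]. The three other
   strips are alike. *)
have L1 : flux_defect a x1 c d = 0.
  have [->|nx] := eqVneq x1 a; first exact: Dx0.
  apply: D_off => // z /andP[_ zx] _; apply: contra_neq nx => zw.
  by rewrite zw /x1 in zx *; case: (leP a (re w - del)) zx => // ? ?; lra.
have L2 : flux_defect x2 b c d = 0.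
  have [->|nx] := eqVneq x2 b; first exact: Dx0.
  apply: D_off => // z /andP[zx _] _; apply: contra_neq nx => zw.
  by rewrite zw /x2 in zx *; case: (leP b (re w + del)) zx => // ? ?; lra.
have x12 : x1 <= x2 by apply: le_trans wx2.
have y12 : y1 <= y2 by apply: le_trans wy2.
have L3 : flux_defect x1 x2 c y1 = 0.
  have [->|nx] := eqVneq y1 c; first exact: Dy0.
  apply: D_off => // z _ /andP[_ zx]; apply: contra_neq nx => zw.
  by rewrite zw /y1 in zx *; case: (leP c (im w - del)) zx => // ? ?; lra.
have L4 : flux_defect x1 x2 y2 d = 0.
  have [->|nx] := eqVneq y2 d; first exact: Dy0.
  apply: D_off => // z _ /andP[zx _]; apply: contra_neq nx => zw.
  by rewrite zw /y2 in zx *; case: (leP d (im w + del)) zx => // ? ?; lra.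
rewrite (@Dx a x1 b c d)//; last exact: le_trans x2b.
rewrite (@Dx x1 x2 b c d)// L1 L2 add0r addr0.
rewrite (@Dy x1 x2 c y1 d)//; last exact: le_trans y2d.
rewrite (@Dy x1 x2 y1 y2 d)// L3 L4 add0r addr0.
apply: le_trans (hM _ _ _ _ ax1 x12 x2b cy1 y12 y2d) _.
apply: le_trans delM; rewrite ler_pM2l//.
have : (x2 - x1) * (y2 - y1) <= (2 * del) * (2 * 1).
  by apply: ler_pM; lra.
by lra.
Qed.

End Divergence.

Lemma Rintegral0_eq d (T : measurableType d) (R : realType)
  (mu : {measure set T -> \bar R}) (D : set T) (f : T -> R) :
  (forall x, D x -> f x = 0) -> \int[mu]_(x in D) f x = 0.
Proof. by move=> h; rewrite /Rintegral integral0_eq// => x /h ->. Qed.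

(** * Wirtinger derivatives and Green's formula on the disc *)

Section Wirtinger.
Variable R : realType.
Local Notation C := (Cx R).
Implicit Types (z w : C) (F G : C -> C).

Lemma le_of_eq (x y : R) : x = y -> x <= y. Proof. by move=> ->. Qed.

(* Real differentiability at z; a and b are the Wirtinger derivatives. *)
Definition cdiff (F : C -> C) (z a b : C) :=
  forall e : R, 0 < e -> exists2 del : R, 0 < del & forall z', nm (z' - z) < del ->
    nm (F z' - F z - a * (z' - z) - b * cj (z' - z)) <= e * nm (z' - z).

Lemma cdiff_re F z a b : cdiff F z a b ->
  rdiff (fun z => re (F z)) z (re a + re b) (im b - im a).
Proof.
move=> h e /h[del del0 hd]; exists del => // z' /hd; apply: le_trans.
by apply: le_trans (re_nm _); rewrite !reim; apply: le_of_eq; congr `|_|; ring.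
Qed.

Lemma cdiff_im F z a b : cdiff F z a b ->
  rdiff (fun z => im (F z)) z (im a + im b) (re a - re b).
Proof.
move=> h e /h[del del0 hd]; exists del => // z' /hd; apply: le_trans.
by apply: le_trans (im_nm _); rewrite !reim; apply: le_of_eq; congr `|_|; ring.
Qed.

Lemma rdiffN (P : C -> R) z a b : rdiff P z a b -> rdiff (fun z => - P z) z (- a) (- b).
Proof.
move=> h e /h[del del0 hd]; exists del => // z' /hd; apply: le_trans.
by rewrite -normrN; apply: le_of_eq; congr `|_|; ring.
Qed.

Lemma cdiff_near F G z a b :
  (\forall z' \near z, F z' = G z') -> cdiff F z a b -> cdiff G z a b.
Proof.
move=> /nbhs_nm[d d0 hd] h e /h[del del0 hdel].
exists (Num.min d del); first by rewrite lt_min d0.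
move=> z'; rewrite lt_min => /andP[h1 h2].
by rewrite -!hd// ?subrr ?nm0//; exact: hdel.
Qed.

Lemma cdiff_lip F z a b : cdiff F z a b -> exists2 del : R, 0 < del &
  forall z', nm (z' - z) < del -> nm (F z' - F z) <= (1 + nm a + nm b) * nm (z' - z).
Proof.
move=> /(_ _ ltr01)[del del0 hd]; exists del => // z' /hd h.
have := nmD (F z' - F z - a * (z' - z) - b * cj (z' - z))
  (a * (z' - z) + b * cj (z' - z)).
have := nmD (a * (z' - z)) (b * cj (z' - z)).
rewrite !nmM nm_cj.
rewrite (_ : _ - _ + (_ + _) = F z' - F z); last by ring.
by lra.
Qed.

Lemma cdiff_continuous F z a b : cdiff F z a b -> {for z, continuous F}.
Proof.
move=> /cdiff_lip[del del0 hd]; apply/continuous_nmP => e e0.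
have K0 : 0 < 1 + nm a + nm b by have := nm_ge0 a; have := nm_ge0 b; lra.
exists (Num.min del (e / (1 + nm a + nm b))).
  by rewrite lt_min del0 divr_gt0.
move=> z'; rewrite lt_min => /andP[/hd h1 h2]; apply: le_lt_trans h1 _.
by rewrite mulrC -ltr_pdivlMr.
Qed.

Lemma cdiff_cst (c z : C) : cdiff (fun=> c) z 0 0.
Proof.
move=> e e0; exists 1 => // z' _.
by rewrite !mul0r !subr0 subrr nm0 mulr_ge0 ?nm_ge0// ltW.
Qed.

Lemma cdiff_id z : cdiff id z 1 0.
Proof.
move=> e e0; exists 1 => // z' _.
by rewrite mul1r mul0r subrr subr0 nm0 mulr_ge0 ?nm_ge0// ltW.
Qed.

Lemma cdiff_cj F z a b : cdiff F z a b -> cdiff (fun z => cj (F z)) z (cj b) (cj a).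
Proof.
move=> h e /h[del del0 hd]; exists del => // z' /hd; apply: le_trans.
by rewrite -nm_cj !(cjB, cjM) !cjK; apply: le_of_eq; congr nm; ring.
Qed.

Lemma cdiffD F G z a b a' b' : cdiff F z a b -> cdiff G z a' b' ->
  cdiff (fun z => F z + G z) z (a + a') (b + b').
Proof.
move=> hF hG e e0; have e2 : 0 < e / 2 by rewrite divr_gt0.
have [d d0 hd] := hF _ e2; have [d' d'0 hd'] := hG _ e2.
exists (Num.min d d'); first by rewrite lt_min d0.
move=> z'; rewrite lt_min => /andP[/hd h1 /hd' h2].
set u := z' - z in h1 h2 *.
rewrite (_ : _ - _ - _ - _ = (F z' - F z - a * u - b * cj u) +
  (G z' - G z - a' * u - b' * cj u)); last by ring.
by apply: le_trans (nmD _ _) _; lra.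
Qed.

Lemma cdiffM F G z a b a' b' : cdiff F z a b -> cdiff G z a' b' ->
  cdiff (fun z => F z * G z) z (a * G z + F z * a') (b * G z + F z * b').
Proof.
move=> hF hG e e0.
have cG := cdiff_continuous hG.
have p1 := nm_ge0 (G z); have p2 := nm_ge0 (F z).
have p3 := nm_ge0 a; have p4 := nm_ge0 b.
have e1 : 0 < e / (3 * (nm (G z) + 1)) by rewrite divr_gt0//; lra.
have e2 : 0 < e / (3 * (nm a + nm b + 1)) by rewrite divr_gt0//; lra.
have e3 : 0 < e / (3 * (nm (F z) + 1)) by rewrite divr_gt0//; lra.
have [d1 d10 h1] := hF _ e1; have [d2 d20 h2] := hG _ e3.
have /continuous_nmP/(_ _ e2)[d3 d30 h3] := cG.
have /continuous_nmP/(_ _ ltr01)[d4 d40 h4] := cG.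
exists (Num.min (Num.min d1 d2) (Num.min d3 d4)).
  by rewrite !lt_min d10 d20 d30 d40.
move=> z'; rewrite !lt_min => /andP[/andP[/h1 {}h1 /h2 {}h2] /andP[/h3 {}h3 /h4 {}h4]].
set u := z' - z in h1 h2 *.
rewrite (_ : _ - _ - _ - _ = (F z' - F z - a * u - b * cj u) * G z' +
  ((a * u + b * cj u) * (G z' - G z) + F z * (G z' - G z - a' * u - b' * cj u)));
  last by ring.
have u0 := nm_ge0 u.
apply: le_trans (nmD _ _) _.
have t1 : nm ((F z' - F z - a * u - b * cj u) * G z') <= e / 3 * nm u.
  rewrite nmM; have g' : nm (G z') <= nm (G z) + 1.
    by have := nmD (G z' - G z) (G z); rewrite subrK; lra.
  have := ler_pM (nm_ge0 _) (nm_ge0 _) h1 g'.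
  rewrite (_ : e / (3 * (nm (G z) + 1)) * nm u * (nm (G z) + 1) = e / 3 * nm u)//.
  by field; rewrite gt_eqF//; lra.
have t2 : nm ((a * u + b * cj u) * (G z' - G z)) <= e / 3 * nm u.
  rewrite nmM; have g' : nm (a * u + b * cj u) <= (nm a + nm b + 1) * nm u.
    by apply: le_trans (nmD _ _) _; rewrite !nmM nm_cj; lra.
  have := ler_pM (nm_ge0 _) (nm_ge0 _) g' (ltW h3).
  rewrite (_ : (nm a + nm b + 1) * nm u * (e / (3 * (nm a + nm b + 1))) = e / 3 * nm u)//.
  by field; rewrite gt_eqF//; lra.
have t3 : nm (F z * (G z' - G z - a' * u - b' * cj u)) <= e / 3 * nm u.
  rewrite nmM; have g' : nm (F z) <= nm (F z) + 1 by lra.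
  have := ler_pM (nm_ge0 _) (nm_ge0 _) g' h2.
  rewrite (_ : (nm (F z) + 1) * (e / (3 * (nm (F z) + 1)) * nm u) = e / 3 * nm u)//.
  by field; rewrite gt_eqF//; lra.
by apply: le_trans (lerD t1 (le_trans (nmD _ _) (lerD t2 t3))) _; lra.
Qed.

Lemma cdiff_eq F z a b a' b' : a = a' -> b = b' -> cdiff F z a b -> cdiff F z a' b'.
Proof. by move=> -> ->. Qed.

Lemma cdiffX F z a b n : cdiff F z a b ->
  cdiff (fun z => F z ^+ n) z (n%:R * F z ^+ n.-1 * a) (n%:R * F z ^+ n.-1 * b).
Proof.
move=> h; elim: n => [|n ih].
  by apply: cdiff_eq (@cdiff_cst 1 z); rewrite !mul0r.
have := cdiffM h ih.
rewrite (_ : (fun z => F z * F z ^+ n) = (fun z => F z ^+ n.+1)); last first.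
  by apply/funext => x; rewrite exprS.
apply: cdiff_eq; rewrite -natr1 /=; case: n {ih} => [|n] /=;
  rewrite ?exprS ?expr0; ring.
Qed.

(* Taylor's formula with a quadratic remainder suffices for the real chain rule. *)
Lemma cdiff_radial (phi : R -> R) (z : C) (D K : R) :
  (forall s, `|phi s - phi (1 - nm z ^+ 2) - D * (s - (1 - nm z ^+ 2))| <=
     K * (s - (1 - nm z ^+ 2)) ^+ 2) ->
  cdiff (fun z => rc (phi (1 - nm z ^+ 2))) z (- rc D * cj z) (- rc D * z).
Proof.
move=> hphi e e0.
pose M := `|D| + `|K| * (2 * nm z + 1) ^+ 2 + 1.
have z0 := nm_ge0 z.
have M0 : 0 < M.
  by rewrite /M ltr_wpDl// addr_ge0// mulr_ge0// sqr_ge0.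
exists (Num.min 1 (e / M)); first by rewrite lt_min ltr01 divr_gt0.
move=> z'; rewrite lt_min => /andP[h1 h2].
pose u := z' - z; have zE : z' = z + u by rewrite /u addrC subrK.
have u0 := nm_ge0 u.
pose s' := 1 - nm z' ^+ 2; pose s := 1 - nm z ^+ 2.
have sE : rc (s' - s) = - (cj z * u + z * cj u + rc (nm u ^+ 2)).
  rewrite /s' /s (_ : 1 - _ - _ = nm z ^+ 2 - nm z' ^+ 2); last by ring.
  by rewrite rcB -!mul_cj zE cjD; ring.
have sb : `|s' - s| <= (2 * nm z + 1) * nm u.
  rewrite -nm_rc sE nmN; apply: le_trans (nmD _ _) _; apply: le_trans (lerD (nmD _ _) (lexx _)) _.
  rewrite !nmM !nm_cj nm_rc ger0_norm ?sqr_ge0//.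
  by rewrite -/u in h1; nra.
rewrite -/s' -/s (_ : _ - _ - _ - _ = rc (phi s' - phi s - D * (s' - s)) -
    rc D * rc (nm u ^+ 2)); last first.
  rewrite -/u (rcB (phi s' - phi s)) (rcB (phi s')) (rcM D (s' - s)) sE; ring.
apply: le_trans (nmB _ _) _; rewrite nmM !nm_rc (ger0_norm (sqr_ge0 (nm u))).
have := hphi s'; rewrite -/s => h3.
have h4 : K * (s' - s) ^+ 2 <= `|K| * ((2 * nm z + 1) * nm u) ^+ 2.
  apply: (@le_trans _ _ (`|K| * (s' - s) ^+ 2)).
    by rewrite ler_wpM2r ?sqr_ge0// ler_norm.
  rewrite ler_wpM2l// -(real_normK (num_real (s' - s))) ler_pXn2r// nnegrE//.
  by rewrite mulr_ge0//; lra.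
have h5 : nm u * M <= e by rewrite -ler_pdivlMr// ltW.
have : (nm u * M) * nm u <= e * nm u by rewrite ler_wpM2r.
rewrite /M; move: h3 h4; rewrite -/u; set X := `|phi _ - _ - _|; set Y := K * _ ^+ 2.
have : 0 <= nm u * nm u by rewrite mulr_ge0.
by move=> ? ? ? ?; nra.
Qed.

Lemma diff_scal (f : C -> C) z (u : C) : 'd f z u = u * 'd f z 1.
Proof.
have -> : 'd f z u = 'd f z (u *: (1 : C)) by rewrite /GRing.scale /= mulr1.
by rewrite linearZ.
Qed.

(** The differential is linear over [C], so its conjugate-linear part is 0: the Cauchy-Riemann
    equation. *)
Lemma diff_cdiff (f : C -> C) z : differentiable f z -> cdiff f z ('d f z 1) 0.
Proof.
move=> df e e0.
have re0 : 0 < rc e by rewrite -rc0 rc_lt.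
have /eqaddoP/(_ _ re0)/nbhs_nm[del del0 hd] := diff_locally df.
exists del => // z' h.
have /hd : nm (z' - z - 0) < del by rewrite subr0.
rewrite /= !normE -rcM rc_le; apply: le_trans; apply: le_of_eq; congr nm.
rewrite !fctE /= subrK (diff_scal f z (z' - z)).
by rewrite mul0r subr0; ring.
Qed.

Local Notation mu2 := (@lebesgue_measure R \x @lebesgue_measure R)%E.

(** The divergence theorem is applied on the square of side 2 around the disc: its boundary lies
    where the field vanishes, and so does the part of the square outside the disc. *)
Let flux_green (P Q h : C -> R) w (r : R) : continuous P -> continuous Q -> continuous h ->
  (forall z, z != w -> exists aP bP aQ bQ,
     [/\ rdiff P z aP bP, rdiff Q z aQ bQ & h z = aP + bQ]) ->
  r < 1 -> (forall z, r <= nm z -> [/\ P z = 0, Q z = 0 & h z = 0]) ->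
  \int[mu2]_(p in @disc_plane R) h (cpt p) = 0.
Proof.
move=> cP cQ ch dPQ r1 h0.
have n1 : -1 <= 1 :> R by lra.
have := divergence_eq0 cP cQ ch dPQ n1 n1; rewrite /flux_defect.
have big x y : `|x| = 1 \/ `|y| = 1 -> r <= nm (pt x y).
  have := re_nm (pt x y); have := im_nm (pt x y); rewrite re_pt im_pt => ? ?.
  by case; lra.
have -> : \int[lebesgue_measure]_(y in `]-1, 1]%classic) (P (pt 1 y) - P (pt (-1) y)) = 0.
  apply: Rintegral0_eq => y _; have [|-> _ _] := @h0 (pt 1 y);
    first by apply: big; left; rewrite normr1.
  have [|-> _ _] := @h0 (pt (-1) y); first by apply: big; left; rewrite normrN1.
  by rewrite subrr.
have -> : \int[lebesgue_measure]_(y in `]-1, 1]%classic) (Q (pt y 1) - Q (pt y (-1))) = 0.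
  apply: Rintegral0_eq => y _; have [|_ -> _] := @h0 (pt y 1);
    first by apply: big; right; rewrite normr1.
  have [|_ -> _] := @h0 (pt y (-1)); first by apply: big; right; rewrite normrN1.
  by rewrite subrr.
rewrite addr0 sub0r => /eqP; rewrite oppr_eq0 => /eqP <-.
rewrite [LHS]Rintegral_mkcond [RHS]Rintegral_mkcond; congr Rintegral.
apply/funext => p; rewrite /patch.
case: ifPn => [|/negP]; rewrite inE => dp; case: ifPn => // /negP; rewrite inE => bp.
- case: bp; move: dp => /discE; rewrite -/(cpt p) => dp.
  have := re_nm (cpt p); have := im_nm (cpt p).
  rewrite re_cpt im_cpt !ler_norml => /andP[? ?] /andP[? ?].
  by split; rewrite /= in_itv/=; apply/andP; split; lra.
- have [] // := @h0 (cpt p); rewrite leNgt; apply/negP => h1; apply: dp.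
  by apply/discE; rewrite -/(cpt p); lra.
Qed.

Lemma disc_integralE (G : C -> C) : disc_integral G =
  pt (\int[mu2]_(p in @disc_plane R) re (G (cpt p)))
     (\int[mu2]_(p in @disc_plane R) im (G (cpt p))).
Proof. by []. Qed.

(** For G = u + iv, twice its derivative in the conjugate variable has real part u_x - v_y and
    imaginary part v_x + u_y: these are the divergences of the fields (u, -v) and (v, u). At [w]
    only continuity is asked, which suits a difference quotient. *)
Lemma green_disc (G H : C -> C) w (r : R) : continuous G -> continuous H ->
  (forall z, z != w -> exists a, cdiff G z a (H z)) ->
  r < 1 -> (forall z, r <= nm z -> G z = 0 /\ H z = 0) -> disc_integral H = 0.
Proof.
move=> cG cH dG r1 h0.
have cre (K : C -> C) : continuous K -> continuous (fun z => re (K z)).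
  by move=> cK z; exact: (cr_re (@cK z)).
have cim (K : C -> C) : continuous K -> continuous (fun z => im (K z)).
  by move=> cK z; exact: (cr_im (@cK z)).
have c2 (k : C -> R) : continuous k -> continuous (fun z => 2 * k z).
  by move=> ck z; exact: (crM (@cr_cst R 2 z) (@ck z)).
have half (k : C -> R) : continuous k ->
    \int[mu2]_(p in @disc_plane R) (2 * k (cpt p)) = 0 ->
    \int[mu2]_(p in @disc_plane R) k (cpt p) = 0.
  move=> ck; rewrite RintegralZl; first by move/eqP; rewrite mulf_eq0 pnatr_eq0/= => /eqP.
    exact: measurable_disc_plane.
  apply: (@integrableS _ _ _ _ (box (-1) 1 (-1) 1)).
  - exact: measurable_box.
  - exact: measurable_disc_plane.
  - move=> p /discE; rewrite -/(cpt p) => dp.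
    have := re_nm (cpt p); have := im_nm (cpt p).
    rewrite re_cpt im_cpt !ler_norml => /andP[? ?] /andP[? ?].
    by split; rewrite /= in_itv/=; apply/andP; split; lra.
  - by apply: integrable_box => //; lra.
have E1 : \int[mu2]_(p in @disc_plane R) re (H (cpt p)) = 0.
  apply: (half (fun z => re (H z)) (cre _ cH)).
  apply: (@flux_green (fun z => re (G z)) (fun z => - im (G z)) (fun z => 2 * re (H z)) w r) => //.
  + exact: cre.
  + by move=> z; exact: (crN (cr_im (@cG z))).
  + by apply: c2; exact: cre.
  + move=> z /dG[a ha].
    exists (re a + re (H z)), (im (H z) - im a), (- (im a + im (H z))), (- (re a - re (H z))).
    by split; [exact: cdiff_re|apply: rdiffN; exact: cdiff_im|ring].
  + by move=> z /h0[-> ->]; rewrite !reim mulr0 oppr0.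
have E2 : \int[mu2]_(p in @disc_plane R) im (H (cpt p)) = 0.
  apply: (half (fun z => im (H z)) (cim _ cH)).
  apply: (@flux_green (fun z => im (G z)) (fun z => re (G z)) (fun z => 2 * im (H z)) w r) => //.
  + exact: cim.
  + exact: cre.
  + by apply: c2; exact: cim.
  + move=> z /dG[a ha]; exists (im a + im (H z)), (re a - re (H z)),
      (re a + re (H z)), (im (H z) - im a).
    by split; [exact: cdiff_im|exact: cdiff_re|ring].
  + by move=> z /h0[-> ->]; rewrite !reim mulr0.
by rewrite disc_integralE E1 E2.
Qed.

End Wirtinger.

(** * Integrals over the disc and the mean value formula *)

Section DiscIntegral.
Variable R : realType.
Local Notation C := (Cx R).
Local Notation D := (@disc_plane R).
Local Notation mu2 := (@lebesgue_measure R \x @lebesgue_measure R)%E.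
Implicit Types (F G : C -> C) (g : C -> R).

Definition rint g : R := \int[mu2]_(p in D) g (cpt p).
Definition rmeas g := measurable_fun D (fun p => g (cpt p)).
Definition rintegrable g := mu2.-integrable D (EFin \o (fun p => g (cpt p))).
Definition cmeas F := rmeas (fun z => re (F z)) /\ rmeas (fun z => im (F z)).
Definition cintegrable F :=
  rintegrable (fun z => re (F z)) /\ rintegrable (fun z => im (F z)).
Local Notation cint := (@disc_integral R).

Lemma in_disc_plane (p : measurableTypeR R * measurableTypeR R) : p \in D -> disc (cpt p).
Proof. by rewrite inE. Qed.

Lemma re_cint F : re (cint F) = rint (fun z => re (F z)). Proof. by []. Qed.
Lemma im_cint F : im (cint F) = rint (fun z => im (F z)). Proof. by []. Qed.

Lemma eq_rint g g' : (forall z, disc z -> g z = g' z) -> rint g = rint g'.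
Proof. by move=> h; apply: eq_Rintegral => p /in_disc_plane/h. Qed.

Lemma eq_cint F G : (forall z, disc z -> F z = G z) -> cint F = cint G.
Proof.
by move=> h; apply: cx_eq; rewrite ?(re_cint, im_cint); apply: eq_rint => z /h ->.
Qed.

Lemma eq_rmeas g g' : (forall z, disc z -> g z = g' z) -> rmeas g -> rmeas g'.
Proof. by move=> h; apply: eq_measurable_fun => p /in_disc_plane/h. Qed.

Lemma eq_rintegrable g g' : (forall z, disc z -> g z = g' z) -> rintegrable g -> rintegrable g'.
Proof.
move=> h; apply: eq_integrable; first exact: measurable_disc_plane.
by move=> p /in_disc_plane/h /= ->.
Qed.

Lemma eq_cintegrable F G : (forall z, disc z -> F z = G z) -> cintegrable F -> cintegrable G.
Proof.
by move=> h [h1 h2]; split; [apply: eq_rintegrable h1|apply: eq_rintegrable h2] => z /h ->.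
Qed.

Lemma rmeas_cont g : (forall z, disc z -> {for z, continuous g}) -> rmeas g.
Proof. exact: measurable_fun_disc. Qed.

Lemma cmeas_cont F : (forall z, disc z -> {for z, continuous F}) -> cmeas F.
Proof.
by move=> h; split; apply: rmeas_cont => z /h; [apply: cr_re|apply: cr_im].
Qed.

Lemma rmeasD g g' : rmeas g -> rmeas g' -> rmeas (fun z => g z + g' z).
Proof. exact: measurable_funD. Qed.
Lemma rmeasB g g' : rmeas g -> rmeas g' -> rmeas (fun z => g z - g' z).
Proof. exact: measurable_funB. Qed.
Lemma rmeasM g g' : rmeas g -> rmeas g' -> rmeas (fun z => g z * g' z).
Proof. exact: measurable_funM. Qed.

Lemma cmeasD F G : cmeas F -> cmeas G -> cmeas (fun z => F z + G z).
Proof.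
move=> [f1 f2] [g1 g2]; split.
- by apply: eq_rmeas (rmeasD f1 g1) => z _; rewrite reD.
- by apply: eq_rmeas (rmeasD f2 g2) => z _; rewrite imD.
Qed.

Lemma cmeasM F G : cmeas F -> cmeas G -> cmeas (fun z => F z * G z).
Proof.
move=> [f1 f2] [g1 g2]; split.
- by apply: eq_rmeas (rmeasB (rmeasM f1 g1) (rmeasM f2 g2)) => z _; rewrite reM.
- by apply: eq_rmeas (rmeasD (rmeasM f1 g2) (rmeasM f2 g1)) => z _; rewrite imM.
Qed.

Lemma cmeas_cst (c : C) : cmeas (fun=> c).
Proof. by apply: cmeas_cont => z _; exact: cc_cst. Qed.

Lemma rintegrable_bound g (M : R) : rmeas g -> (forall z, disc z -> `|g z| <= M) ->
  rintegrable g.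
Proof.
move=> mg hM; apply: (@integrable_bounded _ _ _ _ _ _ M) => //.
- exact: measurable_disc_plane.
- exact: mu_disc_fin.
- by move=> p /hM.
Qed.

Lemma rintegrable_le g g' : rmeas g -> (forall z, disc z -> `|g z| <= g' z) ->
  rintegrable g' -> rintegrable g.
Proof.
move=> mg h; apply: le_integrable; first exact: measurable_disc_plane.
  exact/measurable_EFinP.
move=> p Dp; rewrite /= lee_fin; apply: le_trans (h _ Dp) _; exact: ler_norm.
Qed.

Lemma cintegrable_le F g : cmeas F -> (forall z, disc z -> nm (F z) <= g z) ->
  rintegrable g -> cintegrable F.
Proof.
move=> [m1 m2] h ig; split.
- by apply: rintegrable_le ig => // z /h; exact: le_trans (re_nm _).
- by apply: rintegrable_le ig => // z /h; exact: le_trans (im_nm _).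
Qed.

Lemma cintegrable_bound F (M : R) : cmeas F -> (forall z, disc z -> nm (F z) <= M) ->
  cintegrable F.
Proof.
move=> [m1 m2] h; split.
- by apply: (@rintegrable_bound _ M) => // z /h; exact: le_trans (re_nm _).
- by apply: (@rintegrable_bound _ M) => // z /h; exact: le_trans (im_nm _).
Qed.

Lemma rintD g g' : rintegrable g -> rintegrable g' ->
  rint (fun z => g z + g' z) = rint g + rint g'.
Proof. by move=> *; rewrite /rint RintegralD//; exact: measurable_disc_plane. Qed.

Lemma rintB g g' : rintegrable g -> rintegrable g' ->
  rint (fun z => g z - g' z) = rint g - rint g'.
Proof. by move=> *; rewrite /rint RintegralB//; exact: measurable_disc_plane. Qed.

Lemma rintZ (a : R) g : rintegrable g -> rint (fun z => a * g z) = a * rint g.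
Proof. by move=> *; rewrite /rint RintegralZl//; exact: measurable_disc_plane. Qed.

Lemma rintN g : rintegrable g -> rint (fun z => - g z) = - rint g.
Proof.
move=> ig; rewrite -mulN1r -rintZ//.
by apply: eq_rint => z _; rewrite mulN1r.
Qed.

Lemma rintegrableD g g' : rintegrable g -> rintegrable g' ->
  rintegrable (fun z => g z + g' z).
Proof.
move=> i1 i2; have := integrableD (@measurable_disc_plane R) i1 i2.
by apply: eq_integrable; first exact: measurable_disc_plane.
Qed.

Lemma rintegrableB g g' : rintegrable g -> rintegrable g' ->
  rintegrable (fun z => g z - g' z).
Proof.
move=> i1 i2; have := integrableB (@measurable_disc_plane R) i1 i2.
by apply: eq_integrable; first exact: measurable_disc_plane.
Qed.

Lemma rintegrableZ (a : R) g : rintegrable g -> rintegrable (fun z => a * g z).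
Proof.
move=> i1; have := integrableZl (@measurable_disc_plane R) a i1.
by apply: eq_integrable; first exact: measurable_disc_plane.
Qed.

Lemma le_rint g g' : rintegrable g -> rintegrable g' ->
  (forall z, disc z -> g z <= g' z) -> rint g <= rint g'.
Proof.
move=> i1 i2 h; apply: le_Rintegral => //; first exact: measurable_disc_plane.
by move=> p /h.
Qed.

Lemma cintD F G : cintegrable F -> cintegrable G ->
  cint (fun z => F z + G z) = cint F + cint G.
Proof.
move=> [f1 f2] [g1 g2]; apply: cx_eq; rewrite ?(reD, imD) ?(re_cint, im_cint).
- by rewrite -rintD//; apply: eq_rint => z _; rewrite reD.
- by rewrite -rintD//; apply: eq_rint => z _; rewrite imD.
Qed.

Lemma cintB F G : cintegrable F -> cintegrable G ->
  cint (fun z => F z - G z) = cint F - cint G.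
Proof.
move=> [f1 f2] [g1 g2]; apply: cx_eq; rewrite ?(reD, imD, reN, imN) ?(re_cint, im_cint).
- by rewrite -rintB//; apply: eq_rint => z _; rewrite !reim.
- by rewrite -rintB//; apply: eq_rint => z _; rewrite !reim.
Qed.

Lemma cintZ (c : C) F : cintegrable F -> cint (fun z => c * F z) = c * cint F.
Proof.
move=> [f1 f2]; apply: cx_eq; rewrite ?(reM, imM) ?(re_cint, im_cint).
- rewrite -!rintZ// -rintB; try exact: rintegrableZ.
  by apply: eq_rint => z _; rewrite reM.
- rewrite -!rintZ// -rintD; try exact: rintegrableZ.
  by apply: eq_rint => z _; rewrite imM.
Qed.

Lemma cintegrableD F G : cintegrable F -> cintegrable G -> cintegrable (fun z => F z + G z).
Proof.
move=> [f1 f2] [g1 g2]; split.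
- by apply: eq_rintegrable (rintegrableD f1 g1) => z _; rewrite reD.
- by apply: eq_rintegrable (rintegrableD f2 g2) => z _; rewrite imD.
Qed.

Lemma cintegrableZ (c : C) F : cintegrable F -> cintegrable (fun z => c * F z).
Proof.
move=> [f1 f2]; split.
- apply: eq_rintegrable (rintegrableB (rintegrableZ (re c) f1) (rintegrableZ (im c) f2)).
  by move=> z _; rewrite reM.
- apply: eq_rintegrable (rintegrableD (rintegrableZ (re c) f2) (rintegrableZ (im c) f1)).
  by move=> z _; rewrite imM.
Qed.

Lemma cint_cj F : cintegrable F -> cint (fun z => cj (F z)) = cj (cint F).
Proof.
move=> [f1 f2]; apply: cx_eq; rewrite ?(reJ, imJ) ?(re_cint, im_cint).
- by apply: eq_rint => z _; rewrite reJ.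
- by rewrite -rintN//; apply: eq_rint => z _; rewrite imJ.
Qed.

Lemma cint_rc g : rintegrable g -> cint (fun z => rc (g z)) = rc (rint g).
Proof.
move=> ig; apply: cx_eq; rewrite ?(re_cint, im_cint) ?(re_rc, im_rc)//.
by rewrite /rint Rintegral0_eq.
Qed.

(** The factor 2 comes from bounding real and imaginary parts separately; the estimate serves only
    where constants are irrelevant. *)
Lemma nm_cint F g : cintegrable F -> rintegrable g -> (forall z, disc z -> nm (F z) <= g z) ->
  nm (cint F) <= 2 * rint g.
Proof.
move=> [f1 f2] ig h; apply: le_trans (nm_le_reim _) _; rewrite re_cint im_cint mulr_natl mulr2n.
have H k : rintegrable k -> (forall z, disc z -> `|k z| <= nm (F z)) -> `|rint k| <= rint g.
  move=> ik hk; rewrite ler_norml; apply/andP; split.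
    rewrite -rintN// ; apply: le_rint => //.
      by apply: eq_rintegrable (rintegrableZ (-1) ig) => z _; rewrite mulN1r.
    by move=> z dz; have := hk _ dz; have := h _ dz; rewrite ler_norml => ? /andP[? ?]; lra.
  apply: le_rint => // z dz.
  by have := hk _ dz; have := h _ dz; rewrite ler_norml => ? /andP[? ?]; lra.
by apply: lerD; apply: H => // z _; [exact: re_nm|exact: im_nm].
Qed.

Lemma rint_dominated (g_ : nat -> C -> R) (g b : C -> R) :
  (forall n, rmeas (g_ n)) -> (forall z, disc z -> g_ n z @[n --> \oo] --> g z) ->
  rintegrable b -> (forall n z, disc z -> `|g_ n z| <= b z) ->
  rint (g_ n) @[n --> \oo] --> rint g.
Proof.
move=> mg cg ib hb.
have h := @dominated_cvg _ _ _ mu2 _ (@measurable_disc_plane R)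
  (fun n p => (g_ n (cpt p))%:E) (fun p => (g (cpt p))%:E) (fun p => (b (cpt p))%:E).
have ig : rintegrable g.
  apply: rintegrable_le ib; last first.
    move=> z dz; have : `|g_ n z| @[n --> \oo] --> `|g z| by apply: cvg_norm; exact: cg.
    by move=> /cvgr_to_le; apply; apply: nearW => n; exact: hb.
  apply: (@measurable_fun_cvg _ _ _ _ (fun n p => g_ n (cpt p))) => //.
  by move=> p Dp; exact: cg.
have E : (rint g)%:E = (\int[mu2]_(p in D) (g (cpt p))%:E)%E.
  rewrite /rint /Rintegral fineK//.
  by apply: integrable_fin_num => //; exact: measurable_disc_plane.
have h2 : (\int[mu2]_(p in D) (g_ n (cpt p))%:E)%E @[n --> \oo] --> (rint g)%:E.
  rewrite E; apply: h => //.
  - by move=> n; apply/measurable_EFinP; exact: mg.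
  - by move=> p Dp; apply: cvg_EFin; [exact: nearW|exact: cg].
  - by move=> n p Dp; rewrite /= lee_fin; exact: hb.
exact: (fine_cvg h2).
Qed.

Lemma cvg_re_im (u : nat -> C) (l : C) : nm (u n - l) @[n --> \oo] --> (0 : R) ->
  re (u n) @[n --> \oo] --> re l /\ im (u n) @[n --> \oo] --> im l.
Proof.
move=> /cvgrPdist_lt h; split; apply/cvgrPdist_lt => e /h; apply: filterS => n;
  rewrite sub0r normrN ger0_norm ?nm_ge0// => hn; rewrite distrC.
- by rewrite -reN -reD; apply: le_lt_trans (re_nm _) hn.
- by rewrite -imN -imD; apply: le_lt_trans (im_nm _) hn.
Qed.

Lemma cint_dominated (F_ : nat -> C -> C) F b :
  (forall n, cmeas (F_ n)) ->
  (forall z, disc z -> nm (F_ n z - F z) @[n --> \oo] --> (0 : R)) ->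
  rintegrable b -> (forall n z, disc z -> nm (F_ n z) <= b z) ->
  re (cint (F_ n)) @[n --> \oo] --> re (cint F) /\
  im (cint (F_ n)) @[n --> \oo] --> im (cint F).
Proof.
move=> mF cF ib hb; split.
- apply: (@rint_dominated (fun n z => re (F_ n z)) (fun z => re (F z)) b) => //.
  + by move=> n; case: (mF n).
  + by move=> z dz; case: (cvg_re_im (cF z dz)).
  + by move=> n z dz; apply: le_trans (re_nm _) _; exact: hb.
- apply: (@rint_dominated (fun n z => im (F_ n z)) (fun z => im (F z)) b) => //.
  + by move=> n; case: (mF n).
  + by move=> z dz; case: (cvg_re_im (cF z dz)).
  + by move=> n z dz; apply: le_trans (im_nm _) _; exact: hb.
Qed.

Lemma cint_dominated_cst (F_ : nat -> C -> C) F b (v : C) :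
  (forall n, cmeas (F_ n)) ->
  (forall z, disc z -> nm (F_ n z - F z) @[n --> \oo] --> (0 : R)) ->
  rintegrable b -> (forall n z, disc z -> nm (F_ n z) <= b z) ->
  (forall n, cint (F_ n) = v) -> cint F = v.
Proof.
move=> mF cF ib hb hv; have [] := cint_dominated mF cF ib hb.
rewrite (_ : (fun n => re (cint (F_ n))) = fun=> re v); last by apply/funext => n; rewrite hv.
rewrite (_ : (fun n => im (cint (F_ n))) = fun=> im v); last by apply/funext => n; rewrite hv.
by move=> h1 h2; apply: cx_eq; [apply: cvg_unique h1 _|apply: cvg_unique h2 _] => //;
  exact: cvg_cst.
Qed.

End DiscIntegral.

(** * A cutoff of class C^1 with explicit Taylor bounds *)

Section Cutoff.
Variable R : realType.
Implicit Types a s x : R.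

(* q a is a C^1 approximation of the identity of the half-line [0, +oo[ vanishing
   near 0, with derivative q' a between 0 and 1. *)
Definition q a s : R := (Num.max (s - a) 0 ^+ 2 - Num.max (s - 2 * a) 0 ^+ 2) / (2 * a).
Definition q' a s : R := (Num.max (s - a) 0 - Num.max (s - 2 * a) 0) / a.

(** The square of the positive part is convex, which gives the lower bound, and its derivative
    [2 * Num.max y 0] is Lipschitz with constant 2, which gives the upper one. *)
Lemma pos_sqr_taylor (x y : R) :
  0 <= Num.max x 0 ^+ 2 - Num.max y 0 ^+ 2 - 2 * Num.max y 0 * (x - y) <= (x - y) ^+ 2.
Proof.
have h1 := sqr_ge0 x; have h2 := sqr_ge0 y; have h3 := sqr_ge0 (x - y).
case: (leP x 0) => hx; case: (leP y 0) => hy; rewrite ?expr0n /=.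
- by apply/andP; split; lra.
- have : 0 <= - x * y by apply: mulr_ge0; lra.
  by move=> ?; apply/andP; split; nra.
- have : 0 <= x * - y by apply: mulr_ge0; lra.
  by move=> ?; apply/andP; split; nra.
- by apply/andP; split; nra.
Qed.

(** The two Taylor remainders both lie between 0 and (s - s0)^2, hence so does the absolute value of
    their difference. This is the quadratic bound that [cdiff_radial] asks for. *)
Lemma q_taylor a s s0 : 0 < a ->
  `|q a s - q a s0 - q' a s0 * (s - s0)| <= (2 * a)^-1 * (s - s0) ^+ 2.
Proof.
move=> a0.
have := pos_sqr_taylor (s - a) (s0 - a); have := pos_sqr_taylor (s - 2 * a) (s0 - 2 * a).
rewrite (_ : s - a - (s0 - a) = s - s0); last by ring.
rewrite (_ : s - 2 * a - (s0 - 2 * a) = s - s0); last by ring.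
rewrite /q /q'; set A := Num.max (s - 2 * a) _; set A0 := Num.max (s0 - 2 * a) _.
set B := Num.max (s - a) _; set B0 := Num.max (s0 - a) _.
move=> /andP[h1 h2] /andP[h3 h4].
rewrite (_ : _ - _ - _ = (2 * a)^-1 * ((B ^+ 2 - B0 ^+ 2 - 2 * B0 * (s - s0)) -
  (A ^+ 2 - A0 ^+ 2 - 2 * A0 * (s - s0)))); last by field; rewrite gt_eqF.
have i0 : 0 < (2 * a)^-1 by rewrite invr_gt0 mulr_gt0.
by rewrite normrM gtr0_norm// ler_pM2l// ler_norml; apply/andP; split; lra.
Qed.

Lemma q0 a s : 0 < a -> s <= a -> q a s = 0 /\ q' a s = 0.
Proof.
move=> a0 sa; rewrite /q /q'.
have -> : Num.max (s - a) 0 = 0 by apply: max_r; lra.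
have -> : Num.max (s - 2 * a) 0 = 0 by apply: max_r; lra.
by rewrite !subrr !mul0r.
Qed.

(** At a fixed positive [s] the error is exactly [3 / 2 * a] as soon as [a] is small, which makes
    the convergence as [a] tends to 0 explicit. *)
Lemma q_far a s : 0 < a -> 2 * a <= s -> q a s = s - 3 / 2 * a /\ q' a s = 1.
Proof.
move=> a0 sa; rewrite /q /q'.
have -> : Num.max (s - a) 0 = s - a by apply: max_l; lra.
have -> : Num.max (s - 2 * a) 0 = s - 2 * a by apply: max_l; lra.
by split; field; rewrite ?gt_eqF.
Qed.

Lemma q'_01 a s : 0 < a -> 0 <= q' a s <= 1.
Proof.
move=> a0; rewrite /q' ler_pdivrMr// mul1r.
apply/andP; split; first (apply: divr_ge0; last exact: ltW).
  by case: (leP (s - a) 0); case: (leP (s - 2 * a) 0) => *; lra.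
by case: (leP (s - a) 0); case: (leP (s - 2 * a) 0) => *; lra.
Qed.

Lemma q_bound a s : 0 < a -> 0 <= s -> 0 <= q a s <= s.
Proof.
move=> a0 s0; rewrite /q ler_pdivrMr ?mulr_gt0//.
apply/andP; split; first (apply: divr_ge0; last by rewrite mulr_ge0// ltW).
  by case: (leP (s - a) 0); case: (leP (s - 2 * a) 0) => *; nra.
by case: (leP (s - a) 0); case: (leP (s - 2 * a) 0) => *; nra.
Qed.

Lemma continuous_lip (phi : R -> R) (K : R) :
  (forall s s', `|phi s' - phi s| <= K * `|s' - s|) -> continuous phi.
Proof.
move=> h s; apply/cvgrPdist_lt => e e0; near=> s'.
rewrite distrC; apply: le_lt_trans (h _ _) _.
have K0 : 0 < `|K| + 1 by rewrite ltr_wpDl.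
apply: (@le_lt_trans _ _ ((`|K| + 1) * `|s' - s|)).
  by apply: ler_wpM2r => //; have := ler_norm K; lra.
rewrite mulrC -ltr_pdivlMr// distrC; near: s'.
by apply: cvgr_dist_lt; [exact: cvg_id|exact: divr_gt0].
Unshelve. all: by end_near. Qed.

Lemma continuous_q' a : 0 < a -> continuous (q' a).
Proof.
move=> a0; apply: (@continuous_lip _ (2 / a)) => s s'.
have mx (x y : R) : `|Num.max x 0 - Num.max y 0| <= `|x - y|.
  rewrite ler_norml; have := ler_norm (x - y); have := ler_norm (y - x).
  rewrite (distrC y) => h1 h2.
  by case: (leP x 0); case: (leP y 0) => *; apply/andP; split; lra.
have := mx (s' - a) (s - a); have := mx (s' - 2 * a) (s - 2 * a).
rewrite (_ : s' - a - (s - a) = s' - s); last by ring.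
rewrite (_ : s' - 2 * a - (s - 2 * a) = s' - s); last by ring.
rewrite /q'; set A := Num.max (s' - 2 * a) _; set A0 := Num.max (s - 2 * a) _.
set B := Num.max (s' - a) _; set B0 := Num.max (s - a) _.
rewrite -mulrBl normrM (gtr0_norm (x := a^-1)) ?invr_gt0// => h1 h2.
rewrite ler_pdivrMr// mulrAC divfK ?gt_eqF//.
move: h1 h2; rewrite !ler_norml => /andP[? ?] /andP[? ?]; apply/andP; split; lra.
Qed.

Lemma continuous_q a : 0 < a -> continuous (q a).
Proof.
move=> a0 s; apply/cvgrPdist_lt => e e0; near=> s'.
have := q_taylor s' s a0; have /andP[d0 d1] := q'_01 s a0.
pose x := `|s' - s|; rewrite distrC.
have i0 : 0 < (2 * a)^-1 by rewrite invr_gt0 mulr_gt0.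
have hx : x < Num.min 1 (e / (1 + (2 * a)^-1)).
  rewrite /x distrC; near: s'; apply: cvgr_dist_lt; [exact: cvg_id|].
  by rewrite lt_min ltr01 divr_gt0// addr_gt0// invr_gt0 mulr_gt0.
have x0 : 0 <= x by exact: normr_ge0.
move: hx; rewrite lt_min => /andP[x1]; rewrite ltr_pdivlMr; last lra.
move=> xe; rewrite -(real_normK (num_real (s' - s))) -/x.
have t1 := ler_norm (s' - s); have t2 := ler_norm (s - s'); rewrite (distrC s) in t2.
rewrite -/x in t1 t2.
rewrite !ler_norml ltr_norml => /andP[h1 h2].
have t3 : `|q' a s * (s' - s)| <= x by rewrite normrM ger0_norm// -/x; nra.
move: t3; rewrite ler_norml => /andP[t3 t4].
have t5 : (2 * a)^-1 * x ^+ 2 <= (2 * a)^-1 * x by rewrite ler_pM2l//; nra.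
by apply/andP; split; lra.
Unshelve. all: by end_near. Qed.

End Cutoff.

Section CdiffInverse.
Variable R : realType.
Local Notation C := (Cx R).

Lemma cdiffV (F : C -> C) z a b : F z != 0 -> cdiff F z a b ->
  cdiff (fun z => (F z)^-1) z (- a / F z ^+ 2) (- b / F z ^+ 2).
Proof.
move=> Fz hF e e0.
have m0 : 0 < nm (F z) by rewrite nm_gt0.
set m := nm (F z) in m0.
have e1 : 0 < e * m ^+ 2 / 2 by rewrite divr_gt0// mulr_gt0// exprn_gt0.
have [d1 d10 h1] := hF _ e1; have [d2 d20 h2] := cdiff_lip hF.
pose L := 1 + nm a + nm b.
have L0 : 0 < L by rewrite /L; have := nm_ge0 a; have := nm_ge0 b; lra.
have p1 : 0 < m / (2 * L) by rewrite divr_gt0// mulr_gt0.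
have p2 : 0 < e * m ^+ 3 / (4 * L ^+ 2) by rewrite divr_gt0 ?mulr_gt0 ?exprn_gt0.
exists (Num.min (Num.min d1 d2) (Num.min (m / (2 * L)) (e * m ^+ 3 / (4 * L ^+ 2)))).
  by rewrite !lt_min d10 d20 p1 p2.
move=> z'; rewrite !lt_min => /andP[/andP[/h1 {}h1 /h2 {}h2] /andP[h3 h4]].
rewrite -/L in h2; set u := z' - z in h1 h2 h3 h4 *.
have u0 := nm_ge0 u.
have h5 : m / 2 <= nm (F z').
  have := nmD (F z - F z') (F z'); rewrite subrK nm_distC -/m.
  move: h3; rewrite ltr_pdivlMr ?mulr_gt0// => h3; lra.
have F'0 : F z' != 0 by rewrite -nm_gt0; apply: lt_le_trans h5; rewrite divr_gt0.
rewrite (_ : _ - _ - _ - _ = - (F z' - F z - a * u - b * cj u) / F z ^+ 2 +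
  (F z' - F z) ^+ 2 / (F z ^+ 2 * F z')); last by field; rewrite Fz F'0.
apply: le_trans (nmD _ _) _.
rewrite !nmM !nmV nmM nmN !nmX -/m.
have m20 : 0 < m ^+ 2 by rewrite exprn_gt0.
have t1 : nm (F z' - F z - a * u - b * cj u) / m ^+ 2 <= e / 2 * nm u.
  rewrite ler_pdivrMr//; apply: le_trans h1 _.
  by apply: le_of_eq; field.
have t2 : nm (F z' - F z) ^+ 2 / (m ^+ 2 * nm (F z')) <= e / 2 * nm u.
  have m30 : 0 < m ^+ 2 * nm (F z') by rewrite mulr_gt0// nm_gt0.
  rewrite ler_pdivrMr//.
  apply: (@le_trans _ _ (e / 2 * nm u * (m ^+ 2 * (m / 2)))); last first.
    apply: ler_wpM2l; first by rewrite mulr_ge0// divr_ge0// ltW.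
    by apply: ler_wpM2l => //; exact: ltW.
  apply: (@le_trans _ _ ((L * nm u) ^+ 2)).
    by rewrite ler_pXn2r// nnegrE ?nm_ge0// mulr_ge0// ltW.
  move: h4; rewrite ltr_pdivlMr ?mulr_gt0 ?exprn_gt0// => h4.
  have := ler_wpM2r u0 (ltW h4); lra.
by lra.
Qed.

End CdiffInverse.

(** * The weighted mean value formula for holomorphic functions *)

Section MeanValueFormula.
Variable R : realType.
Local Notation C := (Cx R).

Definition sC (z : C) : C := rc (1 - nm z ^+ 2).

Lemma sCE z : sC z = 1 - z * cj z.
Proof. by rewrite /sC rcB mul_cj. Qed.

Lemma cdiff_sC z : cdiff sC z (- cj z) (- z).
Proof.
have := @cdiff_radial R id z 1 0; rewrite rc1 !mulN1r; apply.
by move=> s; rewrite !mul1r subrr normr0 mul0r.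
Qed.

Variables (w : C) (w1 : nm w < 1).

(** A power of [tC] is the conjugate of the reproducing kernel at [w], up to a constant. It is
    antiholomorphic in [z], so that it contributes to derivatives in [cj z]. *)
Definition tC (z : C) : C := (1 - w * cj z)^-1.

Lemma tC_neq0 z : nm z < 1 -> 1 - w * cj z != 0.
Proof.
move=> z1; rewrite -nm_gt0; apply: lt_le_trans (nm_1B _).
have := @nm_prod_lt1 R w (cj z) w1; rewrite nm_cj => /(_ z1); lra.
Qed.

Lemma nm_tC z : nm z < 1 -> nm (tC z) <= (1 - nm w)^-1.
Proof.
move=> z1; rewrite /tC nmV lef_pV2 ?posrE ?nm_gt0 ?tC_neq0 ?subr_gt0//.
apply: le_trans (nm_1B _); rewrite nmM nm_cj.
by have := nm_ge0 w; have := nm_ge0 z; nra.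
Qed.

Lemma cdiff_tC z : nm z < 1 -> cdiff tC z 0 (w * tC z ^+ 2).
Proof.
move=> z1; have n0 := tC_neq0 z1.
have h1 : cdiff (fun z => 1 - w * cj z) z 0 (- w).
  have h := cdiffD (@cdiff_cst R 1 z) (cdiffM (@cdiff_cst R (- w) z) (cdiff_cj (@cdiff_id R z))).
  rewrite (_ : (fun z => 1 - w * cj z) = (fun z => 1 + (- w) * cj (id z))).
    by apply: cdiff_eq h; rewrite ?cj0 ?cj1; ring.
  by apply/funext => x; rewrite mulNr.
have h2 : cdiff tC z _ _ := @cdiffV R (fun z => 1 - w * cj z) z _ _ n0 h1.
apply: cdiff_eq h2; first by rewrite oppr0 mul0r.
by rewrite /tC opprK -exprVn.
Qed.

Lemma continuous_tC z : nm z < 1 -> {for z, continuous tC}.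
Proof. by move=> /cdiff_tC/cdiff_continuous. Qed.

Variable f : C -> C.
Hypothesis hf : holomorphic_on (@disc R) f.
Variable d : nat.
Hypothesis int_f : rintegrable (fun z => nm (f z) ^+ 2 * (1 - nm z ^+ 2) ^+ (2 * d)).

Let k := (2 * d).+1.
(** Minus the difference quotient of [f] at [w]. Continuity at [w] follows from differentiability of
    [f] there; holomorphy is known only elsewhere, which is why Green's formula admits an
    exceptional point. *)
Let g z := if z == w then - 'd f w 1 else (f z - f w) / (w - z).

Let f_cdiff z : nm z < 1 -> cdiff f z ('d f z 1) 0.
Proof. by move=> z1; apply: diff_cdiff; apply: hf; apply/discE. Qed.

Let g_off z : z != w -> nm z < 1 -> exists a, cdiff g z a 0.
Proof.
move=> zw z1.
have wz : w - z != 0 by rewrite subr_eq0 eq_sym.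
have h1 := cdiffD (f_cdiff z1) (@cdiff_cst R (- f w) z).
have h2 := cdiffD (@cdiff_cst R w z) (cdiffM (@cdiff_cst R (-1) z) (@cdiff_id R z)).
have wz' : w + -1 * id z != 0 by rewrite mulN1r.
have h3 := cdiffM h1 (@cdiffV R (fun z => w + -1 * id z) z _ _ wz' h2).
eexists; apply: cdiff_near (cdiff_eq _ _ h3); last 2 first.
- by reflexivity.
- by rewrite !(mul0r, mulr0, addr0, oppr0).
apply/nbhs_nm; exists (nm (z - w)); first by rewrite nm_gt0 subr_eq0.
move=> z' h; rewrite /g; case: eqP => [zw'|_]; last by rewrite mulN1r.
by move: h; rewrite zw' nm_distC ltxx.
Qed.

Let g_at : {for w, continuous g}.
Proof.
apply/continuous_nmP => e e0.
have e2 : 0 < e / 2 by rewrite divr_gt0.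
have [del del0 hd] := f_cdiff w1 e2.
exists del => // z /hd; rewrite /g eqxx mul0r subr0.
case: eqP => [_ _|/eqP zw h]; first by rewrite subrr nm0.
have wz : w - z != 0 by rewrite subr_eq0 eq_sym.
rewrite (_ : _ - _ = (f z - f w - 'd f w 1 * (z - w)) / (w - z)); last by field.
rewrite nmM nmV ltr_pdivrMr ?nm_gt0// (nm_distC w).
apply: le_lt_trans h _; rewrite ltr_pM2r; last by rewrite nm_distC nm_gt0.
by lra.
Qed.

Let g_cont z : nm z < 1 -> {for z, continuous g}.
Proof.
move=> z1; have [->|zw] := eqVneq z w; first exact: g_at.
by have [a /cdiff_continuous] := g_off zw z1.
Qed.

(** Near [w] continuity bounds [g]; at distance at least [del] the denominator is bounded below. The
    bound carries the square integrability of [f] over to [g] for dominated convergence. *)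
Let g_bound : exists2 M : R, 0 < M & forall z, nm z < 1 -> nm (g z) <= M * (1 + nm (f z)).
Proof.
have /continuous_nmP/(_ _ ltr01)[del del0 hd] := g_at.
pose M1 := nm (g w) + 1; pose M2 := (1 + nm (f w)) / del.
have M10 : 0 < M1 by rewrite /M1; have := nm_ge0 (g w); lra.
have M20 : 0 < M2 by rewrite /M2 divr_gt0//; have := nm_ge0 (f w); lra.
exists (M1 + M2); first exact: addr_gt0.
move=> z z1; have f0 := nm_ge0 (f z).
have [/hd h|h] := ltP (nm (z - w)) del.
  have := nmD (g z - g w) (g w); rewrite subrK => h2.
  have : nm (g z) <= M1 by rewrite /M1; lra.
  have : 0 <= M2 * (1 + nm (f z)) by rewrite mulr_ge0 ?(ltW M20)//; lra.
  by have : 0 <= M1 * nm (f z); [rewrite mulr_ge0// ltW|lra].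
have zw : z != w by apply: contraTneq h => ->; rewrite subrr nm0 -ltNge.
rewrite /g (negbTE zw) nmM nmV (nm_distC w).
have p0 : 0 < nm (z - w) by apply: lt_le_trans h.
rewrite ler_pdivrMr//; apply: le_trans (nmB _ _) _.
have h3 : M2 * nm (z - w) >= 1 + nm (f w).
  rewrite /M2 mulrAC ler_pdivlMr//; apply: ler_wpM2l => //.
  by have := nm_ge0 (f w); lra.
have fw := nm_ge0 (f w).
have : 0 <= M1 * (1 + nm (f z)) * nm (z - w).
  by rewrite !mulr_ge0 ?(ltW M10) ?nm_ge0//; lra.
have : (1 + nm (f w)) * (1 + nm (f z)) <= M2 * nm (z - w) * (1 + nm (f z)).
  by apply: ler_wpM2r => //; lra.
by have := mulr_ge0 fw f0; lra.
Qed.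

Section Approximation.
Variable a : R.
Hypotheses (a0 : (0 : R) < a) (a1 : a <= 1).

Let Q z : C := rc (q a (1 - nm z ^+ 2)).
Let Q' z : C := rc (q' a (1 - nm z ^+ 2)).
Let Phi z := sC z ^+ (2 * d) * Q z * tC z ^+ k.
(** The derivative of [Phi] in [cj z], by the product rule over the powers of [sC], the cutoff and
    the powers of [tC]. *)
Definition dPhi z :=
  ((2 * d)%:R * sC z ^+ (2 * d).-1 * (- z)) * Q z * tC z ^+ k +
  sC z ^+ (2 * d) * (- Q' z * z) * tC z ^+ k +
  sC z ^+ (2 * d) * Q z * (k%:R * tC z ^+ (2 * d) * (w * tC z ^+ 2)).

Let cdiff_Q z : cdiff Q z (- Q' z * cj z) (- Q' z * z).
Proof. by apply: cdiff_radial => s; exact: q_taylor. Qed.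

Let cdiff_Phi z : nm z < 1 -> exists b, cdiff Phi z b (dPhi z).
Proof.
move=> z1.
have h := cdiffM (cdiffM (cdiffX (2 * d) (cdiff_sC z)) (cdiff_Q z)) (cdiffX k (cdiff_tC z1)).
eexists; apply: cdiff_eq h; first by reflexivity.
by rewrite /dPhi /k /=; ring.
Qed.

Let Phi_cont z : nm z < 1 -> {for z, continuous Phi}.
Proof. by move=> /cdiff_Phi[b /cdiff_continuous]. Qed.

Let S_cont z : {for z, continuous (fun z : C => 1 - nm z ^+ 2)}.
Proof.
have c := crN (crM (@continuous_nm R z) (@continuous_nm R z)).
by have := crD (@cr_cst R 1 z) c.
Qed.

Let dPhi_cont z : nm z < 1 -> {for z, continuous dPhi}.
Proof.
move=> z1.
have cS := cdiff_continuous (cdiff_sC z).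
have cT := continuous_tC z1.
have cQ := cdiff_continuous (cdiff_Q z).
have cQ' : {for z, continuous Q'}.
  have c := @cr_comp R (q' a) (fun z => 1 - nm z ^+ 2) z (@S_cont z) (@continuous_q' R a a0 _).
  exact: (@cc_rc R (fun z => q' a (1 - nm z ^+ 2)) z c).
have cI := @cc_id R z.
have h1 := ccM (ccM (ccM (ccM (@cc_cst R (2 * d)%:R z) (ccX (n := (2 * d).-1) cS)) (ccN cI)) cQ)
  (ccX (n := k) cT).
have h2 := ccM (ccM (ccX (n := 2 * d) cS) (ccM (ccN cQ') cI)) (ccX (n := k) cT).
have h3 := ccM (ccM (ccX (n := 2 * d) cS) cQ)
  (ccM (ccM (@cc_cst R k%:R z) (ccX (n := 2 * d) cT)) (ccM (@cc_cst R w z) (ccX (n := 2) cT))).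
exact: (ccD (ccD h1 h2) h3).
Qed.

(** For |z| at least [r], 1 - |z|^2 is at most a - a^2 / 4, hence below [a], where the cutoff
    vanishes. *)
Let r : R := 1 - a / 2.

Let far z : r <= nm z -> Q z = 0 /\ Q' z = 0.
Proof.
move=> rz; have rr : r * r <= nm z * nm z.
  have r0 : 0 <= r by rewrite /r subr_ge0 ler_pdivrMr// mul1r (le_trans a1)// ler1n.
  exact: ler_pM.
have [] := @q0 R a (1 - nm z ^+ 2) a0; last by rewrite /Q /Q' => -> ->.
have a0t : (0 : R) < a := a0.
by have := sqr_ge0 a; rewrite /r in rr *; nra.
Qed.

(** Off [w], [g] is holomorphic, so the derivative of [g * Phi] in [cj z] is [g * dPhi], and both
    vanish near the circle. *)
Lemma cint_approx : disc_integral (fun z => g z * dPhi z) = 0.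
Proof.
have r1 : r < 1 by rewrite /r ltrBlDr ltrDl divr_gt0.
have fd z : r <= nm z -> Phi z = 0 /\ dPhi z = 0.
  by move=> /far[h1 h2]; rewrite /Phi /dPhi h1 h2 !(mulr0, mul0r, oppr0, addr0).
have cont (G : C -> C) : (forall z, nm z < 1 -> {for z, continuous G}) ->
    (forall z, r <= nm z -> G z = 0) -> continuous G.
  move=> h1 h2 z; have [/h1//|z1] := ltP (nm z) 1.
  apply/continuous_nmP => e e0; exists (1 - r); first by rewrite subr_gt0.
  move=> z' h; rewrite !h2 ?subrr ?nm0//; first by lra.
  by have := nmD (z - z') z'; rewrite subrK nm_distC; lra.
have cG : continuous (fun z => g z * Phi z).
  apply: cont => [z z1|z /fd[-> _]]; last by rewrite mulr0.
  exact: (ccM (g_cont z1) (Phi_cont z1)).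
have cH : continuous (fun z => g z * dPhi z).
  apply: cont => [z z1|z /fd[_ ->]]; last by rewrite mulr0.
  exact: (ccM (g_cont z1) (dPhi_cont z1)).
apply: (green_disc (w := w) cG cH _ r1) => [z zw|z /fd[-> ->]]; last by rewrite !mulr0.
have [z1|z1] := ltP (nm z) 1.
  have [b hb] := g_off zw z1; have [b' hb'] := cdiff_Phi z1.
  eexists; apply: cdiff_eq (cdiffM hb hb'); first by reflexivity.
  by rewrite mul0r add0r.
have [_ dz] : Phi z = 0 /\ dPhi z = 0 by apply: fd; lra.
exists 0; rewrite dz mulr0; apply: cdiff_near (@cdiff_cst R 0 z).
apply/nbhs_nm; exists (1 - r); first by rewrite subr_gt0.
move=> z' h; have [|-> _] := fd z'; last by rewrite mulr0.
by have := nmD (z - z') z'; rewrite subrK nm_distC; lra.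
Qed.

End Approximation.

Let tau : R := (1 - nm w)^-1.

Let tau1 : 1 <= tau.
Proof. by rewrite /tau invf_ge1 ?subr_gt0// lerBlDr lerDl nm_ge0. Qed.

(** [L1] and [L2] collect the coefficients of the cutoff and of its derivative in [dPhi]; when [a]
    tends to 0 these two factors become 1 - |z|^2 and 1. *)
Let L1 z := (2 * d)%:R * sC z ^+ (2 * d).-1 * (- z) * tC z ^+ k +
  sC z ^+ (2 * d) * (k%:R * tC z ^+ (2 * d) * (w * tC z ^+ 2)).
Let L2 z := sC z ^+ (2 * d) * (- z) * tC z ^+ k.

Let dPhiE a z : dPhi a z = L1 z * rc (q a (1 - nm z ^+ 2)) + L2 z * rc (q' a (1 - nm z ^+ 2)).
Proof. by rewrite /dPhi /L1 /L2; ring. Qed.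

Let S_gt0 (z : C) : nm z < 1 -> 0 < 1 - nm z ^+ 2 <= 1.
Proof.
move=> z1; have z0 := nm_ge0 z; apply/andP; split.
  by rewrite subr_gt0 expr2; nra.
by rewrite lerBlDr lerDl sqr_ge0.
Qed.

Let nm_sC (z : C) : nm z < 1 -> nm (sC z) = 1 - nm z ^+ 2.
Proof. by move=> /S_gt0/andP[h _]; rewrite nm_rc gtr0_norm. Qed.

Let K := k%:R * tau ^+ k + k%:R * tau ^+ k.+1.

Let L_bound (z : C) (x y : R) : nm z < 1 -> 0 <= x <= 1 - nm z ^+ 2 -> 0 <= y <= 1 ->
  nm (L1 z * rc x + L2 z * rc y) <= K * (1 - nm z ^+ 2) ^+ (2 * d).
Proof.
move=> z1 /andP[x0 xS] /andP[y0 y1].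
have /andP[S0 S1] := S_gt0 z1; set S := 1 - nm z ^+ 2 in xS S0 S1 *.
have tT j : nm (tC z ^+ j) <= tau ^+ j.
  by rewrite nmX; apply: lerXn2r; rewrite ?nnegrE ?nm_ge0 ?(le_trans ler01 tau1)// nm_tC.
have t0 j : 0 <= tau ^+ j by rewrite exprn_ge0// (le_trans ler01 tau1).
have SX j : nm (sC z ^+ j) = S ^+ j by rewrite nmX nm_sC.
have Sp j : 0 <= S ^+ j by rewrite exprn_ge0// ltW.
have b2 : nm (L2 z * rc y) <= S ^+ (2 * d) * tau ^+ k.
  rewrite /L2 !nmM SX nmN nm_rc ger0_norm//.
  have h1 : nm (tC z ^+ k) * y <= tau ^+ k * 1 by apply: ler_pM => //; exact: nm_ge0.
  have h2 : nm z * (nm (tC z ^+ k) * y) <= 1 * (tau ^+ k * 1).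
    by apply: ler_pM => //; rewrite ?mulr_ge0 ?nm_ge0// ltW.
  by rewrite -!mulrA; apply: ler_wpM2l => //; rewrite !(mul1r, mulr1) in h2.
have b1 : nm (L1 z * rc x) <= S ^+ (2 * d) * ((2 * d)%:R * tau ^+ k + k%:R * tau ^+ k.+1).
  rewrite /L1 mulrDl; apply: le_trans (nmD _ _) _; rewrite mulrDr; apply: lerD.
    rewrite !nmM SX nmN nm_rc (ger0_norm x0) nm_nat.
    (* For [d = 0] the truncated exponent [(2 * d).-1] comes with the coefficient 0; otherwise the
       factor [x <= S] restores the power of [S] lost by differentiation. *)
    have [->|d0] := posnP (2 * d); first by rewrite mulr0n !mul0r mulr0.
    have h1 : nm (tC z ^+ k) * x <= tau ^+ k * S by apply: ler_pM => //; exact: nm_ge0.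
    have h2 : nm z * (nm (tC z ^+ k) * x) <= 1 * (tau ^+ k * S).
      by apply: ler_pM => //; rewrite ?mulr_ge0 ?nm_ge0// ltW.
    have eS : S ^+ (2 * d) = S * S ^+ (2 * d).-1 by rewrite -exprS prednK.
    rewrite [in X in _ <= X]eS.
    rewrite (_ : _ * nm z * _ * x = ((2 * d)%:R * S ^+ (2 * d).-1) * (nm z * (nm (tC z ^+ k) * x)));
      last by ring.
    rewrite (_ : S * _ * _ = ((2 * d)%:R * S ^+ (2 * d).-1) * (1 * (tau ^+ k * S))); last by ring.
    by apply: ler_wpM2l => //; rewrite mulr_ge0.
  rewrite !nmM SX nm_rc (ger0_norm x0) nm_nat -mulrA.
  apply: ler_wpM2l => //; rewrite -!mulrA; apply: ler_wpM2l => //.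
  rewrite (_ : tau ^+ k.+1 = tau ^+ (2 * d) * (1 * (tau ^+ 2 * 1))); last first.
    by rewrite mulr1 mul1r -exprD addn2.
  have p1 : 0 <= nm (tC z ^+ 2) * x by rewrite mulr_ge0 ?nm_ge0.
  have p2 : 0 <= nm w * (nm (tC z ^+ 2) * x) by rewrite mulr_ge0 ?nm_ge0.
  have xl1 : x <= 1 by apply: le_trans xS _.
  have -> : nm (tC z) * (nm (tC z) * x) = nm (tC z ^+ 2) * x by rewrite nmX expr2 mulrA.
  apply: (ler_pM (nm_ge0 _) p2 (tT _)); apply: (ler_pM (nm_ge0 _) p1 (ltW w1)).
  exact: (ler_pM (nm_ge0 _) x0 (tT _) xl1).
apply: le_trans (nmD _ _) _; apply: le_trans (lerD b1 b2) _.
have kE : (k%:R : R) = (2 * d)%:R + 1 by rewrite /k -natr1.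
rewrite /K kE; apply: le_of_eq; ring.
Qed.

Let K_ge0 : 0 <= K.
Proof. by rewrite /K addr_ge0// mulr_ge0// exprn_ge0// (le_trans ler01 tau1). Qed.

(* Up to a constant, the integrand is the d/dzbar derivative of
   (f z - f w) / (z - w) * (1 - |z|^2)^(2d+1) / (1 - w * zbar)^(2d+1), which vanishes on
   the unit circle. Replacing one factor s = 1 - |z|^2 by q a s makes it vanish near the
   circle, so that Green's formula applies, and dominated convergence lets a tend to 0. *)
Lemma mean_value_formula :
  disc_integral (fun z => (f z - f w) * (sC z ^+ (2 * d) * tC z ^+ k.+1)) = 0.
Proof.
have [M M0 hM] := g_bound.
(* The dominating function: 1 + |f| is at most 2 + |f|^2, which is integrable against the weight. *)
pose b z := M * K * (2 * (1 - nm z ^+ 2) ^+ (2 * d) + nm (f z) ^+ 2 * (1 - nm z ^+ 2) ^+ (2 * d)).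
have ib : rintegrable b.
  apply: rintegrableZ; apply: rintegrableD => //; apply: rintegrableZ.
  apply: (@rintegrable_bound _ _ 1).
    apply: rmeas_cont => z _.
    have c := crN (crM (@continuous_nm R z) (@continuous_nm R z)).
    have {}c := crD (@cr_cst R 1 z) c.
    apply: (@cr_comp R (fun x => x ^+ (2 * d)) (fun z => 1 - nm z ^+ 2)) => //.
    exact: exprn_continuous.
  move=> z /discE/S_gt0/andP[S0 S1]; rewrite ger0_norm ?exprn_ge0// ?(ltW S0)//.
  by rewrite exprn_ile1// ltW.
have bound z x y : disc z -> 0 <= x <= 1 - nm z ^+ 2 -> 0 <= y <= 1 ->
    nm (g z * (L1 z * rc x + L2 z * rc y)) <= b z.
  move=> /discE z1 hx hy; rewrite nmM.
  have /andP[S0 S1] := S_gt0 z1.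
  have Sp : 0 <= (1 - nm z ^+ 2) ^+ (2 * d) by rewrite exprn_ge0// ltW.
  apply: le_trans (ler_pM (nm_ge0 _) (nm_ge0 _) (hM _ z1) (L_bound z1 hx hy)) _.
  rewrite /b -mulrDl.
  rewrite (_ : _ * _ * (K * _) = M * K * ((1 + nm (f z)) * (1 - nm z ^+ 2) ^+ (2 * d)));
    last by ring.
  apply: ler_wpM2l; first by rewrite mulr_ge0// ltW.
  by apply: ler_wpM2r => //; have := sqr_ge0 (nm (f z) - 1); have := nm_ge0 (f z); nra.
have a_gt0 n : (0 : R) < n.+1%:R^-1 by rewrite invr_gt0.
have a_le1 n : (n.+1%:R^-1 : R) <= 1 by rewrite invf_le1// ler1n.
have cont_H (x y : C -> R) z : disc z -> {for z, continuous x} -> {for z, continuous y} ->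
    {for z, continuous (fun z => g z * (L1 z * rc (x z) + L2 z * rc (y z)))}.
  move=> /discE z1 cx cy.
  have cS := cdiff_continuous (cdiff_sC z).
  have cT := continuous_tC z1.
  have cI := @cc_id R z.
  have h1 := ccM (ccM (ccM (@cc_cst R (2 * d)%:R z) (ccX (n := (2 * d).-1) cS)) (ccN cI))
    (ccX (n := k) cT).
  have h3 := ccM (ccX (n := 2 * d) cS)
    (ccM (ccM (@cc_cst R k%:R z) (ccX (n := 2 * d) cT)) (ccM (@cc_cst R w z) (ccX (n := 2) cT))).
  have h2 := ccM (ccM (ccX (n := 2 * d) cS) (ccN cI)) (ccX (n := k) cT).
  exact: (ccM (g_cont z1) (ccD (ccM (ccD h1 h3) (cc_rc cx)) (ccM h2 (cc_rc cy)))).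
have S_cont z : {for z, continuous (fun z : C => 1 - nm z ^+ 2)}.
  have c := crN (crM (@continuous_nm R z) (@continuous_nm R z)).
  by have := crD (@cr_cst R 1 z) c.
pose Hn n z := g z * dPhi n.+1%:R^-1 z.
pose H z := g z * (L1 z * sC z + L2 z * rc 1).
have H0 : disc_integral H = 0.
  apply: (@cint_dominated_cst R Hn H b 0) => //.
  - move=> n; apply: cmeas_cont => z dz; rewrite /Hn.
    rewrite (_ : (fun z => _) = (fun z => g z * (L1 z * rc (q n.+1%:R^-1 (1 - nm z ^+ 2)) +
        L2 z * rc (q' n.+1%:R^-1 (1 - nm z ^+ 2))))).
      apply: (cont_H (fun z => q n.+1%:R^-1 (1 - nm z ^+ 2))
          (fun z => q' n.+1%:R^-1 (1 - nm z ^+ 2))) => //.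
        exact: (@cr_comp R _ _ z (S_cont z) (@continuous_q R _ (a_gt0 n) _)).
      exact: (@cr_comp R _ _ z (S_cont z) (@continuous_q' R _ (a_gt0 n) _)).
    by apply/funext => x; rewrite dPhiE.
  - move=> z /discE z1; have /andP[S0 S1] := S_gt0 z1.
    (* For large [n], [q_far] makes the distance between [Hn n z] and [H z] equal to [c] divided by
       n + 1. *)
    pose c := nm (g z * L1 z * rc (3 / 2)).
    have hc : (fun n => c * (n.+1%:R^-1 : R)) @ \oo --> c * 0.
      by apply: cvgMr; exact: cvg_harmonic.
    rewrite mulr0 in hc; apply: cvg_trans hc; apply: near_eq_cvg.
    have S2 : 0 < (1 - nm z ^+ 2) / 2 by rewrite divr_gt0.
    have /cvgrPdist_lt/(_ _ S2) := @cvg_harmonic R.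
    apply: filterS => n; rewrite sub0r normrN /= ger0_norm ?(ltW (a_gt0 n))// => hn.
    have [|e1 e2] := @q_far R n.+1%:R^-1 (1 - nm z ^+ 2) (a_gt0 n).
      have hn' : (n.+1%:R^-1 : R) < (1 - nm z ^+ 2) / 2 := hn.
      by move: hn'; set x := _^-1 => hn'; lra.
    rewrite /Hn /H dPhiE e1 e2 /sC rcB.
    rewrite (_ : _ - _ = - (g z * L1 z * rc (3 / 2)) * rc n.+1%:R^-1).
      by rewrite nmM nmN nm_rc ger0_norm// ltW.
    by rewrite (rcM (3 / 2)); ring.
  - move=> n z dz; rewrite /Hn dPhiE; apply: bound => //; last exact: q'_01.
    by apply: q_bound => //; move/discE/S_gt0/andP: dz => [/ltW].
  - by move=> n; apply: cint_approx.
have iH : cintegrable H.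
  apply: (@cintegrable_le R H b) => //.
    apply: cmeas_cont => z dz.
    exact: (cont_H (fun z => 1 - nm z ^+ 2) (fun=> 1) z dz (S_cont z) (@cr_cst R 1 z)).
  move=> z dz; apply: bound => //; last by rewrite ler01 lexx.
  by rewrite lexx andbT; move/discE/S_gt0/andP: dz => [/ltW].
(* The limit [H] is [k] times the integrand: its bracket is k sC^(2d) T^k (sC w T - z) with T for
   [tC z], and the last factor is (w - z) T. *)
rewrite (@eq_cint R _ (fun z => k%:R^-1 * H z)).
  by rewrite cintZ// H0 mulr0.
move=> z /discE z1.
have n0 := tC_neq0 z1; have kk : (k%:R : C) != 0 by rewrite pnatr_eq0.
have tE : tC z * (1 - w * cj z) = 1 by rewrite /tC mulVf.
have gE : g z * (w - z) = f z - f w.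
  rewrite /g; case: eqP => [->|/eqP zw]; first by rewrite !subrr mulr0.
  by rewrite divfK// subr_eq0 eq_sym.
rewrite -gE /H /L1 /L2 rc1 mulr1.
have e1 : (2 * d)%:R * sC z ^+ (2 * d).-1 * sC z = (2 * d)%:R * sC z ^+ (2 * d).
  by case: (2 * d)%N => [|j]; rewrite ?mul0r//= exprSr mulrA.
have kE : k%:R = (2 * d)%:R + 1 :> C by rewrite /k -natr1.
apply: (mulfI kk); rewrite mulVKf// [in RHS]mulrDl.
rewrite (_ : (2 * d)%:R * sC z ^+ (2 * d).-1 * - z * tC z ^+ k * sC z =
  (2 * d)%:R * sC z ^+ (2 * d).-1 * sC z * - z * tC z ^+ k); last by ring.
rewrite e1 !exprS -/(2 * d)%N.
set T := tC z in tE *; set X := T ^+ (2 * d); set Y := sC z ^+ (2 * d).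
have e3 : w - z = sC z * w - z * (1 - w * cj z) by rewrite sCE; ring.
have e4 : (w - z) * T = sC z * w * T - z.
  by rewrite [in LHS]e3 mulrBl -[X in _ - X]mulrA (mulrC (1 - _)) tE mulr1.
rewrite (_ : k%:R * (g z * (w - z) * (Y * (T * (T * X)))) =
  k%:R * g z * Y * T * X * ((w - z) * T)); last by ring.
by rewrite e4 kE; ring.
Qed.

End MeanValueFormula.

(** * The weighted Bergman kernels and metrics *)

Section Kernel.
Variable R : realType.
Local Notation C := (Cx R).
Local Notation D := (@disc_plane R).
Local Notation mu2 := (@lebesgue_measure R \x @lebesgue_measure R)%E.
Local Notation cint := (@disc_integral R).

Lemma cdiff_derive (f : C -> C) (z a : C) : cdiff f z a 0 ->
  differentiable f z /\ 'd f z 1 = a.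
Proof.
move=> h.
have cv : (fun t : C => t^-1 *: ((f \o shift z) (t *: (1 : C)) - f z)) @ (0 : C)^' --> (a : C).
  move=> A /nbhs_nm[e e0 hA].
  have e2 : 0 < e / 2 by rewrite divr_gt0.
  have [del del0 hd] := h _ e2.
  apply/nbhs_nm; exists del => // t; rewrite subr0 => ht t0; apply: hA.
  have tz : nm (t + z - z) < del by rewrite addrK.
  have := hd _ tz; rewrite addrK mul0r subr0 => h1.
  have t0' : t != 0 := t0.
  rewrite /= /GRing.scale /= mulr1.
  rewrite (_ : _ - a = (f (t + z) - f z - a * t) / t); last by field.
  rewrite nmM nmV ltr_pdivrMr ?nm_gt0//; apply: le_lt_trans h1 _.
  by rewrite ltr_pM2r ?nm_gt0//; lra.
have dv : derivable f z 1 by apply/cvg_ex; exists a.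
have df : differentiable f z by apply/derivable1_diffP.
split; first exact: df.
rewrite -(@deriveE C C C f z 1 df) /derive.
exact: (cvg_lim (@norm_hausdorff C C) cv).
Qed.

Lemma rint_gt0 (v : C -> R) z0 : (forall z, disc z -> {for z, continuous v}) ->
  (forall z, disc z -> 0 <= v z) -> rintegrable v -> disc z0 -> 0 < v z0 -> 0 < rint v.
Proof.
move=> cv v0 iv dz0 vz0.
have v2 : 0 < v z0 / 2 by rewrite divr_gt0.
have /continuous_rnmP/(_ _ v2)[e1 e10 h1] := cv _ dz0.
have /nbhs_nm[e2 e20 h2] : nbhs z0 (@disc R).
  by apply: open_nbhs_nbhs; split => //; exact: open_disc.
pose e := Num.min e1 e2 / 4.
have e0 : 0 < e by rewrite divr_gt0// lt_min e10.
pose B := box (re z0 - e) (re z0 + e) (im z0 - e) (im z0 + e).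
have hB p : B p -> nm (cpt p - z0) < Num.min e1 e2.
  move=> [/=]; rewrite !in_itv/= => /andP[p1 p2] /andP[p3 p4].
  apply: le_lt_trans (nm_le_reim _) _; rewrite !reim re_cpt im_cpt.
  have : `|p.1 - re z0| <= e by rewrite ler_norml; apply/andP; split; lra.
  have : `|p.2 - im z0| <= e by rewrite ler_norml; apply/andP; split; lra.
  have : e < Num.min e1 e2 / 2 by rewrite /e; have : 0 < Num.min e1 e2 by [rewrite lt_min e10]; lra.
  by lra.
have BD : B `<=` D.
  by move=> p /hB; rewrite lt_min => /andP[_ /h2].
have hv p : B p -> v z0 / 2 <= v (cpt p).
  by move=> /hB; rewrite lt_min => /andP[/h1 + _]; rewrite ltr_norml => /andP[? ?]; lra.
have mB : mu2 B = ((2 * e) * (2 * e))%:E.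
  by rewrite /B mu_box; [congr (_%:E); ring|lra|lra].
have iE : (\int[mu2]_(p in D) (v (cpt p))%:E)%E = (rint v)%:E.
  by rewrite /rint /Rintegral fineK// integrable_fin_num//; exact: measurable_disc_plane.
have mv : measurable_fun D (fun p => (v (cpt p))%:E).
  by case/integrableP: iv.
have mBox : measurable B by exact: measurable_box.
rewrite -lte_fin -iE.
apply: (@lt_le_trans _ _ (\int[mu2]_(p in B) (v (cpt p))%:E)%E); last first.
  apply: ge0_subset_integral => //; first exact: measurable_disc_plane.
  by move=> p Dp; rewrite lee_fin; exact: (v0 (cpt p) Dp).
have le : (\int[mu2]_(p in B) (cst (v z0 / 2)%:E p) <= \int[mu2]_(p in B) (v (cpt p))%:E)%E.
  apply: (ge0_le_integral mu2 mBox).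
  - by move=> p _; rewrite lee_fin ltW.
  - exact: measurable_cst.
  - by apply: measurable_funS mv => //; exact: measurable_disc_plane.
  - by move=> p Bp; rewrite lee_fin; exact: hv.
apply: lt_le_trans le.
rewrite integral_cst//; rewrite [X in (_ * X)%E]mB -EFinM lte_fin.
by rewrite mulr_gt0// mulr_gt0// mulr_gt0.
Qed.

(** A positive multiple of [disc_weight d], since the unweighted kernel is a multiple of (1 -
    |z|^2)^-2 on the diagonal. *)
Definition wt (d : nat) (z : C) : R := (1 - nm z ^+ 2) ^+ (2 * d).
(** The normalising constant of the kernel, left unevaluated: the metric is a derivative of a
    logarithm, and only positivity of the mass enters. *)
Definition massd (d : nat) : R := rint (wt d).

Lemma disc_S (z : C) : disc z -> 0 < 1 - nm z ^+ 2 <= 1.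
Proof.
move=> /discE z1; have z0 := nm_ge0 z; apply/andP; split.
  by rewrite subr_gt0 expr2; nra.
by rewrite lerBlDr lerDl sqr_ge0.
Qed.

Lemma wt_bound d (z : C) : disc z -> 0 < wt d z <= 1.
Proof.
move=> /disc_S/andP[S0 S1]; rewrite /wt exprn_gt0//=.
by rewrite exprn_ile1// ltW.
Qed.

Lemma wt_cont d (z : C) : {for z, continuous (wt d)}.
Proof.
have c := crN (crM (@continuous_nm R z) (@continuous_nm R z)).
have {}c := crD (@cr_cst R 1 z) c.
apply: (@cr_comp R (fun x => x ^+ (2 * d)) (fun z => 1 - nm z ^+ 2)) => //.
exact: exprn_continuous.
Qed.

Lemma rintegrable_wt d : rintegrable (wt d).
Proof.
apply: (@rintegrable_bound R _ 1); first by apply: rmeas_cont => z _; exact: wt_cont.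
by move=> z /(wt_bound d)/andP[h1 h2]; rewrite gtr0_norm.
Qed.

Lemma massd_gt0 d : 0 < massd d.
Proof.
apply: (@rint_gt0 _ 0) => //.
- by move=> z _; exact: wt_cont.
- by move=> z /(wt_bound d)/andP[/ltW].
- exact: rintegrable_wt.
- by apply/discE; rewrite nm0.
- by rewrite /wt nm0 expr0n subr0 expr1n.
Qed.

Lemma rc_wt d (z : C) : rc (wt d z) = sC z ^+ (2 * d).
Proof. by rewrite /wt rcX. Qed.

Section Reproducing.
Variable d : nat.
Let N := (2 * d).+2.

(** The conjugate of the power of [tC w] is holomorphic with value 1 at 0, so this is the conjugate
    of the mean value formula at the centre. *)
Lemma cint_tC w : disc w -> cint (fun z => sC z ^+ (2 * d) * tC w z ^+ N) = rc (massd d).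
Proof.
move=> /discE w1; pose u z := (1 - cj w * z)^-1 ^+ N.
have cw1 : nm (cj w) < 1 by rewrite nm_cj.
have u0 z : nm z < 1 -> 1 - cj w * z != 0.
  by move=> z1; have := @tC_neq0 R (cj w) cw1 (cj z); rewrite nm_cj cjK; apply.
have ubd z : disc z -> nm (u z) <= (1 - nm w)^-1 ^+ N.
  move=> /discE z1; rewrite /u nmX; apply: lerXn2r; rewrite ?nnegrE ?nm_ge0//.
    by rewrite invr_ge0 subr_ge0 ltW.
  by have := @nm_tC R (cj w) cw1 (cj z); rewrite /tC !nm_cj cjK; apply.
have cu z : nm z < 1 -> exists a, cdiff u z a 0.
  move=> z1.
  have h := cdiffD (@cdiff_cst R 1 z) (cdiffM (@cdiff_cst R (- cj w) z) (@cdiff_id R z)).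
  have {}h : cdiff (fun z => 1 - cj w * z) z (- cj w) 0.
    rewrite (_ : (fun z => 1 - cj w * z) = (fun z => 1 + - cj w * id z)).
      by apply: cdiff_eq h; ring.
    by apply/funext => x; rewrite mulNr.
  have h2 := cdiffX N (@cdiffV R (fun z => 1 - cj w * z) z _ _ (u0 z z1) h).
  by eexists; apply: cdiff_eq h2; [reflexivity|rewrite oppr0 mul0r mulr0].
have hu : holomorphic_on (@disc R) u.
  by move=> z /discE/cu[a /cdiff_derive[]].
have ucont z : disc z -> {for z, continuous u}.
  by move=> /discE/cu[a /cdiff_continuous].
have iu : rintegrable (fun z => nm (u z) ^+ 2 * (1 - nm z ^+ 2) ^+ (2 * d)).
  apply: (@rintegrable_bound R _ (((1 - nm w)^-1 ^+ N) ^+ 2 * 1)).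
    apply: rmeas_cont => z dz.
    exact: (crM (crM (cr_nm (ucont z dz)) (cr_nm (ucont z dz))) (@wt_cont d z)).
  move=> z dz; have /andP[h1 h2] := wt_bound d dz.
  rewrite normrM [X in _ * X]gtr0_norm// ger0_norm ?sqr_ge0//.
  apply: ler_pM => //; rewrite ?sqr_ge0 ?(ltW h1)//.
  by apply: lerXn2r; rewrite ?nnegrE ?nm_ge0 ?ubd// exprn_ge0// invr_ge0 subr_ge0 ltW.
have n01 : nm (0 : C) < 1 by rewrite nm0.
have cwt (z : C) : disc z -> {for z, continuous (fun z => sC z ^+ (2 * d))}.
  by move=> _; exact: (ccX (cdiff_continuous (cdiff_sC z))).
have i1 : cintegrable (fun z => u z * sC z ^+ (2 * d)).
  apply: (@cintegrable_bound R _ ((1 - nm w)^-1 ^+ N * 1)).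
    by apply: cmeas_cont => z dz;
      exact: (@ccM R u (fun z => sC z ^+ (2 * d)) z (ucont z dz) (cwt z dz)).
  move=> z dz; have /andP[h1 h2] := wt_bound d dz.
  rewrite nmM -rc_wt nm_rc gtr0_norm//.
  by apply: ler_pM; rewrite ?nm_ge0 ?ubd// ltW.
have i2 : cintegrable (fun z => rc (wt d z)).
  apply: (@cintegrable_bound R _ 1).
    by apply: cmeas_cont => z _; exact: (cc_rc (@wt_cont d z)).
  by move=> z /(wt_bound d)/andP[h1 h2]; rewrite nm_rc gtr0_norm.
have := mean_value_formula n01 hu iu.
rewrite (@eq_cint R _ (fun z => u z * sC z ^+ (2 * d) - rc (wt d z))); last first.
  move=> z _; rewrite /tC /u rc_wt mul0r mulr0 subr0 invr1 !expr1n; ring.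
rewrite cintB// cint_rc ?rintegrable_wt// => /eqP; rewrite subr_eq0 => /eqP h.
rewrite -(cj_rc (massd d)) -h -cint_cj//; apply: eq_cint => z _.
rewrite /u cjM !cjX cjV cjB cj1 cjM cjK /sC cj_rc; ring.
Qed.

(** The mean value formula kills the integral of f - f(w) against the kernel, and [cint_tC]
    evaluates what remains. *)
Lemma reproducing f w : disc w -> holomorphic_on (@disc R) f ->
  rintegrable (fun z => nm (f z) ^+ 2 * wt d z) ->
  cintegrable (fun z => f z * (sC z ^+ (2 * d) * tC w z ^+ N)) /\
  cint (fun z => f z * (sC z ^+ (2 * d) * tC w z ^+ N)) = f w * rc (massd d).
Proof.
move=> dw hf iF; have /discE w1 := dw.
pose tau := (1 - nm w)^-1 ^+ N.
have t0 : 0 <= tau by rewrite exprn_ge0// invr_ge0 subr_ge0 ltW.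
have tT z : disc z -> nm (tC w z ^+ N) <= tau.
  move=> /discE z1; rewrite nmX; apply: lerXn2r; rewrite ?nnegrE ?nm_ge0//.
    by rewrite invr_ge0 subr_ge0 ltW.
  exact: nm_tC.
have fcont z : disc z -> {for z, continuous f}.
  by move=> /hf/differentiable_continuous.
have cst z : disc z -> {for z, continuous (fun z => sC z ^+ (2 * d) * tC w z ^+ N)}.
  move=> /discE z1.
  exact: (ccM (ccX (n := 2 * d) (cdiff_continuous (cdiff_sC z))) (ccX (n := N) (continuous_tC w1 z1))).
have i2 : cintegrable (fun z => sC z ^+ (2 * d) * tC w z ^+ N).
  apply: (@cintegrable_bound R _ (1 * tau)).
    by apply: cmeas_cont => z dz; exact: cst.
  move=> z dz; have /andP[h1 h2] := wt_bound d dz.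
  rewrite nmM -rc_wt nm_rc gtr0_norm//.
  by apply: ler_pM; rewrite ?nm_ge0 ?tT// ltW.
have i1 : cintegrable (fun z => f z * (sC z ^+ (2 * d) * tC w z ^+ N)).
  apply: (@cintegrable_le R _ (fun z => tau * (wt d z + nm (f z) ^+ 2 * wt d z))).
  - by apply: cmeas_cont => z dz; exact: (ccM (fcont z dz) (cst z dz)).
  - move=> z dz; have /andP[h1 h2] := wt_bound d dz.
    rewrite nmM nmM -rc_wt nm_rc gtr0_norm//.
    have : nm (f z) * wt d z <= wt d z + nm (f z) ^+ 2 * wt d z.
      by have := sqr_ge0 (nm (f z) - 1); have := nm_ge0 (f z); nra.
    have := tT _ dz; have := nm_ge0 (tC w z ^+ N); have := nm_ge0 (f z) => f0 t00 tt h.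
    rewrite (_ : nm (f z) * (wt d z * nm (tC w z ^+ N)) = nm (tC w z ^+ N) * (nm (f z) * wt d z));
      last by ring.
    by apply: (ler_pM t00 _ tt h); apply: mulr_ge0 => //; exact: ltW.
  - by apply: rintegrableZ; apply: rintegrableD => //; exact: rintegrable_wt.
split => //; have := mean_value_formula w1 hf iF.
rewrite (@eq_cint R _ (fun z => f z * (sC z ^+ (2 * d) * tC w z ^+ N) -
  f w * (sC z ^+ (2 * d) * tC w z ^+ N))); last by move=> z _; rewrite mulrBl.
rewrite cintB//; last exact: cintegrableZ.
by rewrite cintZ// cint_tC// => /eqP; rewrite subr_eq0 => /eqP.
Qed.

End Reproducing.

End Kernel.

(** * Uniqueness and value of the reproducing kernel on the diagonal *)

Section BergmanKernel.
Variable R : realType.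
Local Notation C := (Cx R).
Local Notation D := (@disc_plane R).
Local Notation mu2 := (@lebesgue_measure R \x @lebesgue_measure R)%E.
Local Notation cint := (@disc_integral R).

Lemma rintegrable_ge0P (g : C -> R) : rmeas g -> (forall z, disc z -> 0 <= g z) ->
  rintegrable g <-> (\int[mu2]_(p in D) (g (cpt p))%:E < +oo)%E.
Proof.
move=> mg g0.
have e : (\int[mu2]_(p in D) `|(g (cpt p))%:E| = \int[mu2]_(p in D) (g (cpt p))%:E)%E.
  by apply: eq_integral => p /in_disc_plane dp; rewrite gee0_abs// lee_fin g0.
split => [/integrableP[_]|h]; first by rewrite -e.
apply/integrableP; split; last by rewrite -e in h.
exact/measurable_EFinP.
Qed.

(** A free factor [lam] covers both uses: the weight 1, and [disc_weight d], which carries a power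
    of [massd R 0]. *)
Variables (mu : C -> R) (d : nat) (lam : R).
Hypotheses (lam_gt0 : (0 : R) < lam).
Hypothesis mu_wt : forall z, disc z -> mu z = lam * wt d z.

Lemma bergman_spaceE (f : C -> C) : bergman_space mu f <->
  holomorphic_on (@disc R) f /\ rintegrable (fun z => nm (f z) ^+ 2 * wt d z).
Proof.
have e (p : measurableTypeR R * measurableTypeR R) : disc (cpt p) ->
   complex.Re (`|f (cpt p)| ^+ 2) * mu (cpt p) =
   lam * (nm (f (cpt p)) ^+ 2 * wt d (cpt p)).
  move=> dp; rewrite mu_wt//.
  have -> : complex.Re (`|f (cpt p)| ^+ 2) = re (`|f (cpt p)| ^+ 2) by [].
  by rewrite normE -rcX re_rc; ring.
have eI : (\int[mu2]_(p in D)
    (complex.Re (`|f (p.1 +i* p.2)| ^+ 2) * mu (p.1 +i* p.2))%:E =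
    \int[mu2]_(p in D) (lam * (nm (f (cpt p)) ^+ 2 * wt d (cpt p)))%:E)%E.
  by apply: eq_integral => p /in_disc_plane dp; congr (_%:E); exact: e.
have fi : holomorphic_on (@disc R) f -> rmeas (fun z => lam * (nm (f z) ^+ 2 * wt d z)) /\
    forall z, disc z -> 0 <= lam * (nm (f z) ^+ 2 * wt d z).
  move=> hf; split.
    apply: rmeas_cont => z dz.
    have c : {for z, continuous (fun z => nm (f z))}.
      by apply: cr_nm; apply: differentiable_continuous; exact: hf.
    exact: (crM (@cr_cst R lam z) (crM (crM c c) (@wt_cont R d z))).
  move=> z /(wt_bound d)/andP[w0 _].
  apply: mulr_ge0; first exact: ltW.
  by apply: mulr_ge0; [exact: sqr_ge0|exact: ltW].
split => -[hf hi]; split => //; have [m0 n0] := fi hf.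
- rewrite eI in hi; have h := (rintegrable_ge0P m0 n0).2 hi.
  have := rintegrableZ lam^-1 h; apply: eq_rintegrable => z _.
  by rewrite mulKf// gt_eqF.
- rewrite eI; apply/(rintegrable_ge0P m0 n0).
  exact: rintegrableZ.
Qed.

Lemma sqr_dot (x y : R) : x * y <= x ^+ 2 + y ^+ 2.
Proof. by have := sqr_ge0 (x - y); have := sqr_ge0 x; have := sqr_ge0 y; nra. Qed.

Lemma dot_integrable (f g : C -> C) : bergman_space mu f -> bergman_space mu g ->
  cintegrable (fun z => f z * cj (g z) * rc (mu z)).
Proof.
move=> /bergman_spaceE[hf fi] /bergman_spaceE[hg gi].
have fcont z : disc z -> {for z, continuous f} by move=> /hf/differentiable_continuous.
have gcont z : disc z -> {for z, continuous g} by move=> /hg/differentiable_continuous.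
apply: (@eq_cintegrable R (fun z => f z * cj (g z) * rc (lam * wt d z))).
  by move=> z /mu_wt ->.
apply: (@cintegrable_le R _ (fun z => lam * (nm (f z) ^+ 2 * wt d z + nm (g z) ^+ 2 * wt d z))).
- apply: cmeas_cont => z dz.
  exact: (ccM (ccM (fcont z dz) (cc_cj (gcont z dz))) (cc_rc (crM (@cr_cst R lam z) (@wt_cont R d z)))).
- move=> z dz; have /andP[w0 _] := wt_bound d dz; have l0 := lam_gt0.
  rewrite nmM nmM nm_cj nm_rc gtr0_norm ?mulr_gt0//.
  rewrite -mulrDl mulrA [leRHS]mulrA ler_pM2r// mulrC ler_pM2l//.
  exact: sqr_dot.
- by apply: rintegrableZ; exact: rintegrableD.
Qed.

Lemma bergman_dotE (f g : C -> C) :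
  bergman_dot mu f g = cint (fun z => f z * cj (g z) * rc (mu z)).
Proof. by []. Qed.

Lemma bergman_dot_cj (f g : C -> C) : bergman_space mu f -> bergman_space mu g ->
  bergman_dot mu f g = cj (bergman_dot mu g f).
Proof.
move=> bf bg; rewrite !bergman_dotE -cint_cj; last exact: dot_integrable.
by apply: eq_cint => z _; rewrite !cjM cjK cj_rc; ring.
Qed.

(** Reproducing each kernel with the other makes the two diagonal values conjugate, and reproducing
    [K'] with itself makes [K' w w] real. *)
Lemma reproducing_kernel_uniq K K' w : is_reproducing_kernel mu K ->
  is_reproducing_kernel mu K' -> disc w -> K w w = K' w w.
Proof.
move=> hK hK' dw; have [bK rK] := hK w dw; have [bK' rK'] := hK' w dw.
have e1 := rK _ bK'; have e2 := rK' _ bK; have e3 := rK' _ bK'.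
have -> : K w w = cj (K' w w) by rewrite e2 bergman_dot_cj// -e1.
by rewrite [RHS]e3 bergman_dot_cj// -e3.
Qed.

Definition kernelC (z w : C) : C :=
  (rc (lam * massd R d))^-1 * (1 - z * cj w)^-1 ^+ (2 * d).+2.

Lemma kernelC_reproducing : is_reproducing_kernel mu kernelC.
Proof.
move=> w dw; have /discE w1 := dw.
have m0 := massd_gt0 R d.
have u0 z : nm z < 1 -> 1 - z * cj w != 0.
  have cw1 : nm (cj w) < 1 by rewrite nm_cj.
  by move=> z1; have := @tC_neq0 R (cj w) cw1 (cj z); rewrite nm_cj cjK mulrC; apply.
split.
  have hol : holomorphic_on (@disc R) (kernelC ^~ w).
    move=> z /discE z1.
    have h := cdiffD (@cdiff_cst R 1 z) (cdiffM (@cdiff_cst R (- cj w) z) (@cdiff_id R z)).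
    have {}h : cdiff (fun z => 1 - z * cj w) z (- cj w) 0.
      rewrite (_ : (fun z => 1 - z * cj w) = (fun z => 1 + - cj w * id z)).
        by apply: cdiff_eq h; ring.
      by apply/funext => x; rewrite mulNr mulrC.
    have h2 := cdiffX (2 * d).+2 (@cdiffV R (fun z => 1 - z * cj w) z _ _ (u0 z z1) h).
    have h3 := cdiffM (@cdiff_cst R (rc (lam * massd R d))^-1 z) h2.
    have [a h4] : exists a, cdiff (kernelC ^~ w) z a 0.
      by eexists; apply: cdiff_eq h3; [reflexivity|rewrite oppr0 !(mul0r, mulr0) addr0].
    by have [] := cdiff_derive h4.
  apply/bergman_spaceE; split => //.
  apply: (@rintegrable_bound R _
    ((nm (rc (lam * massd R d))^-1 * (1 - nm w)^-1 ^+ (2 * d).+2) ^+ 2 * 1)).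
    apply: rmeas_cont => z dz.
    have c : {for z, continuous (fun z => nm (kernelC z w))}.
      by apply: cr_nm; apply: differentiable_continuous; exact: hol.
    exact: (crM (crM c c) (@wt_cont R d z)).
  move=> z dz; have /andP[w0 w2] := wt_bound d dz; have /discE z1 := dz.
  rewrite normrM [X in _ * X]gtr0_norm// ger0_norm ?sqr_ge0//.
  have p0 : 0 <= (1 - nm w)^-1 by rewrite invr_ge0 subr_ge0 ltW.
  apply: ler_pM => //; rewrite ?sqr_ge0 ?(ltW w0)//.
  have q0 : 0 <= (1 - nm w)^-1 ^+ (2 * d).+2 by exact: exprn_ge0.
  apply: lerXn2r; rewrite ?nnegrE; [exact: nm_ge0|by apply: mulr_ge0 => //; exact: nm_ge0|].
  rewrite /kernelC nmM; apply: ler_wpM2l; first exact: nm_ge0.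
  rewrite nmX; apply: lerXn2r; rewrite ?nnegrE ?nm_ge0//.
  by have := nm_tC w1 z1; rewrite /tC -nm_cj cjV cjB cj1 cjM cjK mulrC.
move=> f /bergman_spaceE[hf fi]; rewrite bergman_dotE.
have [i1 r1] := reproducing dw hf fi.
rewrite (@eq_cint R _ (fun z => (rc (massd R d))^-1 * (f z * (sC z ^+ (2 * d) * tC w z ^+ (2 * d).+2)))).
  by rewrite cintZ// r1; field; rewrite -nm_gt0 nm_rc gtr0_norm.
move=> z dz; rewrite mu_wt// /kernelC cjM cjV cj_rc !rcM rc_wt cjX cjV cjB cj1 cjM cjK /tC.
rewrite (mulrC (cj z) w); set T := _ ^+ (2 * d).+2; field.
by rewrite -!nm_gt0 !nm_rc !gtr0_norm// lam_gt0 m0.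
Qed.

Lemma bergman_diagE z : disc z ->
  bergman_diag mu z = (lam * massd R d)^-1 * (1 - nm z ^+ 2)^-1 ^+ (2 * d).+2.
Proof.
move=> dz; rewrite /bergman_diag.
(* [xget] falls back on its default only if no reproducing kernel exists, and [kernelC] is one. *)
have hK : is_reproducing_kernel mu (bergman_kernel mu).
  by rewrite /bergman_kernel; case: xgetP => // h; have := h kernelC kernelC_reproducing.
rewrite (reproducing_kernel_uniq hK kernelC_reproducing dz) /kernelC mul_cj.
by rewrite -rc1 -rcB -!rcV -rcX -rcM.
Qed.

End BergmanKernel.

(** * Computation of the weighted Bergman metrics *)

Section Metric.
Variable R : realType.
Local Notation C := (Cx R).

Lemma is_derive_eps (phi : R -> R) (s D : R) : is_derive s 1 phi D ->
  forall e : R, 0 < e -> exists2 del : R, 0 < del & forall s', `|s' - s| < del ->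
    `|phi s' - phi s - D * (s' - s)| <= e * `|s' - s|.
Proof.
move=> [dv dE] e e0.
have df : differentiable phi s by apply/derivable1_diffP.
have /eqaddoP/(_ _ e0)/nbhs_ballP[del /= del0 hd] := diff_locally df.
exists del => // s' h.
have /hd : ball (0 : R) del (s' - s) by rewrite -ball_normE /= sub0r normrN.
rewrite /= !fctE /= subrK; apply: le_trans; apply: le_of_eq; congr `|_|.
have E1 : 'd phi s 1 = D by rewrite -dE deriveE.
have E2 : 'd phi s ((s' - s) *: (1 : R)) = (s' - s) *: 'd phi s 1 by rewrite linearZ.
have -> : 'd phi s (s' - s) = 'd phi s ((s' - s) *: (1 : R)) by rewrite /GRing.scale /= mulr1.
by rewrite E2 E1 /GRing.scale /=; ring.
Qed.

(** Here the outer function is derivable at one point only, as [ln] demands; the global Taylor bound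
    of [cdiff_radial] would fail near 0. *)
Lemma cdiff_chain (phi : R -> R) (F : C -> R) z a b (D : R) :
  is_derive (F z) 1 phi D -> cdiff (fun z => rc (F z)) z a b ->
  cdiff (fun z => rc (phi (F z))) z (rc D * a) (rc D * b).
Proof.
move=> /is_derive_eps hphi hF e e0.
pose L := 1 + nm a + nm b.
have L0 : 0 < L by rewrite /L; have := nm_ge0 a; have := nm_ge0 b; lra.
have [d1 d10 h1] := cdiff_lip hF; rewrite -/L in h1.
have e2 : 0 < e / (2 * L) by rewrite divr_gt0// mulr_gt0.
have [d2 d20 h2] := hphi _ e2.
have D0 : 0 < `|D| + 1 by rewrite ltr_wpDl.
have e3 : 0 < e / (2 * (`|D| + 1)) by rewrite divr_gt0// mulr_gt0.
have [d3 d30 h3] := hF _ e3.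
exists (Num.min d1 (Num.min (d2 / L) d3)).
  by rewrite !lt_min d10 d30 divr_gt0.
move=> z'; rewrite !lt_min => /andP[/h1 {}h1 /andP[h4 /h3 {}h3]].
set u := z' - z in h1 h3 h4 *; have u0 := nm_ge0 u.
rewrite -rcB nm_rc in h1.
have /h2 {}h2 : `|F z' - F z| < d2.
  by apply: le_lt_trans h1 _; rewrite mulrC -ltr_pdivlMr.
rewrite (_ : _ - _ - _ - _ = rc (phi (F z') - phi (F z) - D * (F z' - F z)) +
  rc D * (rc (F z') - rc (F z) - a * u - b * cj u)); last first.
  by rewrite !(rcB, rcM); ring.
apply: le_trans (nmD _ _) _; rewrite nmM !nm_rc.
have t1 : e / (2 * L) * `|F z' - F z| <= e / 2 * nm u.
  apply: (@le_trans _ _ (e / (2 * L) * (L * nm u))); first by rewrite ler_pM2l.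
  by apply: le_of_eq; field; rewrite gt_eqF.
have t2 : `|D| * nm (rc (F z') - rc (F z) - a * u - b * cj u) <= e / 2 * nm u.
  apply: (@le_trans _ _ ((`|D| + 1) * (e / (2 * (`|D| + 1)) * nm u))).
    by apply: ler_pM => //; [exact: nm_ge0|lra].
  by apply: le_of_eq; field; rewrite gt_eqF.
by move: h2 t1 t2; lra.
Qed.

Lemma rdiff_derive (P : C -> R) z a b : rdiff P z a b ->
  derive1 (fun t : R => P (z + rc t)) 0 = a /\
  derive1 (fun t : R => P (z + ci * rc t)) 0 = b.
Proof.
move=> h.
have key (v : C) (c : R) : nm v = 1 -> a * re v + b * im v = c ->
    derive1 (fun t : R => P (z + v * rc t)) 0 = c.
  move=> v1 vc; rewrite /derive1; apply: cvg_lim; first exact: norm_hausdorff.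
  move=> A /nbhs_ballP[e e0 hA].
  have e2 : 0 < e / 2 by rewrite divr_gt0.
  have [del del0 hd] := h _ e2.
  apply/nbhs_ballP; exists del => // t; rewrite -ball_normE /= sub0r normrN => ht t0.
  apply: hA; rewrite -ball_normE /=.
  have nt : nm (z + v * rc t - z) = `|t| by rewrite addrC addKr nmM v1 mul1r nm_rc.
  have := hd (z + v * rc t); rewrite nt => /(_ ht).
  rewrite !reim.
  have -> : P (z + v * rc (t + 0)) = P (z + v * rc t) by congr (P (z + v * rc _)); exact: addr0.
  have -> : P (z + v * rc 0) = P z by rewrite rc0 mulr0 addr0.
  rewrite (_ : _ - _ - _ - _ = P (z + v * rc t) - P z - c * t); last by rewrite -vc; ring.
  move=> h1; rewrite distrC.
  rewrite (_ : _ - c = (P (z + v * rc t) - P z - c * t) / t); last first.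
    by rewrite /GRing.scale /=; field.
  rewrite normrM normfV ltr_pdivrMr ?normr_gt0//; apply: le_lt_trans h1 _.
  by rewrite ltr_pM2r ?normr_gt0//; lra.
split; last by apply: key; [exact: nm_i|rewrite re_i im_i; ring].
rewrite -(key 1 a) ?nm1// ?re1 ?im1; last by ring.
by congr (derive1 _ 0); apply/funext => t; rewrite mul1r.
Qed.

Lemma cdiff_dz (F : C -> C) z a b : cdiff F z a b -> dz F z = a /\ dzbar F z = b.
Proof.
move=> h; have [r1 r2] := rdiff_derive (cdiff_re h); have [i1 i2] := rdiff_derive (cdiff_im h).
have ex : dx F z = a + b.
  by apply: cx_eq; rewrite !reim; [exact: r1|exact: i1].
have ey : dy F z = ci * (a - b).
  apply: cx_eq; rewrite !reim.
    by rewrite -[RHS]opprK; apply/eqP; rewrite -subr_eq0; apply/eqP; rewrite [X in X - _]r2; ring.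
  by rewrite [LHS]i2; ring.
rewrite /dz /dzbar ex ey.
have two : (2 : C) != 0 by rewrite pnatr_eq0.
split.
  have -> : a + b - 'i%C * (ci * (a - b)) = a + b - (ci * ci) * (a - b) :> C by rewrite -mulrA.
  by rewrite sqr_ci; field.
have -> : a + b + 'i%C * (ci * (a - b)) = a + b + (ci * ci) * (a - b) :> C by rewrite -mulrA.
by rewrite sqr_ci; field.
Qed.

Lemma disc_weightE d (z : C) : disc z ->
  disc_weight d z = massd R 0 ^+ d * wt d z.
Proof.
move=> dz; rewrite /disc_weight (@bergman_diagE R _ 0 1)//; last first.
  by move=> z' _; rewrite /wt muln0 expr0 mulr1.
have m0 := massd_gt0 R 0; have /andP[S0 _] := disc_S dz.
rewrite /wt mul1r muln0 exprMn !exprVn -exprM -invfM invrK.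
by rewrite exprM.
Qed.

(** With s = 1 - |z|^2 and N = 2d + 2, the logarithm of the kernel is a constant minus N ln s. Its
    derivative in [cj z] is N z / s, whose derivative in [z] is N (s + |z|^2) / s^2, and s + |z|^2 =
    1. Both formulas must hold near [z], whence [cdiff_near]. *)
Lemma bergman_metricE d (z : C) : disc z ->
  bergman_metric d z = (2 * d.+1)%:R / sC z ^+ 2.
Proof.
move=> dz; pose lam := massd R 0 ^+ d.
have l0 : 0 < lam by rewrite exprn_gt0// massd_gt0.
pose c := (lam * massd R d)^-1.
have c0 : 0 < c by rewrite invr_gt0 mulr_gt0// massd_gt0.
pose N := (2 * d).+2.
pose psi (s : R) := ln c - N%:R * ln s.
have uE z' : disc z' -> rc (ln (bergman_diag (@disc_weight R d) z')) =
    rc (psi (1 - nm z' ^+ 2)).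
  move=> dz'; have /andP[S0 _] := disc_S dz'.
  rewrite (@bergman_diagE R (@disc_weight R d) d lam l0 (@disc_weightE d) z' dz').
  rewrite -/c -/N; have Si : 0 < (1 - nm z' ^+ 2)^-1 by rewrite invr_gt0.
  have -> : ln (c * (1 - nm z' ^+ 2)^-1 ^+ N) = ln c + ln ((1 - nm z' ^+ 2)^-1 ^+ N).
    by apply: lnM; rewrite posrE// exprn_gt0.
  rewrite (lnXn N Si) (lnV (x := 1 - nm z' ^+ 2)) ?posrE//.
  by rewrite /psi mulNrn mulr_natl.
have dnear (z' : C) : disc z' -> \forall y \near z', disc y.
  by move=> h; apply: open_nbhs_nbhs; split => //; exact: open_disc.
have dpsi (s : R) : 0 < s -> is_derive s 1 psi (- N%:R / s).
  move=> s0; have dl := is_derive1_ln s0.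
  apply: is_derive_eq; rewrite /GRing.scale /=; ring.
have u1 z' : disc z' ->
    cdiff (fun z => rc (ln (bergman_diag (@disc_weight R d) z))) z'
     (N%:R * cj z' / sC z') (N%:R * z' / sC z').
  move=> dz'; have /andP[S0 _] := disc_S dz'.
  have h := cdiff_chain (dpsi _ S0) (cdiff_sC z').
  apply: (@cdiff_near _ (fun z => rc (psi (1 - nm z ^+ 2)))).
    by have := dnear _ dz'; apply: filterS => y /uE ->.
  by apply: cdiff_eq h; rewrite rcM rcV rcN rcn -/(sC z'); ring.
have v1 z' : disc z' ->
    dzbar (fun z => rc (ln (bergman_diag (@disc_weight R d) z))) z' = N%:R * z' / sC z'.
  by move=> /u1/cdiff_dz[].
have Sz : sC z != 0.
  by have /andP[S0 _] := disc_S dz; rewrite -nm_gt0 nm_rc gtr0_norm.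
have h := cdiffM (cdiffM (@cdiff_cst R N%:R z) (@cdiff_id R z)) (cdiffV Sz (cdiff_sC z)).
have E : \forall y \near z, N%:R * id y * (sC y)^-1 =
    dzbar (fun z => rc (ln (bergman_diag (@disc_weight R d) z))) y.
  by have := dnear _ dz; apply: filterS => y /v1 ->.
have h2 := cdiff_near E h.
have [e _] := cdiff_dz h2.
rewrite /bergman_metric
  -[LHS]/(Defs.dz (dzbar (fun z => rc (ln (bergman_diag (@disc_weight R d) z)))) z) e.
have e2 : z * cj z = 1 - sC z by rewrite sCE; ring.
rewrite (_ : _ + _ = N%:R * (sC z + z * cj z) / sC z ^+ 2); last first.
  by move: (sC z) (cj z) Sz => s v s0; rewrite /=; field.
by rewrite e2 addrC subrK mulr1 /N mulnS.
Qed.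

End Metric.

(** * Maximum principle and Schwarz lemma *)

Section ReproducingClass.
Variable R : realType.
Local Notation C := (Cx R).
Local Notation cint := (@disc_integral R).
Let A := massd R 0.

(* Bounded functions satisfying the unweighted Bergman reproducing formula: they are
   the bounded holomorphic functions, but closure under pointwise limits is immediate. *)
Definition repro (B : R) (u : C -> C) :=
  [/\ cmeas u, forall z, disc z -> nm (u z) <= B &
    forall w, disc w -> cint (fun z => u z * tC w z ^+ 2) = u w * rc A].

Let A0 : 0 < A. Proof. exact: massd_gt0. Qed.

Lemma wt0 (z : C) : wt 0 z = 1. Proof. by rewrite /wt muln0 expr0. Qed.

Lemma rintegrable_cst (c : R) : rintegrable (fun _ : C => c).
Proof.
apply: (@rintegrable_bound R _ `|c|) => //.
by apply: rmeas_cont => z _; exact: cr_cst.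
Qed.

Lemma rint_cst (c : R) : rint (fun _ : C => c) = c * A.
Proof.
rewrite /A /massd -rintZ; last exact: rintegrable_wt.
by apply: eq_rint => z _; rewrite wt0 mulr1.
Qed.

Lemma cmeas_tC w n : disc w -> cmeas (fun z : C => tC w z ^+ n).
Proof.
by move=> /discE w1; apply: cmeas_cont => z /discE z1; exact: (ccX (continuous_tC w1 z1)).
Qed.

Let tau (w : C) := (1 - nm w)^-1.

Lemma tC_bound (w z : C) n : disc w -> disc z -> nm (tC w z ^+ n) <= tau w ^+ n.
Proof.
move=> /discE w1 /discE z1; rewrite nmX; apply: lerXn2r; rewrite ?nnegrE ?nm_ge0//.
  by rewrite invr_ge0 subr_ge0 ltW.
exact: nm_tC.
Qed.

Lemma repro_integrable B u w n : repro B u -> disc w -> cintegrable (fun z => u z * tC w z ^+ n).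
Proof.
move=> [mu bu _] dw; apply: (@cintegrable_bound R _ (B * tau w ^+ n)).
  by apply: cmeasM => //; exact: cmeas_tC.
by move=> z dz; rewrite nmM; apply: ler_pM; rewrite ?nm_ge0 ?bu ?tC_bound.
Qed.

Lemma tC0 (z : C) : tC 0 z = 1. Proof. by rewrite /tC mul0r subr0 invr1. Qed.

Lemma disc0 : disc (0 : C). Proof. by apply/discE; rewrite nm0. Qed.

Lemma repro_mean B u : repro B u -> cint u = u 0 * rc A.
Proof.
move=> [_ _ h]; rewrite -(h 0 disc0); apply: eq_cint => z _.
by rewrite tC0 expr1n mulr1.
Qed.

Lemma repro_cintegrable B u : repro B u -> cintegrable u.
Proof. by move=> [mu bu _]; exact: cintegrable_bound bu. Qed.

Lemma repro_hol B u : holomorphic_on (@disc R) u -> (forall z, disc z -> nm (u z) <= B) ->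
  repro B u.
Proof.
move=> hu bu.
have cu z : disc z -> {for z, continuous u} by move=> /hu/differentiable_continuous.
split => //; first exact: cmeas_cont.
move=> w dw.
have iu : rintegrable (fun z => nm (u z) ^+ 2 * wt 0 z).
  apply: (@rintegrable_bound R _ (B ^+ 2)).
    apply: rmeas_cont => z dz.
    by have c := cr_nm (cu z dz); exact: (crM (crM c c) (@wt_cont R 0 z)).
  move=> z dz; rewrite wt0 mulr1 ger0_norm ?sqr_ge0//.
  have b0 : 0 <= B by apply: le_trans (bu _ dz); exact: nm_ge0.
  by apply: lerXn2r; rewrite ?nnegrE ?nm_ge0 ?bu.
have [_ <-] := reproducing dw hu iu.
by apply: eq_cint => z _; rewrite expr0 mul1r.
Qed.

Lemma reproZ B u (c : C) : repro B u -> repro (nm c * B) (fun z => c * u z).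
Proof.
move=> ru; have [mu bu h] := ru; split.
- by apply: cmeasM => //; exact: cmeas_cst.
- by move=> z dz; rewrite nmM; apply: ler_wpM2l; [exact: nm_ge0|exact: bu].
- move=> w dw; rewrite -mulrA -h// -cintZ; last exact: repro_integrable ru dw.
  by apply: eq_cint => z _; rewrite mulrA.
Qed.

Lemma reproD B B' u v : repro B u -> repro B' v -> repro (B + B') (fun z => u z + v z).
Proof.
move=> ru rv; have [mu bu hu] := ru; have [mv bv hv] := rv; split.
- exact: cmeasD.
- by move=> z dz; apply: le_trans (nmD _ _) _; apply: lerD; [exact: bu|exact: bv].
- move=> w dw; rewrite mulrDl -hu// -hv// -cintD; last 2 first.
  + exact: repro_integrable ru dw.
  + exact: repro_integrable rv dw.
  by apply: eq_cint => z _; rewrite mulrDl.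
Qed.

Lemma repro0 : repro 0 (fun=> 0).
Proof.
split; first exact: cmeas_cst.
- by move=> z _; rewrite nm0.
- move=> w dw; rewrite mul0r; apply: cx_eq; rewrite ?(re_cint, im_cint) /rint Rintegral0_eq//.
  by move=> p _; rewrite mul0r.
  by move=> p _; rewrite mul0r.
Qed.

Lemma repro_sum (I : Type) (s : seq I) (u : I -> C -> C) (B : I -> R) :
  (forall i, repro (B i) (u i)) ->
  repro (\sum_(i <- s) B i) (fun z => \sum_(i <- s) u i z).
Proof.
move=> h; elim: s => [|i s ih].
  rewrite big_nil (_ : (fun z => _) = fun=> 0); first exact: repro0.
  by apply/funext => z; rewrite big_nil.
rewrite big_cons (_ : (fun z => _) = fun z => u i z + \sum_(j <- s) u j z).
  exact: reproD.
by apply/funext => z; rewrite big_cons.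
Qed.

Lemma tC_sqr_lip (w w' z : C) (r : R) : r < 1 -> nm w <= r -> nm w' <= r -> disc z ->
  nm (tC w z ^+ 2 - tC w' z ^+ 2) <= 2 * (1 - r)^-1 ^+ 3 * nm (w - w').
Proof.
move=> r1 wr wr' dz; have /discE z1 := dz.
have w1 : nm w < 1 by lra.
have w1' : nm w' < 1 by lra.
have n0 := tC_neq0 w1 z1; have n0' := tC_neq0 w1' z1.
pose t := (1 - r)^-1.
have t0 : 0 <= t by rewrite invr_ge0; lra.
have bt v : nm v <= r -> nm (tC v z) <= t.
  move=> vr; have v1 : nm v < 1 by lra.
  apply: le_trans (nm_tC v1 z1) _.
  by rewrite lef_pV2 ?posrE ?subr_gt0//; lra.
rewrite (_ : _ - _ = (w - w') * (cj z * (tC w z * tC w' z * (tC w z + tC w' z)))); last first.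
  by rewrite /tC; field; rewrite n0 n0'.
rewrite nmM [leRHS]mulrC; apply: ler_wpM2l; first exact: nm_ge0.
rewrite nmM nm_cj.
have b1 := bt _ wr; have b2 := bt _ wr'.
have p1 := nm_ge0 (tC w z); have p2 := nm_ge0 (tC w' z).
have h1 : nm (tC w z * tC w' z) <= t * t by rewrite nmM; apply: ler_pM.
have h2 : nm (tC w z + tC w' z) <= 2 * t by apply: le_trans (nmD _ _) _; lra.
have h3 := ler_pM (nm_ge0 _) (nm_ge0 _) h1 h2; rewrite -nmM in h3.
have h4 := ler_pM (nm_ge0 z) (nm_ge0 _) (ltW z1) h3.
by apply: le_trans h4 _; rewrite -/t; apply: le_of_eq; ring.
Qed.

(** [u w] is an integral of [u] against a kernel that is Lipschitz in [w]. The 4 is the 2 of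
    [nm_cint] times the 2 of [tC_sqr_lip]. *)
Lemma repro_lip B u (r : R) w w' : repro B u -> r < 1 -> nm w <= r -> nm w' <= r ->
  nm (u w - u w') <= 4 * B * (1 - r)^-1 ^+ 3 * nm (w - w').
Proof.
move=> ru r1 wr wr'; have [mu bu h] := ru.
have dw : disc w by apply/discE; lra.
have dw' : disc w' by apply/discE; lra.
have B0 : 0 <= B by apply: le_trans (bu _ disc0); exact: nm_ge0.
have i1 := repro_integrable 2 ru dw.
have i2 := repro_integrable 2 ru dw'.
have e : (u w - u w') * rc A = cint (fun z => u z * (tC w z ^+ 2 - tC w' z ^+ 2)).
  by rewrite mulrBl -!h// -cintB//; apply: eq_cint => z _; rewrite mulrBr.
have i3 : cintegrable (fun z => u z * (tC w z ^+ 2 - tC w' z ^+ 2)).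
  apply: eq_cintegrable (cintegrableD i1 (cintegrableZ (-1) i2)) => z _.
  by ring.
have := nm_cint i3 (rintegrable_cst (B * (2 * (1 - r)^-1 ^+ 3 * nm (w - w')))) _.
rewrite -e rint_cst nmM nm_rc gtr0_norm//.
rewrite (_ : 2 * (_ * A) = 4 * B * (1 - r)^-1 ^+ 3 * nm (w - w') * A); last by ring.
rewrite ler_pM2r//; apply => z dz; rewrite nmM.
by apply: ler_pM; rewrite ?nm_ge0 ?bu//; exact: tC_sqr_lip.
Qed.

Lemma repro_cont B u z : repro B u -> disc z -> {for z, continuous u}.
Proof.
move=> ru /discE z1; apply/continuous_nmP => e e0.
pose r := (1 + nm z) / 2.
have r1 : r < 1 by rewrite /r; lra.
pose K := 4 * B * (1 - r)^-1 ^+ 3.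
have K0 : 0 < `|K| + 1 by rewrite ltr_wpDl.
exists (Num.min ((1 - nm z) / 2) (e / (`|K| + 1))).
  by rewrite lt_min !divr_gt0// subr_gt0.
move=> w; rewrite lt_min => /andP[h1 h2].
have wr : nm w <= r.
  by have := nmD (w - z) z; rewrite subrK /r; lra.
apply: le_lt_trans (repro_lip ru r1 wr _) _; first by rewrite /r; lra.
rewrite -/K; apply: (@le_lt_trans _ _ ((`|K| + 1) * nm (w - z))).
  by apply: ler_wpM2r; [exact: nm_ge0|have := ler_norm K; lra].
by rewrite mulrC -ltr_pdivlMr.
Qed.

(** At 0 the kernel is constant, so [u] has the mean value property: re (u 0) - re u is continuous,
    nonnegative and of integral 0. *)
Lemma repro_re_max B u : repro B u -> (forall z, disc z -> re (u z) <= re (u 0)) ->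
  forall z, disc z -> re (u z) = re (u 0).
Proof.
move=> ru h z dz; apply/eqP; rewrite eq_le h//= leNgt; apply/negP => lt.
have cu := repro_cont ru; have [iu _] := repro_cintegrable ru.
pose v z := re (u 0) - re (u z).
have iv : rintegrable v by apply: rintegrableB => //; exact: rintegrable_cst.
have : 0 < rint v.
  apply: (rint_gt0 (z0 := z)) => //.
  - by move=> y dy; exact: (crD (@cr_cst R (re (u 0)) y) (crN (cr_re (cu y dy)))).
  - by move=> y /h; rewrite /v subr_ge0.
  - by rewrite /v subr_gt0.
rewrite /v rintB//; last exact: rintegrable_cst.
by rewrite rint_cst -re_cint (repro_mean ru) reM im_rc mulr0 subr0 re_rc subrr ltxx.
Qed.

(** The real part of [cj (u 0) * u] is maximal at 0, hence constantly |u(0)|^2; expanding, |u(z) -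
    u(0)|^2 = |u(z)|^2 - |u(0)|^2, which is at most 0. *)
Lemma strong_max B u : repro B u -> (forall z, disc z -> nm (u z) <= nm (u 0)) ->
  forall z, disc z -> u z = u 0.
Proof.
move=> ru h z dz.
have r2 := reproZ (cj (u 0)) ru.
have e0 : re (cj (u 0) * u 0) = nm (u 0) ^+ 2.
  by rewrite mulrC mul_cj.
have hm : forall y, disc y -> re (cj (u 0) * u y) <= re (cj (u 0) * u 0).
  move=> y /h hy; apply: le_trans (re_le_nm _) _.
  by rewrite e0 nmM nm_cj expr2; apply: ler_wpM2l => //; exact: nm_ge0.
have e1 := repro_re_max r2 hm dz.
have := h _ dz; set a := u z in e1 *; set b := u 0 in e0 e1 *.
move=> hab; rewrite e0 in e1.
apply/eqP; rewrite -subr_eq0 -nm_eq0 -sqrf_eq0 eq_le sqr_ge0 andbT.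
have : nm a ^+ 2 <= nm b ^+ 2 by apply: lerXn2r; rewrite ?nnegrE ?nm_ge0.
rewrite !nm_sqr !reim; rewrite !reim nm_sqr in e1.
by move=> ?; nra.
Qed.

(** The uniform bound [B] allows dominated convergence in the reproducing formula; no uniformity of
    the convergence is asked. *)
Lemma repro_lim B (u_ : nat -> C -> C) u : (forall n, repro B (u_ n)) ->
  (forall z, disc z -> nm (u_ n z - u z) @[n --> \oo] --> (0 : R)) -> repro B u.
Proof.
move=> hr hc.
have b z : disc z -> nm (u z) <= B.
  move=> dz; apply/ler_addgt0Pr => e e0.
  have /cvgrPdist_lt/(_ _ e0)[n _ /(_ n (leqnn n))] := hc z dz.
  rewrite /= sub0r normrN ger0_norm ?nm_ge0// => h.
  have [_ bn _] := hr n; have := bn z dz; have := nmD (u z - u_ n z) (u_ n z).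
  by rewrite subrK nm_distC; lra.
have m : cmeas u.
  split.
  - apply: (@measurable_fun_cvg _ _ _ _ (fun n p => re (u_ n (cpt p)))).
    + by move=> n; have [[]] := hr n.
    + by move=> p dp; case: (cvg_re_im (hc (cpt p) dp)).
  - apply: (@measurable_fun_cvg _ _ _ _ (fun n p => im (u_ n (cpt p)))).
    + by move=> n; have [[]] := hr n.
    + by move=> p dp; case: (cvg_re_im (hc (cpt p) dp)).
split => // w dw.
have [] := @cint_dominated R (fun n z => u_ n z * tC w z ^+ 2) (fun z => u z * tC w z ^+ 2)
  (fun=> B * tau w ^+ 2).
- by move=> n; have [mn _ _] := hr n; apply: cmeasM => //; exact: cmeas_tC.
- move=> z dz; rewrite (_ : (fun n => _) = fun n => nm (tC w z ^+ 2) * nm (u_ n z - u z)).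
    by rewrite -[0](mulr0 (nm (tC w z ^+ 2))); apply: cvgMr; exact: hc.
  by apply/funext => n; rewrite -nmM; congr nm; ring.
- exact: rintegrable_cst.
- move=> n z dz; have [_ bn _] := hr n; rewrite nmM.
  by apply: ler_pM; rewrite ?nm_ge0 ?bn ?tC_bound.
have [c1 c2] := cvg_re_im (hc w dw).
have e n : cint (fun z => u_ n z * tC w z ^+ 2) = u_ n w * rc A by have [_ _ ->] := hr n.
rewrite (_ : (fun n => re (cint _)) = fun n => re (u_ n w) * A); last first.
  by apply/funext => n; rewrite e reM im_rc mulr0 subr0.
rewrite (_ : (fun n => im (cint _)) = fun n => im (u_ n w) * A); last first.
  by apply/funext => n; rewrite e imM im_rc mulr0 add0r.
move=> h1 h2; apply: cx_eq.
- rewrite reM im_rc mulr0 subr0 re_rc; apply: cvg_unique h1 _; first exact: norm_hausdorff.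
  by apply: cvgMl.
- rewrite imM im_rc mulr0 add0r re_rc; apply: cvg_unique h2 _; first exact: norm_hausdorff.
  by apply: cvgMl.
Qed.

End ReproducingClass.

(** * Division of a holomorphic function by z at a zero *)

Section Schwarz.
Variable R : realType.
Local Notation C := (Cx R).
Local Notation cint := (@disc_integral R).

Lemma hol_cdiff (f : C -> C) z : holomorphic_on (@disc R) f -> disc z ->
  cdiff f z ('d f z 1) 0.
Proof. by move=> hf dz; apply: diff_cdiff; exact: hf. Qed.

Lemma cdiff_hol (f : C -> C) : (forall z, disc z -> exists a, cdiff f z a 0) ->
  holomorphic_on (@disc R) f.
Proof. by move=> h z /h[a /cdiff_derive[]]. Qed.

Lemma cdiff_comp_affine (f : C -> C) (p v z a : C) : cdiff f (p + v * z) a 0 ->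
  cdiff (fun z => f (p + v * z)) z (a * v) 0.
Proof.
move=> h e e0.
have v1 : 0 < nm v + 1 by have := nm_ge0 v; lra.
have e2 : 0 < e / (nm v + 1) by rewrite divr_gt0.
have [del del0 hd] := h _ e2.
exists (del / (nm v + 1)); first by rewrite divr_gt0.
move=> z' hz; have u0 := nm_ge0 (z' - z).
have hv : nm (p + v * z' - (p + v * z)) = nm v * nm (z' - z).
  by rewrite -nmM; congr nm; ring.
have hl : nm v * nm (z' - z) <= (nm v + 1) * nm (z' - z) by apply: ler_wpM2r => //; lra.
have := hd (p + v * z'); rewrite hv.
have -> : nm v * nm (z' - z) < del.
  by apply: le_lt_trans hl _; rewrite mulrC -ltr_pdivlMr.
move=> /(_ isT); rewrite !mul0r !subr0 => h1.
rewrite (_ : _ - _ - _ = f (p + v * z') - f (p + v * z) - a * (p + v * z' - (p + v * z)));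
  last by ring.
apply: le_trans h1 _; apply: (@le_trans _ _ (e / (nm v + 1) * ((nm v + 1) * nm (z' - z)))).
  by rewrite ler_pM2l.
by rewrite mulrA divfK ?gt_eqF.
Qed.

(* The difference quotient of f at a zero extends holomorphically: dividing the
   reproducing formula by w gives an integral formula for the quotient. *)
Lemma dslope (f : C -> C) : holomorphic_on (@disc R) f -> (forall z, disc z -> nm (f z) <= 1) ->
  f 0 = 0 -> exists g : C -> C, [/\ holomorphic_on (@disc R) g,
    forall z, disc z -> f z = z * g z & g 0 = 'd f 0 1].
Proof.
move=> hf bf f0.
have d0 := @disc0 R.
have rf := repro_hol hf bf.
have A0 : 0 < massd R 0 by exact: massd_gt0.
have cA0 : rc (massd R 0) != 0 by rewrite -nm_gt0 nm_rc gtr0_norm.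
set A := rc (massd R 0) in cA0.
(* [tC w z ^+ 2 - 1] equals [w * cj z * (tC w z + tC w z ^+ 2)], and the formulas at [w] and at 0
   are subtracted: this is the quotient by [w]. *)
pose F w z := f z * (cj z * (tC w z + tC w z ^+ 2)).
pose g w := cint (F w) / A.
have fcont z : disc z -> {for z, continuous f}.
  by move=> /hf/differentiable_continuous.
have mF w : disc w -> cmeas (F w).
  move=> /discE w1; apply: cmeas_cont => z dz; have /discE z1 := dz.
  have ct := continuous_tC w1 z1.
  exact: (ccM (fcont z dz) (ccM (cc_cj (@cc_id R z)) (ccD ct (ccX (n := 2) ct)))).
have tb (w z : C) : nm w <= 2^-1 -> disc z -> nm (tC w z) <= 2.
  move=> w2 /discE z1; have w1 : nm w < 1 by lra.
  apply: le_trans (nm_tC w1 z1) _.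
  by rewrite -[leRHS]invrK lef_pV2 ?posrE ?subr_gt0//; lra.
have iF w : disc w -> cintegrable (F w).
  move=> dw; have /discE w1 := dw; pose t := (1 - nm w)^-1.
  apply: (@cintegrable_bound R _ (1 * (1 * (t + t ^+ 2)))); first exact: mF.
  move=> z dz; have /discE z1 := dz.
  have tz := nm_tC w1 z1.
  rewrite nmM nmM nm_cj; apply: ler_pM; rewrite ?mulr_ge0 ?nm_ge0 ?bf//.
  apply: ler_pM; rewrite ?nm_ge0 ?(ltW z1)//.
  apply: le_trans (nmD _ _) _; rewrite nmX; apply: lerD => //.
  by apply: lerXn2r; rewrite ?nnegrE ?nm_ge0// invr_ge0 subr_ge0 ltW.
have fE w : disc w -> f w = w * g w.
  move=> dw; have /discE w1 := dw; rewrite /g.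
  have [_ _ h] := rf.
  have h1 := h w dw; have h2 := h 0 d0.
  apply: (mulIf cA0); rewrite mulrA divfK// -cintZ; last exact: iF.
  rewrite -[LHS]subr0 -[X in _ - X](mul0r A) -f0 -h1 -h2 -cintB.
  - apply: eq_cint => z /discE z1; rewrite tC0 /F.
    have n0 := tC_neq0 w1 z1.
    by rewrite /tC; field.
  - exact: repro_integrable rf dw.
  - exact: repro_integrable rf d0.
(* The derivative of [F w z] in [w] at 0: there [tC] is 1 with derivative [cj z], so that 3 = 1 +
   2. *)
pose F2 z := f z * (cj z ^+ 2 * 3).
have iF2 : cintegrable F2.
  apply: (@cintegrable_bound R _ (1 * (1 * 3))).
    apply: cmeas_cont => z dz.
    exact: (ccM (fcont z dz) (ccM (ccX (n := 2) (cc_cj (@cc_id R z))) (@cc_cst R 3 z))).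
  move=> z dz; have /discE z1 := dz.
  rewrite nmM nmM nmX nm_cj nm_nat; apply: ler_pM; rewrite ?mulr_ge0 ?exprn_ge0 ?nm_ge0 ?bf//.
  by apply: ler_pM => //; rewrite ?exprn_ge0 ?nm_ge0// exprn_ile1 ?nm_ge0// ltW.
(* Elsewhere [g] is the quotient of [f w] by [w]; only at 0 does holomorphy require the integral. *)
have g0 : cdiff g 0 (cint F2 / A) 0.
  move=> e e0.
  (* The second-order remainder of [F] is w^2 times a factor of modulus at most 10 for |w| up to
     1/2, and [nm_cint] doubles it. *)
  pose K := 20 : R.
  exists (Num.min 2^-1 (e / K)); first by rewrite lt_min invr_gt0 ltr0n divr_gt0.
  move=> w; rewrite subr0 lt_min => /andP[h1 h2].
  have dw : disc w by apply/discE; lra.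
  rewrite mul0r subr0 /g.
  have -> : cint (F w) / A - cint (F 0) / A - cint F2 / A * w =
      cint (fun z => F w z - F 0 z - w * F2 z) / A.
    rewrite cintB; last 2 first.
    - by apply: eq_cintegrable (cintegrableD (iF w dw) (cintegrableZ (-1) (iF 0 d0))) => z _; ring.
    - exact: cintegrableZ.
    rewrite cintB; [|exact: iF|exact: iF].
    by rewrite cintZ//; field.
  have ib : cintegrable (fun z => F w z - F 0 z - w * F2 z).
    apply: eq_cintegrable (cintegrableD (cintegrableD (iF w dw) (cintegrableZ (-1) (iF 0 d0)))
      (cintegrableZ (- w) iF2)) => z _; ring.
  have := nm_cint ib (rintegrable_cst (nm w ^+ 2 * 10)) _.
  rewrite rint_cst nmM nmV nm_rc gtr0_norm// => hh.
  rewrite ler_pdivrMr//; apply: le_trans (hh _) _.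
    move=> z dz; have /discE z1 := dz; have w1 : nm w < 1 by lra.
    have n0 := tC_neq0 w1 z1.
    rewrite (_ : _ - _ - _ =
        w ^+ 2 * (f z * (cj z * cj z * cj z) * (tC w z * (tC w z + 3)))); last first.
      by rewrite /F /F2 tC0 /tC; field.
    rewrite nmM nmX; apply: ler_wpM2l; first exact: sqr_ge0.
    have t2 := tb w z (ltW h1) dz; have t0 := nm_ge0 (tC w z).
    have a1 : nm (tC w z * (tC w z + 3)) <= 2 * 5.
      rewrite nmM; apply: ler_pM; rewrite ?nm_ge0//.
      by apply: le_trans (nmD _ _) _; rewrite nm_nat; lra.
    have a2 : nm (cj z * cj z * cj z) <= 1 * 1 * 1.
      by rewrite !nmM nm_cj; do 2 (apply: ler_pM; rewrite ?mulr_ge0 ?nm_ge0 ?(ltW z1)//).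
    have a3 := ler_pM (nm_ge0 _) (nm_ge0 _) (bf z dz) a2; rewrite -nmM in a3.
    have a4 := ler_pM (nm_ge0 _) (nm_ge0 _) a3 a1; rewrite -nmM in a4.
    by apply: le_trans a4 _; lra.
  have := h2; rewrite ltr_pdivlMr// /K => h3.
  have w0 := nm_ge0 w.
  rewrite (_ : 2 * _ = nm w * 20 * nm w * massd R 0); last by ring.
  by rewrite ler_pM2r//; apply: ler_wpM2r => //; exact: ltW.
exists g; split; last 1 first.
- have h := cdiffM (@cdiff_id R 0) g0.
  have {}h : cdiff f 0 (g 0) 0.
    apply: cdiff_near (cdiff_eq _ _ h); last 2 first.
    + by rewrite /= mul1r mul0r addr0.
    + by rewrite !(mul0r, mulr0) addr0.
    have := open_nbhs_nbhs (conj (@open_disc R) d0).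
    by apply: filterS => y dy; rewrite fE.
  by have [_ ->] := cdiff_derive h.
- apply: cdiff_hol => w dw; have [->|w0] := eqVneq w 0; first by exists (cint F2 / A).
  have h := cdiffM (hol_cdiff hf dw) (cdiffV w0 (@cdiff_id R w)).
  eexists; apply: cdiff_near (cdiff_eq _ _ h); last 2 first.
  + by reflexivity.
  + by rewrite oppr0 !(mul0r, mulr0) addr0.
  have nd : \forall y \near w, disc y /\ y != 0.
    apply/nbhs_nm; exists (Num.min (1 - nm w) (nm w)).
      by rewrite lt_min nm_gt0 w0 subr_gt0 andbT; apply/discE.
    move=> y; rewrite lt_min => /andP[h1 h2]; split.
      by apply/discE; have := nmD (y - w) w; rewrite subrK; lra.
    by apply: contraTneq h2 => ->; rewrite sub0r nmN ltxx.
  by apply: filterS nd => y [dy y0]; rewrite fE//= mulrAC divff// mul1r.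
- exact: fE.
Qed.

End Schwarz.

(** * Maximum principle on smaller discs, Schwarz lemma, vanishing derivative *)

Section SchwarzLemma.
Variable R : realType.
Local Notation C := (Cx R).

Lemma compact_closed_disc (r : R) : compact [set z : C | nm z <= r].
Proof.
apply: (@subclosed_compact _ _ _ _ (@compact_box R (- r) r (- r) r)).
  rewrite (_ : [set z | _] = (@nm R) @^-1` [set x | x <= r]) //.
  apply: closed_comp; last exact: closed_le.
  by move=> z _; exact: continuous_nm.
move=> z /= zr; exists (re z, im z); last by apply: cx_eq.
have := re_nm z; have := im_nm z; rewrite !ler_norml => /andP[? ?] /andP[? ?].
by split; rewrite /= in_itv/=; apply/andP; split; lra.
Qed.

(** The maximum of |g| on the closed disc is attained at some [p]. If [p] is interior, [g] is
    constant on the largest disc around [p] inside it, which touches the circle at a point [w];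
    continuity carries the value to [w]. *)
Lemma max_principle (g : C -> C) (r M : R) : 0 < r -> r < 1 ->
  holomorphic_on (@disc R) g -> (forall z, nm z = r -> nm (g z) <= M) ->
  forall z, nm z <= r -> nm (g z) <= M.
Proof.
move=> r0 r1 hg hM.
have gcont z : disc z -> {for z, continuous g}.
  by move=> /hg/differentiable_continuous.
have [p pr pmax] : exists2 c, c \in [set z : C | nm z <= r] &
    forall t, t \in [set z : C | nm z <= r] -> nm (g t) <= nm (g c).
  apply: (@compact_EVT_max C R (fun z => nm (g z))).
  - by exists 0; rewrite /= nm0 ltW.
  - exact: compact_closed_disc.
  - apply: continuous_in_subspaceT => z; rewrite inE /= => zr.
    by apply: cr_nm; apply: gcont; apply/discE; exact: le_lt_trans zr r1.
have {}pr : nm p <= r by move: pr; rewrite inE.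
have {}pmax t : nm t <= r -> nm (g t) <= nm (g p) by move=> tr; apply: pmax; rewrite inE.
suff pM : nm (g p) <= M by move=> z zr; exact: le_trans (pmax _ zr) pM.
have [pr'|] := eqVneq (nm p) r; first exact: hM.
move=> npr; have {}pr : nm p < r by rewrite lt_neqAle npr.
pose rho := r - nm p.
have rho0 : 0 < rho by rewrite subr_gt0.
have inr (z : C) : nm z <= 1 -> nm (p + rc rho * z) <= r.
  move=> z1; apply: le_trans (nmD _ _) _; rewrite nmM nm_rc gtr0_norm//.
  have : rho * nm z <= rho * 1 by rewrite ler_pM2l.
  by rewrite /rho; lra.
have hu : repro (nm (g p)) (fun z => g (p + rc rho * z)).
  apply: repro_hol.
    apply: cdiff_hol => z /discE z1.
    have dq : disc (p + rc rho * z) by apply/discE; apply: le_lt_trans r1; apply: inr; exact: ltW.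
    by eexists; apply: cdiff_comp_affine; exact: (hol_cdiff hg dq).
  by move=> z /discE z1; apply: pmax; apply: inr; exact: ltW.
have cst z : disc z -> g (p + rc rho * z) = g p.
  move=> dz; rewrite -[in RHS](addr0 p) -[in RHS](mulr0 (rc rho)).
  apply: (strong_max hu) => // y /discE y1; rewrite mulr0 addr0.
  by apply: pmax; apply: inr; exact: ltW.
(* [v] is the direction of [p], or any direction if [p] is 0. *)
have [v [v1 vr]] : exists v : C, nm v = 1 /\ nm (p + rc rho * v) = r.
  have [p0|p0] := eqVneq p 0.
    by exists 1; rewrite nm1 p0 add0r mulr1 nm_rc gtr0_norm// /rho p0 nm0 subr0.
  have np : nm p != 0 by rewrite nm_eq0.
  have np0 := nm_ge0 p.
  exists (rc (nm p)^-1 * p); rewrite nmM nm_rc ger0_norm ?invr_ge0// mulVf//; split => //.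
  have -> : p + rc rho * (rc (nm p)^-1 * p) = rc (1 + rho / nm p) * p.
    by rewrite (rcD 1) (rcM rho) rc1; ring.
  rewrite nmM nm_rc ger0_norm; last by rewrite addr_ge0// divr_ge0// ltW.
  by rewrite mulrDl mul1r divfK// /rho addrC subrK.
set w := p + rc rho * v in vr.
have dw : disc w by apply/discE; rewrite vr.
apply: le_trans (hM w vr).
apply/ler_addgt0Pr => e e0.
have /continuous_nmP/(_ _ e0)[del del0 hd] := gcont _ dw.
pose t := Num.min 2^-1 (del / 2).
have t0 : 0 < t by rewrite lt_min invr_gt0 ltr0n divr_gt0.
have t1 : t <= 2^-1 by rewrite ge_min lexx.
have t2 : t <= del / 2 by rewrite ge_min lexx orbT.
have dv : disc (rc (1 - t) * v).
  by apply/discE; rewrite nmM v1 mulr1 nm_rc ger0_norm; lra.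
have := cst _ dv; set y := p + _ => gy.
have : nm (y - w) < del.
  rewrite (_ : y - w = - rc (rho * t) * v); last by rewrite /y /w (rcM rho t) (rcB 1 t) rc1; ring.
  rewrite nmM v1 mulr1 nmN nm_rc ger0_norm ?mulr_ge0 ?(ltW rho0) ?(ltW t0)//.
  have : rho <= 1 by rewrite /rho; have := nm_ge0 p; lra.
  by move=> ?; nra.
move=> /hd; rewrite gy; have := nmD (g p - g w) (g w); rewrite subrK; lra.
Qed.

(** The quotient g of f z by z has modulus at most 1 / r on the circle of radius [r], for all [r]
    below 1. If |g(0)| = 1, the maximum of |g| is attained inside and g is constant. *)
Lemma schwarz (f : C -> C) : holomorphic_on (@disc R) f ->
  (forall z, disc z -> disc (f z)) -> f 0 = 0 ->
  nm ('d f 0 1) <= 1 /\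
  (nm ('d f 0 1) = 1 -> forall z, disc z -> f z = 'd f 0 1 * z).
Proof.
move=> hf df f0.
have bf z : disc z -> nm (f z) <= 1 by move=> /df/discE/ltW.
have [g [hg fg g0]] := dslope hf bf f0.
have gr (r : R) : 0 < r -> r < 1 -> forall z, nm z <= r -> nm (g z) <= r^-1.
  move=> r0 r1; apply: max_principle => // z zr.
  have dz : disc z by apply/discE; rewrite zr.
  have := bf z dz; rewrite fg// nmM zr => h.
  by rewrite -[leRHS]mul1r ler_pdivlMr// mulrC.
have g1 z : disc z -> nm (g z) <= 1.
  move=> /discE z1; rewrite leNgt; apply/negP => h.
  (* If |g(z)| exceeded 1, this radius would lie strictly between 1 / |g(z)| and 1 while reaching
     [z], against the bound 1 / r. *)
  pose r := Num.max (nm z) ((1 + (nm (g z))^-1) / 2).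
  have i1 : (nm (g z))^-1 < 1 by rewrite invf_lt1//; apply: lt_trans h.
  have i0 : 0 < (nm (g z))^-1 by rewrite invr_gt0; apply: lt_trans h.
  have r0 : 0 < r by rewrite lt_max; apply/orP; right; lra.
  have r1 : r < 1 by rewrite gt_max z1/=; lra.
  have zr : nm z <= r by rewrite le_max lexx.
  have := gr r r0 r1 z zr; rewrite leNgt => /negP; apply.
  rewrite -[ltRHS]invrK ltf_pV2 ?posrE//.
  by rewrite /r lt_max; apply/orP; right; lra.
rewrite -g0; split; first by apply: g1; exact: disc0.
move=> e z dz; rewrite fg// mulrC; congr (_ * _).
apply: (strong_max (repro_hol hg g1)) => // y dy.
by rewrite e; exact: g1.
Qed.

(** The real mean value theorem on the segment from 0 to [z], for the real and the imaginary
    part. *)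
Lemma zero_derivative (f : C -> C) : (forall z, disc z -> cdiff f z 0 0) ->
  forall z, disc z -> f z = f 0.
Proof.
move=> hf z dz; have /discE z1 := dz.
have seg (P : C -> R) : (forall z, disc z -> rdiff P z 0 0) -> P z = P 0.
  move=> hP; pose phi (t : R) := P (rc t * z).
  have inD (t : R) : 0 <= t <= 1 -> disc (rc t * z).
    move=> /andP[t0 t1]; apply/discE; rewrite nmM nm_rc ger0_norm//.
    by have := nm_ge0 z; nra.
  have dphi (t : R) : 0 <= t <= 1 -> is_derive t 1 phi 0.
    move=> ht.
    have cv : (fun h : R => h^-1 *: ((phi \o shift t) (h *: (1 : R)) - phi t)) @ (0 : R)^' --> (0 : R).
      move=> U /nbhs_ballP[e e0 hU].
      have e2 : 0 < e / 2 by rewrite divr_gt0.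
      have [del del0 hd] := hP _ (inD t ht) _ e2.
      apply/nbhs_ballP; exists del => // h; rewrite -ball_normE /= sub0r normrN => hh h0.
      apply: hU; rewrite -ball_normE /= sub0r normrN.
      have hE : nm (rc (h + t) * z - rc t * z) = `|h| * nm z.
        by rewrite rcD mulrDl addrK nmM nm_rc.
      have hl : `|h| * nm z <= `|h| * 1 by apply: ler_wpM2l => //; exact: ltW.
      have := hd (rc (h + t) * z); rewrite hE !mul0r !subr0.
      have -> : `|h| * nm z < del by lra.
      move=> /(_ isT) h1.
      rewrite /GRing.scale /= mulr1 /phi normrM normfV mulrC ltr_pdivrMr ?normr_gt0//.
      apply: le_lt_trans h1 _; apply: (@le_lt_trans _ _ (e / 2 * (`|h| * 1))).
        by rewrite ler_pM2l.
      by rewrite mulr1 ltr_pM2r ?normr_gt0//; lra.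
    split; first by apply/cvg_ex; exists 0.
    by rewrite /derive; apply: cvg_lim => //; exact: norm_hausdorff.
  have [c _] : exists2 c : R, c \in `]0, 1[%R & phi 1 - phi 0 = 0 * (1 - 0).
    apply: (@MVT R phi (fun=> 0) 0 1 ltr01).
      move=> t; rewrite in_itv/= => /andP[/ltW t0 /ltW t1]; apply: dphi; exact/andP.
    apply: derivable_within_continuous => t; rewrite in_itv/= => ht.
    by have [] := dphi t ht.
  by rewrite mul0r /phi rc1 rc0 mul1r mul0r => /eqP; rewrite subr_eq0 => /eqP.
apply: cx_eq.
- apply: (seg (fun z => re (f z))) => y /hf/cdiff_re.
  by rewrite !reim addr0 subr0.
- apply: (seg (fun z => im (f z))) => y /hf/cdiff_im.
  by rewrite !reim addr0 subr0.
Qed.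

End SchwarzLemma.

(** * Rigidity on one disc *)

Section Moebius.
Variable R : realType.
Local Notation C := (Cx R).

Definition moebius (a x : C) : C := (x - a) / (1 - cj a * x).

Lemma moebius_neq0 (a x : C) : nm a < 1 -> nm x < 1 -> 1 - cj a * x != 0.
Proof.
move=> a1 x1; have ca : nm (cj a) < 1 by rewrite nm_cj.
by have := @tC_neq0 R (cj a) ca (cj x); rewrite nm_cj cjK; apply.
Qed.

Lemma moebius_norm (a x : C) : nm a < 1 -> nm x < 1 ->
  1 - nm (moebius a x) ^+ 2 =
  (1 - nm a ^+ 2) * (1 - nm x ^+ 2) / nm (1 - cj a * x) ^+ 2.
Proof.
move=> a1 x1; have n0 := moebius_neq0 a1 x1.
have n0' : nm (1 - cj a * x) != 0 by rewrite nm_eq0.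
apply: (mulIf (expf_neq0 2 n0')); rewrite divfK ?expf_neq0//.
rewrite /moebius nmM nmV exprMn mulrBl mul1r exprVn divfK ?expf_neq0//.
apply: rcI; rewrite (rcB (nm (1 - cj a * x) ^+ 2)) (rcM (1 - nm a ^+ 2)) !(rcB 1) rc1.
rewrite -!mul_cj !cjB cj1 cjM cjK; ring.
Qed.

Lemma moebius_disc (a x : C) : nm a < 1 -> nm x < 1 -> nm (moebius a x) < 1.
Proof.
move=> a1 x1; have e := moebius_norm a1 x1.
have n0 := moebius_neq0 a1 x1.
have : 0 < 1 - nm (moebius a x) ^+ 2.
  rewrite e divr_gt0// ?exprn_gt0 ?nm_gt0// mulr_gt0//.
    by have /andP[] := @disc_S R a (proj2 (discE a) a1).
  by have /andP[] := @disc_S R x (proj2 (discE x) x1).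
rewrite subr_gt0 => h; rewrite ltNge; apply/negP => h2.
have : 1 <= nm (moebius a x) ^+ 2 by exact: exprn_ege1.
by rewrite leNgt h.
Qed.

Lemma moebius_cdiff (a x : C) : nm a < 1 -> nm x < 1 ->
  cdiff (moebius a) x (rc (1 - nm a ^+ 2) / (1 - cj a * x) ^+ 2) 0.
Proof.
move=> a1 x1; have n0 := moebius_neq0 a1 x1.
have h1 := cdiffD (@cdiff_id R x) (@cdiff_cst R (- a) x).
have h2 : cdiff (fun x => 1 - cj a * x) x (- cj a) 0.
  have h := cdiffD (@cdiff_cst R 1 x) (cdiffM (@cdiff_cst R (- cj a) x) (@cdiff_id R x)).
  rewrite (_ : (fun x => 1 - cj a * x) = (fun x => 1 + - cj a * id x)).
    by apply: cdiff_eq h; ring.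
  by apply/funext => y; rewrite mulNr.
have h3 : cdiff (moebius a) x _ _ := cdiffM h1 (@cdiffV R (fun x => 1 - cj a * x) x _ _ n0 h2).
apply: cdiff_eq h3; last by rewrite !(mul0r, oppr0, mulr0, addr0).
by rewrite rcB rc1 -mul_cj /=; field.
Qed.

Lemma moebiusK (a x : C) : nm a < 1 -> nm x < 1 -> moebius (- a) (moebius a x) = x.
Proof.
move=> a1 x1; have n0 := moebius_neq0 a1 x1.
have a1' : nm (- a) < 1 by rewrite nmN.
have n1 := moebius_neq0 a1' (moebius_disc a1 x1).
apply: (mulIf n1); rewrite [in LHS]/moebius divfK//.
have aa : 1 - a * cj a != 0.
  rewrite mul_cj -rc1 -rcB -nm_gt0 nm_rc gtr0_norm//.
    by have /andP[] := @disc_S R a (proj2 (discE a) a1).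
  by have /andP[] := @disc_S R a (proj2 (discE a) a1).
by rewrite /moebius cjN; field.
Qed.

Lemma moebius_eq0 (a x : C) : nm a < 1 -> nm x < 1 -> moebius a x = 0 -> x = a.
Proof.
move=> a1 x1; have n0 := moebius_neq0 a1 x1.
by move=> /eqP; rewrite /moebius mulf_eq0 invr_eq0 (negbTE n0) orbF subr_eq0 => /eqP.
Qed.

Lemma moebiusE0 (a : C) : moebius a a = 0.
Proof. by rewrite /moebius subrr mul0r. Qed.

(* Invariance of the Poincare metric: the factor squared is moebius a's derivative. *)
Lemma moebius_metric (a x : C) : nm a < 1 -> nm x < 1 ->
  nm (rc (1 - nm a ^+ 2) / (1 - cj a * x) ^+ 2) ^+ 2 / (1 - nm (moebius a x) ^+ 2) ^+ 2 =
  ((1 - nm x ^+ 2) ^+ 2)^-1.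
Proof.
move=> a1 x1; have n0 := moebius_neq0 a1 x1.
have p0 : 0 < nm (1 - cj a * x) by rewrite nm_gt0.
have /andP[sa _] := @disc_S R a (proj2 (discE a) a1).
have /andP[sx _] := @disc_S R x (proj2 (discE x) x1).
rewrite moebius_norm// nmM nmV nmX nm_rc gtr0_norm//.
by field; rewrite !gt_eqF.
Qed.

End Moebius.

Section Rigidity.
Variable R : realType.
Local Notation C := (Cx R).

(* With L the sum of the p k * cj (h k 0) * h k, the hypothesis on the sum says that
   2 * (c - re L) is the sum of the p k times |h k - h k 0|^2 + |h k|^2 ((1 - |q k|^2)^-2 - 1),
   which is nonnegative, while re L 0 = c: the maximum principle makes all terms vanish. *)
Lemma rigid (n : nat) (p : 'I_n -> R) (h q : 'I_n -> C -> C) (B : 'I_n -> R) (c : R) :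
  (forall k, 0 < p k) -> (forall k, repro (B k) (h k)) ->
  (forall k z, disc z -> nm (q k z) < 1) -> (forall k, q k 0 = 0) ->
  (forall z, disc z -> \sum_k p k * (nm (h k z) ^+ 2 / (1 - nm (q k z) ^+ 2) ^+ 2) = c) ->
  forall k z, disc z -> h k z = h k 0 /\ (h k 0 = 0 \/ q k z = 0).
Proof.
move=> p0 rh q1 q0 hc.
pose L (z : C) := \sum_k (rc (p k) * cj (h k 0)) * h k z.
have rL := repro_sum (index_enum 'I_n) (fun k => reproZ (rc (p k) * cj (h k 0)) (rh k)).
have c0 : c = \sum_k p k * nm (h k 0) ^+ 2.
  rewrite -(hc 0 (@disc0 R)); apply: eq_bigr => k _.
  by rewrite q0 nm0 expr0n subr0 expr1n divr1.
have reL (z : C) : re (L z) = \sum_k p k * re (cj (h k 0) * h k z).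
  rewrite /L (big_morph (@re R) (@reD R) (@re0 R)); apply: eq_bigr => k _.
  by rewrite -mulrA reM re_rc im_rc mul0r subr0.
have L0 : re (L 0) = c.
  rewrite reL c0; apply: eq_bigr => k _; congr (_ * _).
  by rewrite mulrC mul_cj re_rc.
pose T k (z : C) := nm (h k z - h k 0) ^+ 2 +
  nm (h k z) ^+ 2 * (((1 - nm (q k z) ^+ 2) ^+ 2)^-1 - 1).
have q2 k (z : C) : disc z -> 1 <= ((1 - nm (q k z) ^+ 2) ^+ 2)^-1.
  move=> dz; have /andP[S0 S1] := @disc_S R (q k z) (proj2 (discE _) (q1 k z dz)).
  by rewrite invf_ge1 ?exprn_gt0// exprn_ile1// ltW.
have T0 k (z : C) : disc z -> 0 <= T k z.
  move=> dz; rewrite addr_ge0 ?sqr_ge0// mulr_ge0 ?sqr_ge0// subr_ge0; exact: q2.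
have TE (z : C) : disc z -> \sum_k p k * T k z = 2 * (c - re (L z)).
  move=> dz; rewrite mulrBr reL [2 * c]mulr_natl mulr2n -{1}(hc z dz) c0 mulr_sumr.
  rewrite -big_split -sumrB; apply: eq_bigr => k _ /=.
  rewrite /T !nm_sqr !reim; ring.
have Lle (z : C) : disc z -> re (L z) <= re (L 0).
  move=> dz; rewrite L0 -subr_ge0 -(@pmulr_rge0 _ 2)// -TE//.
  by apply: sumr_ge0 => k _; rewrite mulr_ge0 ?T0// ltW.
have TZ k (z : C) : disc z -> T k z = 0.
  move=> dz; have e : re (L z) = re (L 0) by exact: (repro_re_max rL Lle dz).
  have /eqP := TE z dz; rewrite e L0 subrr mulr0 psumr_eq0; last first.
    by move=> j _; rewrite mulr_ge0 ?T0// ltW.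
  move=> /allP/(_ k (mem_index_enum _)); rewrite mulf_eq0 gt_eqF//=.
  by move/eqP.
move=> k z dz; have /eqP := TZ k z dz; rewrite /T paddr_eq0 ?sqr_ge0//; last first.
  by rewrite mulr_ge0 ?sqr_ge0// subr_ge0; exact: q2.
rewrite sqrf_eq0 nm_eq0 subr_eq0 => /andP[/eqP hz b]; split=> //; move: b.
rewrite hz mulf_eq0 sqrf_eq0 nm_eq0 => /orP[/eqP ->|]; first by left.
rewrite subr_eq0 => /eqP e; right.
have /andP[S0 S1] := @disc_S R (q k z) (proj2 (discE _) (q1 k z dz)).
set s : R := nm (q k z) ^+ 2 in S0 S1 e.
have e1 : (1 - s) ^+ 2 = 1 by rewrite -[LHS]invrK e invr1.
have : s = 0 by nra.
by move=> /eqP; rewrite sqrf_eq0 nm_eq0 => /eqP.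
Qed.

(* h is a pointwise limit of the difference quotients of G in its second variable. *)
Lemma mixed_repro (G : C -> C -> C) (x0 : C) (h : C -> C) : disc x0 ->
  (forall y x, disc y -> disc x -> nm (G y x) <= 1) ->
  (forall x, disc x -> holomorphic_on (@disc R) (G ^~ x)) ->
  (forall y, disc y -> holomorphic_on (@disc R) (G y)) ->
  (forall y, disc y -> cdiff (G y) x0 (h y) 0) ->
  exists B, repro B h.
Proof.
move=> dx0 bG hy hx hd; have /discE x1 := dx0.
pose r := (1 + nm x0) / 2.
have r1 : r < 1 by rewrite /r; lra.
pose K := 4 * 1 * (1 - r)^-1 ^+ 3.
pose b := (1 - nm x0) / 2.
have b0 : 0 < b by rewrite /b; lra.
have b1 : b <= 1 by rewrite /b; have := nm_ge0 x0; lra.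
(* [b] is half the distance from [x0] to the circle, so that [x0 + rc (ep n)] stays in the disc of
   radius [r]. *)
pose ep n : R := b * n.+1%:R^-1.
have e0 n : 0 < ep n by rewrite mulr_gt0// invr_gt0.
have eb n : ep n <= b by rewrite ger_pMr// invf_le1// ler1n.
have xr n : nm (x0 + rc (ep n)) <= r.
  apply: le_trans (nmD _ _) _; rewrite nm_rc gtr0_norm//.
  by have := eb n; rewrite /b /r; lra.
have dx n : disc (x0 + rc (ep n)) by apply/discE; exact: le_lt_trans (xr n) r1.
pose u n (y : C) := rc (ep n)^-1 * (G y (x0 + rc (ep n)) - G y x0).
have en0 n : rc (ep n) != 0 by rewrite -nm_gt0 nm_rc gtr0_norm.
(* All the [G y] are bounded by 1, so they share a Lipschitz constant on the disc of radius [r]: the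
   difference quotients are bounded uniformly in [n] and [y], as [repro_lim] requires. *)
have ub n (y : C) : disc y -> nm (u n y) <= K.
  move=> dy; have ry := repro_hol (hx y dy) (fun x dx => bG y x dy dx).
  have := repro_lip ry r1 (xr n) (_ : nm x0 <= r).
  rewrite /u nmM rcV nmV nm_rc gtr0_norm// => h1.
  rewrite mulrC ler_pdivrMr//; apply: le_trans (h1 _) _; first by rewrite /r; lra.
  by rewrite addrAC subrr add0r nm_rc gtr0_norm.
exists K; apply: (repro_lim (u_ := u)).
  move=> n; apply: repro_hol => [y dy|y dy]; last exact: ub.
  have h1 := hol_cdiff (hy _ (dx n)) dy; have h2 := hol_cdiff (hy _ dx0) dy.
  have h3 := cdiffM (@cdiff_cst R (rc (ep n)^-1) y) (cdiffD h1 (cdiffM (@cdiff_cst R (-1) y) h2)).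
  have [a ha] : exists a, cdiff (u n) y a 0.
    rewrite (_ : u n = fun y => rc (ep n)^-1 * (G y (x0 + rc (ep n)) + -1 * G y x0)).
      by eexists; apply: cdiff_eq h3; [reflexivity|rewrite !(mulr0, mul0r, addr0)].
    by apply/funext => v; rewrite mulN1r.
  by have [] := cdiff_derive ha.
move=> y dy; apply/cvgrPdist_lt => e ee0.
have ee2 : 0 < e / 2 by rewrite divr_gt0.
have [del del0 hdel] := hd y dy _ ee2.
have /cvgrPdist_lt/(_ _ del0) := @cvg_harmonic R.
apply: filterS => n; rewrite sub0r normrN /harmonic /= ger0_norm ?invr_ge0// => hn.
rewrite sub0r normrN ger0_norm ?nm_ge0//.
have := hdel (x0 + rc (ep n)).
have -> : x0 + rc (ep n) - x0 = rc (ep n) by rewrite addrAC subrr add0r.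
rewrite nm_rc gtr0_norm//.
have -> : ep n < del.
  apply: le_lt_trans hn; rewrite /ep -[leRHS]mul1r.
  apply: (@ler_wpM2r R n.+1%:R^-1); last exact: b1.
  by rewrite invr_ge0 ler0n.
move=> /(_ isT); rewrite mul0r subr0 => h1.
rewrite /u (_ : _ - h y = rc (ep n)^-1 * (G y (x0 + rc (ep n)) - G y x0 - h y * rc (ep n))).
  rewrite nmM rcV nmV nm_rc gtr0_norm// mulrC ltr_pdivrMr//.
  by apply: le_lt_trans h1 _; rewrite ltr_pM2r//; lra.
rewrite rcV; have := en0 n; move: (rc (ep n)) => s s0; field; exact: s0.
Qed.

End Rigidity.

(** * Maps between polydiscs *)

Section Coordinates.
Variable R : realType.
Local Notation C := (Cx R).

Lemma is_diff_coord n (M : 'rV[C]_n) (k : 'I_n) :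
  is_diff M (fun N : 'rV[C]_n => N 0 k : C) (fun N => N 0 k).
Proof.
have lin : linear (fun N : 'rV[C]_n => N 0 k : C) by move=> a u v; rewrite !mxE.
pose lM := GRing.isLinear.Build _ _ _ _ _ lin.
pose l : {linear _ -> _} := HB.pack (fun N : 'rV[C]_n => N 0 k : C) lM.
have cl : continuous l by exact: coord_continuous.
apply: DiffDef; first exact: (@linear_differentiable _ _ _ l).
exact: (@diff_lin _ _ _ l).
Qed.

Lemma differentiable_row m n (F : 'rV[C]_m -> 'rV[C]_n) z :
  (forall k, differentiable (fun z => F z 0 k : C) z) -> differentiable F z.
Proof.
move=> h; rewrite (_ : F = \sum_k (fun z => (F z 0 k : C) *: delta_mx 0 k)).
  by apply: differentiable_sum => k; exact: differentiableZl.
by apply/funext => x; rewrite fct_sumE [LHS]row_sum_delta.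
Qed.

Lemma diff_row m n (F : 'rV[C]_m -> 'rV[C]_n) z u k : differentiable F z ->
  ('d F z u) 0 k = 'd (fun z => F z 0 k : C) z u.
Proof.
move=> dF; have h := is_diff_coord (F z) k.
have e := diff_comp dF (@ex_diff _ _ _ _ _ _ _ h).
by rewrite (_ : (fun z => _) = (fun N : 'rV[C]_n => N 0 k : C) \o F)// e /= diff_val.
Qed.

Definition upd m (z : 'rV[C]_m) (i : 'I_m) (t : C) : 'rV[C]_m :=
  \row_l if l == i then t else z 0 l.

Lemma updE m (z : 'rV[C]_m) i t l : upd z i t 0 l = if l == i then t else z 0 l.
Proof. by rewrite mxE. Qed.

Lemma upd_affine m (z : 'rV[C]_m) i t :
  upd z i t = (z - z 0 i *: delta_mx 0 i) + t *: delta_mx 0 i.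
Proof.
apply/rowP => l; rewrite !mxE eqxx /=; case: eqP => [->|_].
  by rewrite mulr1 subrr add0r mulr1.
by rewrite !mulr0 subr0 addr0.
Qed.

Lemma upd_id m (z : 'rV[C]_m) i : upd z i (z 0 i) = z.
Proof. by apply/rowP => l; rewrite updE; case: eqP => [->|]. Qed.

Lemma updC m (z : 'rV[C]_m) i j s t : i != j -> upd (upd z i s) j t = upd (upd z j t) i s.
Proof.
move=> ij; apply/rowP => l; rewrite !updE.
by case: eqP => [->|//]; rewrite eq_sym (negbTE ij).
Qed.

Lemma upd_polydisc m (z : 'rV[C]_m) i t : polydisc z -> disc t -> polydisc (upd z i t).
Proof. by move=> hz ht l; rewrite updE; case: eqP. Qed.

Lemma cdiff_upd m n (f : 'rV[C]_m -> 'rV[C]_n) z i t k : differentiable f (upd z i t) ->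
  cdiff (fun t => f (upd z i t) 0 k) t (('d f (upd z i t) (delta_mx 0 i)) 0 k) 0.
Proof.
move=> df.
have du : is_diff t (upd z i) (fun s => s *: delta_mx 0 i).
  have h1 : is_diff t (cst (z - z 0 i *: delta_mx 0 i)) 0 by exact: is_diff_cst.
  have h2 : is_diff t (fun s : C => s *: delta_mx 0 i : 'rV[C]_m) (fun s : C => s *: delta_mx 0 i).
    exact: is_diff_scalel.
  rewrite (_ : upd z i = cst (z - z 0 i *: delta_mx 0 i) + (fun s : C => s *: delta_mx 0 i)).
    by apply: is_diff_eq (is_diffD h1 h2) _; apply/funext => s; rewrite fctE add0r.
  by apply/funext => s; rewrite upd_affine.
have dfu := differentiable_comp (@ex_diff _ _ _ _ _ _ _ du) df.
have h := is_diff_coord (f (upd z i t)) k.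
have dg := differentiable_comp dfu (@ex_diff _ _ _ _ _ _ _ h).
have := diff_cdiff dg; apply: cdiff_eq => //.
rewrite (diff_comp dfu (@ex_diff _ _ _ _ _ _ _ h)) /= diff_val.
by rewrite (diff_comp (@ex_diff _ _ _ _ _ _ _ du) df) /= diff_val scale1r.
Qed.

(* Telescoping through the vectors that agree with w on the coordinates of s. *)
Lemma upd_invariant m (T : Type) (i : 'I_m) (P : 'rV[C]_m -> T) :
  (forall z j t, j != i -> polydisc z -> disc t -> P (upd z j t) = P z) ->
  forall z w, polydisc z -> polydisc w -> z 0 i = w 0 i -> P z = P w.
Proof.
move=> h z w pz pw zw.
pose v (s : seq 'I_m) : 'rV[C]_m := \row_l if l \in s then w 0 l else z 0 l.
have pv s : polydisc (v s) by move=> l; rewrite mxE; case: ifP.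
have -> : z = v [::] by apply/rowP => l; rewrite mxE.
have -> : w = v (enum 'I_m) by apply/rowP => l; rewrite mxE mem_enum.
elim: (enum 'I_m) => // j s ->.
have -> : v (j :: s) = upd (v s) j (w 0 j).
  by apply/rowP => l; rewrite updE !mxE inE; case: eqP => [->|].
have [->|ji] := eqVneq j i; last by apply/esym/h.
have -> : w 0 i = v s 0 i by rewrite mxE -zw; case: ifP.
by rewrite upd_id.
Qed.

End Coordinates.

(** * Partial derivatives of an isometry and separation of variables *)

Section Isometry.
Variable R : realType.
Local Notation C := (Cx R).

Lemma cdiff_comp (F G : C -> C) (z a b : C) : cdiff F z a 0 -> cdiff G (F z) b 0 ->
  cdiff (G \o F) z (b * a) 0.
Proof.
move=> /cdiff_derive[dF eF] /cdiff_derive[dG eG].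
have dGF := differentiable_comp dF dG.
have e : 'd (G \o F) z 1 = b * a.
  rewrite -eG -eF [RHS]mulrC -diff_scal.
  by have := congr1 (fun l => l 1) (diff_comp dF dG).
by rewrite -e; exact: diff_cdiff dGF.
Qed.

Lemma metric_term e (z a : C) : disc z ->
  bergman_metric e z * a * (a^*)%R = rc ((2 * e.+1)%:R * (nm a ^+ 2 / (1 - nm z ^+ 2) ^+ 2)).
Proof.
move=> dz; rewrite bergman_metricE// -mulrA [a * _]mul_cj /sC.
rewrite (rcM (2 * e.+1)%:R) rcn (rcM (nm a ^+ 2)) rcV (rcX (1 - nm z ^+ 2)).
by rewrite -mulrA [_^-1 * _]mulrC.
Qed.

Variables (m n : nat) (c : 'I_m -> nat) (d : 'I_n -> nat).
Variable f : 'rV[C]_m -> 'rV[C]_n.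
Hypothesis f_iso : holomorphic_isometry c d f.

Definition partial (k : 'I_n) (i : 'I_m) (z : 'rV[C]_m) : C := ('d f z (delta_mx 0 i)) 0 k.

Lemma iso_nm z k : polydisc z -> nm (f z 0 k) < 1.
Proof. by move=> pz; apply/discE; have [h _ _] := f_iso; exact: h. Qed.

Lemma iso_norm z i : polydisc z ->
  \sum_k (2 * (d k).+1)%:R * (nm (partial k i z) ^+ 2 / (1 - nm (f z 0 k) ^+ 2) ^+ 2) =
  (2 * (c i).+1)%:R / (1 - nm (z 0 i) ^+ 2) ^+ 2.
Proof.
move=> pz; have [fd _ fm] := f_iso.
have := fm z (delta_mx 0 i) (delta_mx 0 i) pz; rewrite /product_metric => e.
apply: rcI; rewrite (big_morph (@rc R) (@rcD R) (@rc0 R)).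
transitivity (\sum_k bergman_metric (d k) (f z 0 k) *
    ('d f z (delta_mx 0 i)) 0 k * ((('d f z (delta_mx 0 i)) 0 k)^*)%R).
  by apply: eq_bigr => k _; rewrite metric_term//; exact: fd.
rewrite e (bigD1 i)//= big1 => [|l li]; last first.
  by rewrite mxE eqxx (negbTE li) /= mulr0 mul0r.
by rewrite addr0 metric_term// mxE !eqxx /= nm1 expr1n mul1r.
Qed.

Lemma cdiff_partial z i t k : polydisc (upd z i t) ->
  cdiff (fun t => f (upd z i t) 0 k) t (partial k i (upd z i t)) 0.
Proof. by have [_ h _] := f_iso => pz; apply: cdiff_upd; exact: h. Qed.

(** [rigid] is applied in the variable y = z_j to the derivatives in z_i of the normalised
    components. The factor [M] that the Moebius map brings into them varies with [y] and has to be
    removed afterwards. *)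
Lemma partial_rigid z i j k t : i != j -> polydisc z -> disc t ->
  partial k i (upd z j t) = partial k i (upd z j 0) /\
  (partial k i (upd z j 0) = 0 \/ f (upd z j t) 0 k = f (upd z j 0) 0 k).
Proof.
move=> ij pz dt.
have pu y : disc y -> polydisc (upd z j y) by exact: upd_polydisc.
have d0 := @disc0 R.
pose a k := f (upd z j 0) 0 k.
have a1 l : nm (a l) < 1 by apply: iso_nm; exact: pu.
pose M l y := rc (1 - nm (a l) ^+ 2) / (1 - cj (a l) * f (upd z j y) 0 l) ^+ 2.
pose q l y := moebius (a l) (f (upd z j y) 0 l).
pose h l y := M l y * partial l i (upd z j y).
have M0 l y : disc y -> M l y != 0.
  move=> dy; rewrite mulf_neq0 ?invr_eq0 ?expf_neq0//.
    have /andP[S0 _] := @disc_S R (a l) (proj2 (discE _) (a1 l)).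
    by rewrite -nm_gt0 nm_rc gtr0_norm.
  by apply: moebius_neq0 => //; apply: iso_nm; exact: pu.
(* [h l] is a derivative in x = z_i of [G], which is bounded and holomorphic in each of [y] and [x]
   separately, as [mixed_repro] asks. *)
have rh : forall l, exists B, repro B (h l).
  move=> l.
  pose G y x := moebius (a l) (f (upd (upd z j y) i x) 0 l).
  have pG y x : disc y -> disc x -> polydisc (upd (upd z j y) i x).
    by move=> dy dx; apply: upd_polydisc => //; exact: pu.
  apply: (@mixed_repro R G (z 0 i) (h l)).
  - exact: pz.
  - by move=> y x dy dx; apply: ltW; apply: moebius_disc => //; apply: iso_nm; exact: pG.
  - move=> x dx; apply: cdiff_hol => y dy; eexists.
    rewrite (_ : G^~ x = moebius (a l) \o (fun y => f (upd (upd z i x) j y) 0 l)); last first.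
      by apply/funext => v; rewrite /G /= updC// eq_sym.
    have px : polydisc (upd (upd z i x) j y) by apply: upd_polydisc => //; exact: upd_polydisc.
    exact: (cdiff_comp (cdiff_partial l px) (moebius_cdiff (a1 l) (iso_nm l px))).
  - move=> y dy; apply: cdiff_hol => x dx; have p := pG _ _ dy dx; eexists.
    exact: (cdiff_comp (cdiff_partial l p) (moebius_cdiff (a1 l) (iso_nm l p))).
  - move=> y dy.
    have p := pG _ _ dy (pz i).
    have := cdiff_comp (cdiff_partial l p) (moebius_cdiff (a1 l) (iso_nm l p)).
    have -> : upd (upd z j y) i (z 0 i) = upd z j y.
      by rewrite -[in RHS](upd_id (upd z j y) i) updE (negbTE ij).
    by [].
have [B hB] := choice rh.
(* Varying z_j leaves z_i fixed, so the right-hand side of [iso_norm] is constant; Moebius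
   invariance of the metric replaces the components by the normalised ones. *)
have hc y : disc y -> \sum_l (2 * (d l).+1)%:R * (nm (h l y) ^+ 2 / (1 - nm (q l y) ^+ 2) ^+ 2) =
    (2 * (c i).+1)%:R / (1 - nm (z 0 i) ^+ 2) ^+ 2.
  move=> dy; have := iso_norm i (pu y dy); rewrite updE (negbTE ij) => <-.
  apply: eq_bigr => l _; congr (_ * _).
  have e := moebius_metric (a1 l) (iso_nm l (pu y dy)).
  by rewrite -e /h nmM exprMn mulrAC [RHS]mulrC.
have pos l : (0 : R) < (2 * (d l).+1)%:R by rewrite ltr0n.
have [||e1 e2] := rigid pos hB _ _ hc k dt.
- by move=> l y dy; apply: moebius_disc => //; apply: iso_nm; exact: pu.
- by move=> l; exact: moebiusE0.
(* If [h k] vanishes, so does the partial derivative, as [M] is nonzero. Otherwise the component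
   takes the same value at [t] and at 0, hence so does [M], which cancels. *)
case: e2 => e2.
  have hp (y : C) : disc y -> h k y = 0 -> partial k i (upd z j y) = 0.
    by move=> dy /eqP; rewrite mulf_eq0 (negbTE (M0 k y dy)) => /eqP.
  have pk0 := hp 0 d0 e2.
  have pkt := hp t dt (etrans e1 e2).
  by split; [exact: etrans pkt (esym pk0)|left; exact: pk0].
have e3 : f (upd z j t) 0 k = f (upd z j 0) 0 k.
  exact: (moebius_eq0 (a1 k) (iso_nm k (pu t dt)) e2).
split; [|by right; exact: e3].
apply: (mulfI (M0 k 0 d0)).
have e4 : M k t = M k 0 by rewrite /M e3.
by rewrite -{1}e4; exact: e1.
Qed.

Lemma partial_dep i k z w : polydisc z -> polydisc w -> z 0 i = w 0 i ->
  partial k i z = partial k i w /\ (partial k i z = 0 \/ f z 0 k = f w 0 k).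
Proof.
move=> pz pw zw.
(* tag forgets f z 0 k exactly where the partial derivative vanishes, which turns the
   alternative into an equation. *)
pose tag (a u : C) := (a, if a == 0 then 0 else u).
have tagP a b u v : tag a u = tag b v <-> a = b /\ (a = 0 \/ u = v).
  split; last first.
    by move=> [<-]; rewrite /tag; case: eqP => // na [/na|->].
  by rewrite /tag => -[<-]; case: eqP => [->|_ ->]; split=> //; [left|right].
apply/tagP; apply: (upd_invariant (P := fun z => tag (partial k i z) (f z 0 k)) _ pz pw zw).
move=> {pz pw zw z w} z j t ji pz dt; rewrite eq_sym in ji.
have [e1 e2] := partial_rigid k ji pz dt.
have [e3 e4] := partial_rigid k ji pz (pz j).
have zE := esym (upd_id z j).
have fE := congr1 (fun v => f v 0 k) zE.
have e : partial k i (upd z j t) = partial k i z.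
  by rewrite [LHS]e1 -[LHS]e3; exact: (congr1 (partial k i) (esym zE)).
apply: (proj2 (tagP _ _ _ _)).
split; first exact: e.
case: e2 => e2; first by left; exact: etrans e1 e2.
by case: e4 => e4; [left; exact: etrans e1 e4|right; exact: etrans e2 (etrans (esym e4) (esym fE))].
Qed.

(** For [z] and [w] moved together along the i-th axis, the difference of the two values of f_k has
    derivative 0. It vanishes when the i-th coordinate is that of [p], where the nonzero derivative
    determines f_k. *)
Lemma component_dep i k p : polydisc p -> partial k i p != 0 ->
  depends_only_on i (fun z => f z 0 k).
Proof.
move=> pp np z w pz pw zw.
have ui (v u : 'rV[C]_m) (y : C) : upd v i y 0 i = upd u i y 0 i by rewrite !updE eqxx.
pose F t := f (upd z i t) 0 k + -1 * f (upd w i t) 0 k.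
have opp (a b x : C) : a = b -> a + (0 * x + -1 * b) = 0 by move=> ->; ring.
have opp0 (x y : C) : 0 + (0 * x + y * 0) = 0 by ring.
have F0 t : disc t -> F t = F 0.
  apply: zero_derivative => y dy.
  have pzy := upd_polydisc i pz dy; have pwy := upd_polydisc i pw dy.
  have h := cdiffD (cdiff_partial k pzy)
    (cdiffM (@cdiff_cst R (-1) y) (cdiff_partial k pwy)).
  have [e _] := partial_dep k pzy pwy (ui z w y).
  exact: (cdiff_eq (opp _ _ _ e) (opp0 _ _) h).
have e : f (upd z i (p 0 i)) 0 k = f (upd w i (p 0 i)) 0 k.
  have pz' := upd_polydisc i pz (pp i); have pw' := upd_polydisc i pw (pp i).
  have [_ [h|//]] := partial_dep k pz' pw' (ui z w (p 0 i)).
  have pzi : p 0 i = upd z i (p 0 i) 0 i by rewrite updE eqxx.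
  have [h2 _] := partial_dep k pp pz' pzi.
  by move: np; rewrite (etrans h2 h) eqxx.
have : F (z 0 i) = 0 by rewrite (F0 _ (pz i)) -(F0 _ (pp i)) /F e mulN1r subrr.
by rewrite /F upd_id zw upd_id mulN1r => /eqP; rewrite subr_eq0 => /eqP.
Qed.

Lemma component_cst k : (forall i z, polydisc z -> partial k i z = 0) ->
  forall i, depends_only_on i (fun z => f z 0 k).
Proof.
move=> h i; apply: upd_invariant => z j t _ pz dt.
have F0 y : disc y -> f (upd z j y) 0 k = f (upd z j 0) 0 k.
  apply: (@zero_derivative R (fun y => f (upd z j y) 0 k)) => v dv.
  by have := cdiff_partial k (upd_polydisc j pz dv); rewrite h//; exact: upd_polydisc.
by rewrite F0// -(F0 _ (pz j)) upd_id.
Qed.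

Lemma partial_eq0 i j k z : i != j -> depends_only_on i (fun z => f z 0 k) ->
  polydisc z -> partial k j z = 0.
Proof.
move=> ij dep pz.
have := @cdiff_partial z j (z 0 j) k; rewrite !upd_id => /(_ pz).
have h : \forall t \near (z 0 j), f (upd z j t) 0 k = f z 0 k.
  have := open_nbhs_nbhs (conj (@open_disc R) (pz j)).
  apply: filterS => t dt; apply: dep => //; first exact: upd_polydisc.
  by rewrite updE (negbTE ij).
move=> /(cdiff_near h)/cdiff_derive[_ <-].
by have [_ ->] := cdiff_derive (@cdiff_cst R (f z 0 k) (z 0 j)).
Qed.

(** A component all of whose partial derivatives vanish is constant and may be given to any
    variable. Every variable owns a component because the right-hand side of [iso_norm] is
    nonzero. *)
Lemma owner_exists : (0 < m)%N -> exists s : 'I_n -> 'I_m,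
  [/\ forall k, depends_only_on (s k) (fun z => f z 0 k),
      forall k i z, s k != i -> polydisc z -> partial k i z = 0
    & forall i, exists k, s k = i].
Proof.
move=> m0.
have /choice[s hs] : forall k, exists i, depends_only_on i (fun z => f z 0 k).
  move=> k; have [[i [p [pp np]]]|H] := pselect (exists i p, polydisc p /\ partial k i p != 0).
    by exists i; exact: component_dep np.
  exists (Ordinal m0); apply: component_cst => i z pz; apply: contra_notP H => /eqP h.
  by exists i, z.
exists s; have h0 k i z : s k != i -> polydisc z -> partial k i z = 0.
  by move=> ski; exact: (partial_eq0 ski (hs k)).
split=> // i; apply: contrapT => H.
have p0 : @polydisc R m 0 by move=> l; rewrite mxE; exact: disc0.
have := iso_norm i p0; rewrite big1 => [|k _]; last first.
  by rewrite h0 ?nm0 ?expr0n ?mul0r ?mulr0//; apply/eqP => e; apply: H; exists k.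
move=> /eqP; rewrite mxE nm0 expr0n subr0 expr1n divr1 eq_sym pnatr_eq0.
by [].
Qed.

End Isometry.

(** * Components along a coordinate axis, and the inequality *)

Section Slices.
Variable R : realType.
Local Notation C := (Cx R).

(** In one variable a tangent vector is a multiple of 1, so the Hermitian form is determined by the
    squared norm of 1. *)
Lemma row_isometry N e (d : 'I_N -> nat) (G : 'I_N -> C -> C) (F : 'rV[C]_1 -> 'rV[C]_N) :
  (forall j t, disc t -> disc (G j t)) -> (forall j, holomorphic_on (@disc R) (G j)) ->
  (forall t, disc t ->
    \sum_j (2 * (d j).+1)%:R * (nm ('d (G j) t 1) ^+ 2 / (1 - nm (G j t) ^+ 2) ^+ 2) =
    (2 * e.+1)%:R / (1 - nm t ^+ 2) ^+ 2) ->
  (forall v j, F v 0 j = G j (v 0 0)) ->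
  holomorphic_isometry (fun _ : 'I_1 => e) d F.
Proof.
move=> GD Gh Gm FE.
have dG (v : 'rV[C]_1) j : disc (v 0 0) -> differentiable (fun v => F v 0 j) v /\
    forall u, 'd (fun v => F v 0 j) v u = u 0 0 * 'd (G j) (v 0 0) 1.
  move=> dv; have dGj := Gh j _ dv; have h := is_diff_coord v (0 : 'I_1).
  have dc := @ex_diff _ _ _ _ _ _ _ h.
  have -> : (fun v => F v 0 j) = G j \o (fun v : 'rV[C]_1 => v 0 0 : C).
    by apply/funext => w; rewrite FE.
  split; first exact: differentiable_comp.
  move=> u; have := congr1 (fun l => l u) (diff_comp dc dGj) => /= ->.
  by rewrite diff_val diff_scal.
have dF (v : 'rV[C]_1) : polydisc v -> differentiable F v.
  by move=> pv; apply: differentiable_row => k; have [] := dG v k (pv 0).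
split=> [v pv j|v|v u w pv]; [by rewrite FE; exact: GD|exact: dF|].
have dt := pv 0; have t1 := Gm _ dt; have Fv := dF v pv.
rewrite /product_metric big_ord1.
transitivity (\sum_j bergman_metric (d j) (G j (v 0 0)) * 'd (G j) (v 0 0) 1 *
    (('d (G j) (v 0 0) 1)^*)%R * (u 0 0 * ((w 0 0)^*)%R)).
  apply: eq_bigr => j _; have [_ dFj] := dG v j dt.
  by rewrite !diff_row// !dFj FE rmorphM /=; ring.
rewrite -mulr_suml -mulrA; congr (_ * _).
transitivity (rc (\sum_j (2 * (d j).+1)%:R *
    (nm ('d (G j) (v 0 0) 1) ^+ 2 / (1 - nm (G j (v 0 0)) ^+ 2) ^+ 2))).
  rewrite (big_morph (@rc R) (@rcD R) (@rc0 R)); apply: eq_bigr => j _.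
  by rewrite metric_term//; exact: GD.
by rewrite t1 bergman_metricE// /sC (rcM (2 * e.+1)%:R) rcn rcV (rcX (1 - _)).
Qed.

Lemma schwarz_linear (G : C -> C) : holomorphic_on (@disc R) G ->
  (forall t, disc t -> disc (G t)) -> G 0 = 0 ->
  nm ('d G 0 1) = 1 <-> exists a : C, nm a = 1 /\ forall t, disc t -> G t = a * t.
Proof.
move=> hG GD G0; have [_ h] := schwarz hG GD G0; split.
  by move=> e; exists ('d G 0 1); split=> //; exact: h.
move=> [a [a1 ha]].
have h1 := cdiffM (@cdiff_cst R a 0) (@cdiff_id R 0).
have nr : \forall t \near (0 : C), a * id t = G t.
  have := open_nbhs_nbhs (conj (@open_disc R) (@disc0 R)).
  by apply: filterS => t dt; rewrite ha.
have [_ ->] : differentiable G 0 /\ 'd G 0 1 = a.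
  apply: cdiff_derive; apply: cdiff_eq (cdiff_near nr h1); first by rewrite mul0r add0r mulr1.
  by rewrite mul0r add0r mulr0.
exact: a1.
Qed.

Variables (m n : nat) (c : 'I_m -> nat) (d : 'I_n -> nat).
Variable f : 'rV[C]_m -> 'rV[C]_n.
Hypothesis f_iso : holomorphic_isometry c d f.

(** Normalised to vanish at 0 by the very automorphism that serves as reparametrization, so that the
    Schwarz lemma applies. *)
Definition slice (k : 'I_n) (i : 'I_m) (t : C) : C := moebius (f 0 0 k) (f (upd 0 i t) 0 k).

Lemma polydisc0 : polydisc (0 : 'rV[C]_m).
Proof. by move=> l; rewrite mxE; exact: disc0. Qed.

Lemma slice_polydisc i t : disc t -> polydisc (upd (0 : 'rV[C]_m) i t).
Proof. by apply: upd_polydisc; exact: polydisc0. Qed.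

Lemma slice_disc k i t : disc t -> disc (slice k i t).
Proof.
move=> dt; apply/discE; apply: moebius_disc; apply: (iso_nm f_iso) => //.
  exact: polydisc0.
exact: slice_polydisc.
Qed.

Lemma slice0 k i : slice k i 0 = 0.
Proof.
rewrite /slice (_ : upd 0 i 0 = 0) ?moebiusE0//.
by apply/rowP => l; rewrite updE mxE; case: eqP.
Qed.

Lemma slice_diff k i t : disc t ->
  differentiable (slice k i) t /\ 'd (slice k i) t 1 =
    rc (1 - nm (f 0 0 k) ^+ 2) / (1 - cj (f 0 0 k) * f (upd 0 i t) 0 k) ^+ 2 *
    partial f k i (upd 0 i t).
Proof.
move=> dt; have pt := slice_polydisc i dt; apply: cdiff_derive.
exact: (cdiff_comp (cdiff_partial f_iso k pt)
  (moebius_cdiff (iso_nm f_iso k polydisc0) (iso_nm f_iso k pt))).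
Qed.

Variables (B : {set 'I_n}) (i : 'I_m).
Hypothesis hB : forall k z, k \notin B -> polydisc z -> partial f k i z = 0.

Lemma slice_metric t : disc t ->
  \sum_(k in B) (2 * (d k).+1)%:R *
    (nm ('d (slice k i) t 1) ^+ 2 / (1 - nm (slice k i t) ^+ 2) ^+ 2) =
  (2 * (c i).+1)%:R / (1 - nm t ^+ 2) ^+ 2.
Proof.
move=> dt; have pt := slice_polydisc i dt.
have := iso_norm f_iso i pt; rewrite updE eqxx => <-.
rewrite [RHS](bigID (mem B))/= [X in _ = _ + X]big1 => [|k kB]; last first.
  by rewrite hB// nm0 expr0n mul0r mulr0.
rewrite addr0; apply: eq_bigr => k _; congr (_ * _).
have [_ ->] := slice_diff k i dt.
have e := moebius_metric (iso_nm f_iso k polydisc0) (iso_nm f_iso k pt).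
by rewrite -e nmM exprMn mulrAC [RHS]mulrC.
Qed.

(** [slice_metric] at the origin, where all denominators are 1, divided by 2. *)
Lemma slice_degree : \sum_(k in B) (d k).+1%:R * nm ('d (slice k i) 0 1) ^+ 2 = (c i).+1%:R.
Proof.
have two : (2 : R) != 0 by rewrite pnatr_eq0.
apply: (mulfI two); have := slice_metric (@disc0 R).
rewrite nm0 expr0n subr0 expr1n divr1 natrM => <-; rewrite mulr_sumr; apply: eq_bigr => k _.
by rewrite slice0 nm0 expr0n subr0 expr1n divr1 natrM mulrA.
Qed.

Lemma slice_schwarz k : nm ('d (slice k i) 0 1) <= 1.
Proof.
have hol : holomorphic_on (@disc R) (slice k i).
  by move=> t dt; have [] := slice_diff k i dt.
by have [] := schwarz hol (@slice_disc k i) (slice0 k i).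
Qed.

Lemma slice_term k : (d k).+1%:R * nm ('d (slice k i) 0 1) ^+ 2 <= (d k).+1%:R.
Proof.
rewrite -[leRHS]mulr1 ler_wpM2l// exprn_ile1// ?nm_ge0//; exact: slice_schwarz.
Qed.

Lemma degree_le : ((c i).+1 <= \sum_(k in B) (d k).+1)%N.
Proof.
rewrite -(ler_nat R) -slice_degree natr_sum; apply: ler_sum => k _; exact: slice_term.
Qed.

(** The difference of the two sides is a sum of nonnegative terms, one for each component of [B],
    with positive factor [(d k).+1]. *)
Lemma degree_eq : (c i).+1 = (\sum_(k in B) (d k).+1)%N <->
  (forall k, k \in B -> nm ('d (slice k i) 0 1) = 1).
Proof.
split=> [e k kB|h]; last first.
  apply/eqP; rewrite -(eqr_nat R) -slice_degree natr_sum; apply/eqP; apply: eq_bigr => k kB.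
  by rewrite h// expr1n mulr1.
have : \sum_(k in B) ((d k).+1%:R - (d k).+1%:R * nm ('d (slice k i) 0 1) ^+ 2) = 0 :> R.
  by rewrite sumrB slice_degree e natr_sum subrr.
move=> /eqP; rewrite psumr_eq0 => [|l _]; last by rewrite subr_ge0; exact: slice_term.
move=> /allP/(_ k (mem_index_enum _))/implyP/(_ kB).
rewrite -{1}[_%:R]mulr1 -mulrBr mulf_eq0 pnatr_eq0/= subr_eq0 eq_sym => h.
by apply/eqP; rewrite -(@eqrXn2 _ 2)// ?nm_ge0// expr1n.
Qed.

End Slices.

(** * Grouping of the components into blocks, and conclusion *)

Lemma block_perm m n (own : 'I_n -> 'I_m) :
  exists (psum : (\sum_i #|[set k | own k == i]%SET| = n)%N) (s : 'S_n),
    forall i (j : 'I_#|[set k | own k == i]%SET|), s (block_index psum j) = enum_val j.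
Proof.
have psum : (\sum_i #|[set k | own k == i]%SET| = n)%N.
  rewrite -[RHS]card_ord -sum1_card (partition_big own xpredT)//=.
  by apply: eq_bigr => i _; rewrite -sum1dep_card.
(* Pairs of a variable and a rank in its fibre index both the components, by [E], and the
   consecutive positions, by [tagnat]; composing the two enumerations gives the permutation. *)
pose E (q : {i & 'I_#|[set k | own k == i]%SET|}) := enum_val (tagged q).
have EP q : own (E q) = tag q by have := enum_valP (tagged q); rewrite inE => /eqP.
have E_inj : injective E.
  move=> q q' e; have := EP q; rewrite e EP; move: e; rewrite /E.
  by case: q q' => i j [i' j'] /= e ii; subst i'; rewrite (enum_val_inj e).
pose F x := E (tagnat.sig (cast_ord (esym psum) x)).
have F_inj : injective F.
  by move=> x y /E_inj /(can_inj (@tagnat.sigK _ _)) /cast_ord_inj.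
exists psum, (perm F_inj) => i j.
by rewrite permE /F /block_index cast_ordK tagnat.rankK.
Qed.

Lemma disc_automorphism_id (R : realType) : disc_automorphism (@id (Cx R)).
Proof.
exists id; split=> // z dz; have [] // := cdiff_derive (@cdiff_id R z).
Qed.

Lemma disc_automorphism_moebius (R : realType) (a : Cx R) : disc a ->
  disc_automorphism (moebius a).
Proof.
move=> /discE a1; have a1' : nm (- a) < 1 by rewrite nmN.
exists (moebius (- a)); split=> z /discE z1.
- by have [] := cdiff_derive (moebius_cdiff a1 z1).
- by have [] := cdiff_derive (moebius_cdiff a1' z1).
- by split; [apply/discE; exact: moebius_disc|exact: moebiusK].
- split; first by apply/discE; exact: moebius_disc.
  by have := moebiusK a1' z1; rewrite opprK.
Qed.

Theorem theorem1p5 (R : realType) (m n : nat) (m_gt0 : (0 < m)%N) (n_gt0 : (0 < n)%N)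
    (c : 'I_m -> nat) (d : 'I_n -> nat)
    (f : 'rV[Cx R]_m -> 'rV[Cx R]_n) (f_iso : holomorphic_isometry c d f) :
  exists (phi : 'I_m -> Cx R -> Cx R) (psi : 'I_n -> Cx R -> Cx R) (s : 'S_n),
    [/\ forall i, disc_automorphism (phi i),
        forall k, disc_automorphism (psi k)
      & let g := reparam phi psi s f in
        let d' := fun k => d (s k) in
        exists (p : 'I_m -> nat) (psum : (\sum_i p i)%N = n),
          (forall i, (0 < p i)%N) /\
          (forall i,
            [/\ forall j : 'I_(p i),
                  depends_only_on i (fun z => g z 0 (block_index psum j)),
                holomorphic_isometry (fun _ : 'I_1 => c i)
                  (fun j : 'I_(p i) => d' (block_index psum j))
                  (block_map psum i g),
                ((c i).+1 <= \sum_(j < p i) (d' (block_index psum j)).+1)%N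
              & ((c i).+1 = \sum_(j < p i) (d' (block_index psum j)).+1)%N <->
                (exists a : 'I_(p i) -> Cx R, forall j,
                   `|a j| = 1 /\
                   forall z, polydisc z -> g z 0 (block_index psum j) = a j * z 0 i)])].
Proof.
have [own [odep opart osurj]] := owner_exists f_iso m_gt0.
have [psum [s sE]] := block_perm own.
pose p i := #|[set k | own k == i]%SET|.
pose a k := f 0 0 (s k).
have a1 k : disc (a k) by apply/discE; apply: (iso_nm f_iso); exact: polydisc0.
(* Normalisation at the origin: after the permutation, each target factor is moved so that the image
   of 0 becomes 0. *)
exists (fun _ => id), (fun k => moebius (a k)), s; split.
- by move=> i; exact: disc_automorphism_id.
- by move=> k; exact: disc_automorphism_moebius.
move=> g d'.
have gE z k : g z 0 k = moebius (a k) (f z 0 (s k)).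
  rewrite /g /reparam mxE (_ : \row_i z 0 i = z)//.
  by apply/rowP => l; rewrite mxE.
exists p, psum; split.
  by move=> i; have [k <-] := osurj i; apply/card_gt0P; exists k; rewrite inE.
move=> i; pose B := [set k | own k == i]%SET.
have hB k z : k \notin B -> polydisc z -> partial f k i z = 0.
  by rewrite inE; exact: opart.
have oB (j : 'I_#|B|) : own (enum_val j) = i by have := enum_valP j; rewrite inE => /eqP.
have dE (j : 'I_#|B|) : d' (block_index psum j) = d (enum_val j) by rewrite /d' sE.
have dsum : (\sum_(j < p i) (d' (block_index psum j)).+1 = \sum_(k in B) (d k).+1)%N.
  by rewrite [RHS]big_enum_val; apply: eq_bigr => j _; rewrite dE.
have gdep (j : 'I_(p i)) : depends_only_on i (fun z => g z 0 (block_index psum j)).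
  move=> z w pz pw zw; rewrite !gE sE; congr (moebius _ _).
  by apply: odep => //; rewrite oB.
have gslice (j : 'I_(p i)) (t : Cx R) :
    g (upd 0 i t) 0 (block_index psum j) = slice f (enum_val j) i t.
  by rewrite gE /a sE.
have sD k t : disc t -> disc (slice f k i t) by exact: (slice_disc f_iso).
have sH k : holomorphic_on (@disc R) (slice f k i).
  by move=> t dt; have [] := slice_diff f_iso k i dt.
split=> //.
- apply: (@row_isometry R (p i) (c i) _ (fun j => slice f (enum_val j) i)) => //.
  + by move=> j t; exact: sD.
  + move=> t dt; rewrite -(slice_metric f_iso hB dt) [RHS]big_enum_val.
    by apply: eq_bigr => j _; rewrite dE.
  + move=> v j; rewrite mxE -gslice; congr (g _ _ _); apply/rowP => l.
    by rewrite updE !mxE eqxx /= eq_sym; case: eqP; rewrite ?mulr1 ?mulr0.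
- by rewrite dsum; exact: (degree_le f_iso hB).
rewrite dsum; apply: (iff_trans (degree_eq f_iso hB)); split.
  move=> h; have /choice[b hb] : forall j : 'I_(p i), exists b : Cx R, nm b = 1 /\
      forall t, disc t -> slice f (enum_val j) i t = b * t.
    by move=> j; apply/(schwarz_linear (sH _) (sD _) (slice0 _ _ _)); apply: h; exact: enum_valP.
  exists b => j; have [b1 bt] := hb j; split; first by rewrite normE b1.
  (* Since the component depends on z_i only, its value is read off on the i-th axis, where it is
     the slice. *)
  move=> z pz; rewrite -bt// -gslice; apply: gdep => //; last by rewrite updE eqxx.
  exact: slice_polydisc.
move=> [b hb] k kB; apply/(schwarz_linear (sH _) (sD _) (slice0 _ _ _)).
have [j ->] : exists j : 'I_(p i), k = enum_val j.
  by exists (enum_rank_in kB k); rewrite enum_rankK_in.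
have [b1 bt] := hb j; exists (b j); split; first by apply: rcI; rewrite -normE b1.
move=> t dt; rewrite -gslice bt ?updE ?eqxx//; exact: slice_polydisc.
Qed.
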